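(* Let $\mathcal{J}=(a,b)$ be a finite interval, $m\geq3$, $Q\in L_1(\mathcal{J};\mathbb{R})$, and let $\Gamma_1,\Gamma_2:\operatorname{Dom}(L_{\max})\to\mathbb{C}^m$ be the maps defined in the context. For a bounded operator $K$ on $\mathbb{C}^m$ let $L_K$ be the restriction of $L_{\max}$ to $\{y\in\operatorname{Dom}(L_{\max}): (K-I)\Gamma_1y+i(K+I)\Gamma_2y=0\}$. Then for every contraction $K$ on $\mathbb{C}^m$, $L_K$ is a maximal dissipative extension of $L_{\min}$. Conversely, for every maximal dissipative extension $\widetilde L$ of $L_{\min}$ there is a contraction $K$ with $\widetilde L=L_K$. The correspondence between contractions $K$ and maximal dissipative extensions $\widetilde L$ is bijective.
   Context: Quasi-derivatives: $D^{[k]}y=y^{(k)}$ for $k=0,\dots,m-2$; $D^{[m-1]}y=y^{(m-1)}+i^{-m}Qy$; $D^{[m]}y=(D^{[m-1]}y)'-i^{-m}QD^{[1]}y$. $L_{\max}$ acts by $y\mapsto i^mD^{[m]}y$ in $L_2(\mathcal{J};\mathbb{C})$ on $\{y: D^{[k]}y\in AC([a,b];\mathbb{C}),\ k=0,\dots,m-1,\ D^{[m]}y\in L_2\}$; $L_{\min}$ is its restriction to functions with $D^{[k]}y(a)=D^{[k]}y(b)=0$, $k=0,\dots,m-1$ (a closed symmetric operator). The maps: if $m=2n$, $\Gamma_1y=i^{2n}(-D^{[2n-1]}y(a),\dots,(-1)^nD^{[n]}y(a),D^{[2n-1]}y(b),\dots,(-1)^{n-1}D^{[n]}y(b))$ (entries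 $(-1)^kD^{[2n-k]}y(a)$, then $(-1)^{k-1}D^{[2n-k]}y(b)$, $k=1,\dots,n$) and $\Gamma_2y=(D^{[0]}y(a),\dots,D^{[n-1]}y(a),D^{[0]}y(b),\dots,D^{[n-1]}y(b))$; if $m=2n+1$, $\Gamma_1y=i^{2n+1}(-D^{[2n]}y(a),\dots,(-1)^nD^{[n+1]}y(a),D^{[2n]}y(b),\dots,(-1)^{n-1}D^{[n+1]}y(b),D^{[n]}y(b)+D^{[n]}y(a))$ and $\Gamma_2y=(D^{[0]}y(a),\dots,D^{[n-1]}y(a),D^{[0]}y(b),\dots,D^{[n-1]}y(b),\gamma D^{[n]}y(b)+\delta D^{[n]}y(a))$ with $\gamma=\frac{(-1)^n}{2}+i$, $\delta=\frac{(-1)^{n+1}}{2}+i$. A densely defined operator $L$ in a Hilbert space is dissipative if $\operatorname{Im}(Lf,f)\geq0$ for all $f\in\operatorname{Dom}L$, and maximal dissipative if moreover it has no nontrivial dissipative extension in that space. *)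

(* Defs.v *)
(* Complex numbers are mathcomp-real-closed's R[i]. *)
From HB Require Import structures.
From mathcomp Require Import all_boot all_order all_algebra.
From mathcomp Require Import all_classical all_reals all_analysis.
From mathcomp Require Import complex.
Unset Printing Implicit Defensive.
Import Order.TTheory GRing.Theory Num.Theory.
Local Open Scope classical_set_scope.
Local Open Scope ring_scope.
Local Open Scope complex_scope.

(* the imaginary unit of R[i] *)
Definition iC (R : realType) : R[i] := Complex 0 1.

(* |z|^2 as a real number *)
Definition cnorm2 {R : realType} (z : R[i]) : R :=
  complex.Re z ^+ 2 + complex.Im z ^+ 2.

(* u (restricted to [a,b]) is (a representative of) an element of L_2((a,b);C) *)
Definition L2 {R : realType} (a b : R) (u : R -> R[i]) : Prop :=
  measurable_fun `[a, b]%classic (fun x => complex.Re (u x)) /\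
  measurable_fun `[a, b]%classic (fun x => complex.Im (u x)) /\
  (\int[@lebesgue_measure R]_(x in `[a, b]) (cnorm2 (u x))%:E < +oo)%E.

(* equality almost everywhere on (a,b), i.e. equality in L_2((a,b);C) *)
Definition aeeq {R : realType} (a b : R) (u v : R -> R[i]) : Prop :=
  {ae @lebesgue_measure R, forall x, a <= x <= b -> u x = v x}.

(* absolute continuity on [a,b] of a complex-valued function *)
Definition abs_cont {R : realType} (a b : R) (f : R -> R[i]) : Prop :=
  forall e : R, 0 < e -> exists2 d : R, 0 < d &
    forall (n : nat) (x y : 'I_n -> R),
      (forall j, a <= x j /\ x j <= y j /\ y j <= b) ->
      (forall j k, j != k -> y j <= x k \/ y k <= x j) ->
      \sum_(j < n) (y j - x j) < d ->
      \sum_(j < n) `|f (y j) - f (x j)| < e%:C.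

(* f : R -> C has derivative d at x (real variable, complex values) *)
Definition has_cderiv {R : realType} (f : R -> R[i]) (x : R) (d : R[i]) : Prop :=
  is_derive x 1 (fun t => complex.Re (f t)) (complex.Re d) /\
  is_derive x 1 (fun t => complex.Im (f t)) (complex.Im d).

(* z k = D^[k] y (k = 0..m-1, z 0 = y) and f = D^[m] y are the quasi-derivatives:
   D^[k] y = y^(k) (k <= m-2), D^[m-1] y = y^(m-1) + i^{-m} Q y,
   D^[m] y = (D^[m-1] y)' - i^{-m} Q D^[1] y, with D^[k] y in AC[a,b], k < m. *)
Definition qd_data {R : realType} (m : nat) (a b : R) (Q : R -> R)
    (z : nat -> R -> R[i]) (f : R -> R[i]) : Prop :=
  (forall k, (k < m)%N -> abs_cont a b (z k)) /\
  {ae @lebesgue_measure R, forall x, a < x < b ->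
     (forall k, (k.+2 < m)%N -> has_cderiv (z k) x (z k.+1 x)) /\
     has_cderiv (z (m - 2)%N) x (z (m - 1)%N x - (iC R ^- m) * (Q x)%:C * z 0%N x) /\
     has_cderiv (z (m - 1)%N) x (f x + (iC R ^- m) * (Q x)%:C * z 1%N x)}.

(* (u, v) is in the graph of L_max, with quasi-derivative data (z, f) of the
   absolutely continuous representative of u *)
Definition Lmax_data {R : realType} (m : nat) (a b : R) (Q : R -> R)
    (u v : R -> R[i]) (z : nat -> R -> R[i]) (f : R -> R[i]) : Prop :=
  L2 a b u /\ L2 a b v /\ qd_data m a b Q z f /\
  aeeq a b (z 0%N) u /\ aeeq a b v (fun x => iC R ^+ m * f x).

(* operators in L_2((a,b);C), given by their graphs *)
Definition op (R : realType) := (R -> R[i]) -> (R -> R[i]) -> Prop.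

Definition Lmax {R : realType} (m : nat) (a b : R) (Q : R -> R) : op R :=
  fun u v => exists z f, Lmax_data m a b Q u v z f.

Definition Lmin {R : realType} (m : nat) (a b : R) (Q : R -> R) : op R :=
  fun u v => exists z f, Lmax_data m a b Q u v z f /\
    forall k, (k < m)%N -> z k a = 0 /\ z k b = 0.

(* boundary maps Gamma_1, Gamma_2 (m = 2n or m = 2n+1, n = m./2) *)
Definition Gamma1 {R : realType} (m : nat) (a b : R) (z : nat -> R -> R[i])
    : 'cV[R[i]]_m :=
  let n := m./2 in
  \col_(j < m) (iC R ^+ m *
    (if (j < n)%N then (-1) ^+ j.+1 * z (m - 1 - j)%N a
     else if (j < 2 * n)%N then (-1) ^+ (j - n) * z (m - 1 - (j - n))%N b
     else z n b + z n a)).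

Definition Gamma2 {R : realType} (m : nat) (a b : R) (z : nat -> R -> R[i])
    : 'cV[R[i]]_m :=
  let n := m./2 in
  let gamma : R[i] := (-1) ^+ n / 2 + iC R in
  let delta : R[i] := (-1) ^+ n.+1 / 2 + iC R in
  \col_(j < m)
    (if (j < n)%N then z j a
     else if (j < 2 * n)%N then z (j - n)%N b
     else gamma * z n b + delta * z n a).

(* L_K : restriction of L_max to (K - I) Gamma_1 y + i (K + I) Gamma_2 y = 0 *)
Definition LK {R : realType} (m : nat) (a b : R) (Q : R -> R)
    (K : 'M[R[i]]_m) : op R :=
  fun u v => exists z f, Lmax_data m a b Q u v z f /\
    (K - 1%:M) *m Gamma1 m a b z + iC R *: ((K + 1%:M) *m Gamma2 m a b z) = 0.

(* a linear (single-valued) operator in L_2((a,b);C), graph closed under a.e. equality *)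
Definition is_operator {R : realType} (a b : R) (G : op R) : Prop :=
  (forall u v, G u v -> L2 a b u /\ L2 a b v) /\
  (forall u v u' v', G u v -> L2 a b u' -> L2 a b v' ->
     aeeq a b u u' -> aeeq a b v v' -> G u' v') /\
  G (fun _ => 0) (fun _ => 0) /\
  (forall u v u' v', G u v -> G u' v' ->
     G (fun x => u x + u' x) (fun x => v x + v' x)) /\
  (forall (c : R[i]) u v, G u v -> G (fun x => c * u x) (fun x => c * v x)) /\
  (forall u v v', G u v -> G u v' -> aeeq a b v v').

Definition densely_defined {R : realType} (a b : R) (G : op R) : Prop :=
  forall w, L2 a b w -> forall e : R, 0 < e -> exists u v, G u v /\
    (\int[@lebesgue_measure R]_(x in `[a, b]) (cnorm2 (w x - u x))%:E < e%:E)%E.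

(* Im (L f, f) >= 0, with (g, h) = int_a^b g * conj h *)
Definition dissipative {R : realType} (a b : R) (G : op R) : Prop :=
  densely_defined a b G /\
  forall u v, G u v ->
    (0 <= \int[@lebesgue_measure R]_(x in `[a, b]) (complex.Im (v x * (u x)^*))%:E)%E.

Definition op_extends {R : realType} (G H : op R) : Prop :=
  forall u v, G u v -> H u v.

Definition maximal_dissipative {R : realType} (a b : R) (G : op R) : Prop :=
  is_operator a b G /\ dissipative a b G /\
  forall G', is_operator a b G' -> dissipative a b G' -> op_extends G G' -> op_extends G' G.

Definition same_op {R : realType} (G H : op R) : Prop :=
  forall u v, G u v <-> H u v.

(* mx_contraction on C^m w.r.t. the Euclidean norm *)
Definition vnorm2 {R : realType} (m : nat) (v : 'cV[R[i]]_m) : R :=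
  \sum_(j < m) cnorm2 (v j 0).

Definition mx_contraction {R : realType} (m : nat) (K : 'M[R[i]]_m) : Prop :=
  forall v : 'cV[R[i]]_m, vnorm2 m (K *m v) <= vnorm2 m v.

(* Main.v *)
(* Put p = Gamma1 y + i Gamma2 y and q = Gamma1 y - i Gamma2 y.  Green's identity
   gives 4 Im (Ly, y) = |p|^2 - |q|^2, and the boundary condition reads K p = q.

   If K is a contraction, L_K is therefore dissipative.  Moreover y |-> K p - q is
   injective on the m-dimensional kernel of L_max + i, hence onto, so L_K + i is
   onto; this excludes proper dissipative extensions, and makes the domain of L_K
   dense because no nonzero vector can be orthogonal to it.

   Conversely, a dissipative extension of L_min is contained in the adjoint of
   L_min, which is L_max: the range of L_min is the orthogonal complement of the
   m-dimensional kernel of L_max.  The pairs (p, q) of its elements form a linear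
   relation with |q| <= |p|, which orthogonal projection extends to the graph of a
   contraction K; maximality then forces equality with L_K.

   K is unique because y |-> (p, q) maps ker (L_max - i) + ker (L_max + i)
   injectively, hence onto, C^m x C^m. *)
Require Import Defs.
From HB Require Import structures.
From mathcomp Require Import all_boot all_order all_algebra.
From mathcomp Require Import all_classical all_reals all_analysis.
From mathcomp Require Import measurable_realfun complex ring lra zify.
Import Order.TTheory GRing.Theory Num.Theory.
Import numFieldNormedType.Exports.
Local Open Scope classical_set_scope.
Local Open Scope ring_scope.

Local Notation mu := (@lebesgue_measure _).
Local Notation Re := complex.Re.
Local Notation Im := complex.Im.

(** * Absolutely continuous functions *)

(** With Q merely integrable, the quasi-derivatives solve a first-order linear system only almost
    everywhere. The analytic input is therefore twofold: an absolutely continuous function is the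
    integral of its derivative, which yields Green's identity, and a linear system with L_1
    coefficients has absolutely continuous solutions with any prescribed values at a. The latter
    provides, for every complex la, m independent elements of ker (L_max - la).

    What remains is linear algebra: each surjectivity claim becomes injectivity of a square matrix.
    For la = i and la = -i its kernel is killed by Green's identity, which turns vanishing or signed
    boundary terms into a statement about the squared norm of y. For la = 0 the matrices are the
    Gram matrix of the kernel and the matrix of its values at b.

    The factor 4 is polarization: |g + ih|^2 - |g - ih|^2 = 4 Im (g, h). Elements of L_2 are
    functions compared by [aeeq]; boundary values belong to the absolutely continuous
    representative, which the class determines. *)

Definition ac {R : realType} (a b : R) (f : R -> R) : Prop :=
  forall e : R, 0 < e -> exists2 d : R, 0 < d &
    forall (n : nat) (x y : 'I_n -> R),
      (forall j, a <= x j /\ x j <= y j /\ y j <= b) ->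
      (forall j k, j != k -> y j <= x k \/ y k <= x j) ->
      \sum_(j < n) (y j - x j) < d ->
      \sum_(j < n) `|f (y j) - f (x j)| < e.

(** At the supremum of the points where [P] holds, the hypothesis carries [P] from a point just
    before it to a point just after it. Stating the step for all s <= x <= t, as for tagged
    partitions, makes a radius around each [x] sufficient. *)
Lemma real_induction {R : realType} (P : R -> Prop) (a b : R) : a <= b -> P a ->
  (forall x, a <= x <= b -> exists2 r : R, 0 < r & forall s t,
     a <= s -> s <= x -> x <= t -> t <= b -> x - s < r -> t - x < r ->
     P s -> P t) ->
  P b.
Proof.
move=> ab Pa H.
pose S := [set t | a <= t <= b /\ P t].
have Sa : S a by split => //; rewrite lexx ab.
have hS : has_sup S.
  by split; [exists a | exists b => t [/andP[_ ?] _]].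
have aT : a <= sup S by apply: ub_le_sup => //; exact: hS.2.
have Tb : sup S <= b by apply: ge_sup; [exists a|move=> t [/andP[_ ?] _]].
have [|r r0 Hr] := H (sup S); first by rewrite aT Tb.
have [s [/andP[sa sb] Ps] Ts] := sup_adherent r0 hS.
have sT : s <= sup S by apply: ub_le_sup; [exact: hS.2 | split; rewrite ?sa].
have PT t : sup S <= t -> t <= b -> t - sup S < r -> P t.
  by move=> h1 h2 h3; apply: (Hr s t) => //; lra.
have [Tb'|Tb'] := ltP (sup S) b; last first.
  by apply: PT => //; lra.
pose t := Num.min b (sup S + r / 2).
have tb : t <= b by rewrite /t ge_min lexx.
have tT : sup S < t by rewrite /t lt_min Tb' /=; lra.
have tr : t <= sup S + r / 2 by rewrite /t ge_min lexx orbT.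
have : t <= sup S.
  apply: ub_le_sup; first exact: hS.2.
  split; first by rewrite tb andbT; lra.
  by apply: PT; lra.
lra.
Qed.

(** Lists can grow by one interval at a time, which real induction requires. New intervals are put
    at the head, so later entries lie further to the left. *)
Lemma ac_seq {R : realType} (a b : R) (f : R -> R) (e : R) : ac a b f -> 0 < e ->
  exists2 d : R, 0 < d & forall s : seq (R * R),
    all (fun p => [&& a <= p.1, p.1 <= p.2 & p.2 <= b]) s ->
    pairwise (fun p q => q.2 <= p.1) s ->
    \sum_(p <- s) (p.2 - p.1) < d ->
    \sum_(p <- s) `|f p.2 - f p.1| < e.
Proof.
move=> acf e0; have [d d0 H] := acf e e0; exists d => // s sA sP.
rewrite !(big_nth (a, a)) !big_mkord => sd.
apply: (H (size s) (fun j => (nth (a, a) s j).1) (fun j => (nth (a, a) s j).2)) => //.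
- by move=> j; have /(_ _ (ltn_ord j))/and3P[] := all_nthP (a, a) sA.
- move=> j k jk; have /(pairwiseP (a, a)) Hp := sP.
  have [jk'|kj'] : (j < k)%N \/ (k < j)%N.
    by apply/orP; rewrite -neq_ltn.
  + by right; apply: Hp; rewrite ?inE ?ltn_ord.
  + by left; apply: Hp; rewrite ?inE ?ltn_ord.
Qed.

Lemma ae_itv_ex {R : realType} (P : R -> Prop) (c d : R) : c < d ->
  {ae mu, forall x, P x} -> exists2 x, c < x < d & P x.
Proof.
move=> cd [N [mN N0 PN]]; apply: contrapT => nex.
have sub : `]c, d[ `<=` N.
  move=> x /=; rewrite in_itv /= => xcd; apply: PN => /= Px.
  by apply: nex; exists x.
have : (mu `]c, d[ <= mu N)%E by apply: le_measure => //; rewrite inE.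
by rewrite N0 lebesgue_measure_itv /= lte_fin cd -EFinD lee_fin; lra.
Qed.

(* [h t] is the measure of the part in [a, t] of an open set of measure less
   than [d] containing [N]. *)
Lemma outer_gauge {R : realType} (N : set R) (a b d : R) : a <= b -> 0 < d ->
  mu.-negligible N ->
  exists h : R -> R, [/\ h a = 0, h b < d, {in `[a, b] &, {homo h : s t / s <= t}} & forall x, N x ->
    exists2 r : R, 0 < r & forall s t, a <= s -> s <= x -> x <= t -> t <= b ->
      x - s < r -> t - x < r -> t - s <= h t - h s].
Proof.
move=> ab d0 [M [mM M0_ NM]]; have M0 : (@lebesgue_measure R) M = 0%E := M0_.
have Moo : (@lebesgue_measure R M < +oo)%E by rewrite M0 ltry.
have [U [oU MU Ud_]] := @lebesgue_regularity_outer R M d mM Moo d0.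
have Ud : (@lebesgue_measure R (U `\` M) < d%:E)%E := Ud_.
have mU : measurable U by exact: open_measurable.
have mUd : (mu U < d%:E)%E.
  have -> : U = (U `\` M) `|` M.
    apply/seteqP; split => x; first by have [Mx|nMx] := pselect (M x); [right|left].
    by case=> [[]//|/MU].
  apply: le_lt_trans Ud.
  rewrite -[leRHS]adde0 -M0; apply: measureU2 => //.
  exact: measurableD.
have fin A : measurable A -> (mu (U `&` A) \is a fin_num).
  move=> mA; rewrite ge0_fin_numE//; apply: le_lt_trans (ltry d).
  by apply: le_trans (ltW mUd); apply: le_measure; rewrite ?inE//; exact: measurableI.
exists (fun t => fine (mu (U `&` `]a, t]))); split.
- by rewrite set_itvoc0 setI0 measure0.
- rewrite -lte_fin fineK ?fin//; apply: le_lt_trans mUd.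
  by apply: le_measure; rewrite ?inE//; exact: measurableI.
- move=> s t sab tab st; apply: fine_le; [exact: fin|exact: fin|].
  apply: le_measure; rewrite ?inE; [exact: measurableI|exact: measurableI|].
  by apply: setIS => y /=; rewrite !in_itv/= => /andP[-> ys] /=; lra.
- move=> x Nx; have /oU : U x by exact/MU/NM.
  (* Any interval around [x] within this radius lies in the open set [U], so it adds its full length
     to the measure. *)
  rewrite /interior /= => /nbhs_ballP[r /= r0 rU].
  exists r => // s t sa sx xt tb xs tx.
  have st : s <= t by lra.
  have sub : (U `&` `]a, s]) `|` `]s, t] `<=` U `&` `]a, t].
    move=> y [[Uy]|] /=; rewrite !in_itv/= => /andP[h1 h2].
      by split => //; rewrite h1/=; lra.
    split; last by apply/andP; split; lra.
    by apply: rU; rewrite /ball /= ltr_norml; apply/andP; split; lra.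
  pose A : set R := U `&` `]a, s]%classic; pose B : set R := `]s, t]%classic.
  pose C : set R := U `&` `]a, t]%classic.
  have mA : measurable A by exact: measurableI.
  have mC : measurable C by exact: measurableI.
  have mB : measurable B by exact: measurable_itv.
  have AB : A `&` B = set0.
    rewrite -subset0 => y [[_]] /=; rewrite /B /= !in_itv/= => /andP[_ h] /andP[h' _].
    lra.
  have le1 : (@lebesgue_measure R (A `|` B) <= @lebesgue_measure R C)%E.
    apply: le_measure; rewrite ?inE//; exact: measurableU.
  have e1 : (@lebesgue_measure R (A `|` B) =
      @lebesgue_measure R A + @lebesgue_measure R B)%E by rewrite measureU.
  have e2 : (@lebesgue_measure R B = (t - s)%:E)%E.
    rewrite lebesgue_measure_itv/= lte_fin; case: ifPn => // h.
    by rewrite (_ : t = s) ?subrr//; lra.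
  have fA : @lebesgue_measure R A \is a fin_num by exact: fin.
  have fC : @lebesgue_measure R C \is a fin_num by exact: fin.
  move: le1; rewrite e1 e2 -(fineK fA) -(fineK fC) -EFinD lee_fin -/A -/C; lra.
Qed.
Lemma is_derive_approx {R : realType} (f : R -> R) (x l e : R) :
  is_derive x 1 f l -> 0 < e ->
  exists2 r, 0 < r & forall y, `|y - x| < r ->
    `|f y - f x - l * (y - x)| <= e * `|y - x|.
Proof.
move=> [df dl] e0.
have : (fun h => h^-1 *: ((f \o shift x) (h *: 1) - f x)) @ 0^' --> l by rewrite -dl.
move/cvgrPdist_le => /(_ e e0); rewrite /dnbhs /within/= => /nbhs_ballP[r /= r0 Hr].
exists r => // y yr; have [->|yx] := eqVneq y x; first by rewrite !subrr mulr0 subr0 normr0 mulr0.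
have yx0 : y - x != 0 by rewrite subr_eq0.
have := Hr (y - x); rewrite /ball /= sub0r normrN => /(_ yr yx0).
rewrite /shift /= [(y - x) *: 1]mulr1 subrK => H.
have -> : f y - f x - l * (y - x) = - (l - (y - x)^-1 *: (f y - f x)) * (y - x).
  by rewrite /GRing.scale /=; field.
by rewrite normrM normrN ler_wpM2r.
Qed.

(* The increment of [f] over [a, t] is at most [e * (t - a)] plus the increments
   over disjoint intervals of small total length that cover the exceptional null
   set; these are propagated from [a] to [b] by real induction. *)
Lemma ac_zero_derivative {R : realType} (a b : R) (f : R -> R) : a <= b -> ac a b f ->
  {ae mu, forall x : R, a < x < b -> is_derive x 1 f 0} -> f b = f a.
Proof.
move=> ab acf dae.
(* The part e * (b - a) pays for the points where the derivative is 0, the last e for the total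
   increment over the exceptional intervals. *)
suff H e : 0 < e -> `|f b - f a| <= e * (b - a + 1).
  apply/eqP; rewrite -subr_eq0 -normr_le0; apply/ler_addgt0Pl => e e0.
  have c0 : 0 < b - a + 1 by lra.
  have := H (e / (b - a + 1)) (divr_gt0 e0 c0).
  by rewrite divfK ?addr0//; lra.
move=> e0; have [d d0 Hd] := ac_seq a b f e acf e0.
(* The endpoints join the exceptional set because the derivative is known only inside (a, b). *)
pose N := [set x | ~ (a < x < b -> is_derive x 1 f 0)] `|` ([set a] `|` [set b]).
have nN : (@lebesgue_measure R).-negligible N.
  apply: negligibleU; first exact: dae.
  by apply: negligibleU; apply/negligibleP => //; exact: lebesgue_measure_set1.
have [h [ha hb hm hN]] := outer_gauge N a b d ab d0 nN.
pose P t := exists s : seq (R * R), [/\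
    all (fun p => [&& a <= p.1, p.1 <= p.2 & p.2 <= t]) s,
    pairwise (fun p q => q.2 <= p.1) s,
    \sum_(p <- s) (p.2 - p.1) <= h t &
    `|f t - f a| <= e * (t - a) + \sum_(p <- s) `|f p.2 - f p.1|].
suff [s [s1 s2 s3 s4]] : P b.
  by have := Hd s s1 s2 (le_lt_trans s3 hb); rewrite mulrDr mulr1; lra.
apply: (real_induction P a b ab).
  by exists nil; split => //; rewrite big_nil ?ha// !subrr normr0 mulr0 addr0.
move=> x /andP[ax xb]; have [Nx|Nx] := pselect (N x).
  have [r r0 Hr] := hN x Nx; exists r => // u t au ux xt tb ur tr [s [s1 s2 s3 s4]].
  exists ((u, t) :: s); split => /=.
  - rewrite au lexx andbT /=; apply/andP; split; first lra.
    by apply: sub_all s1 => p /and3P[-> -> h1] /=; lra.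
  - by rewrite s2 andbT; apply: sub_all s1 => p /and3P[_ _]; exact.
  - by rewrite big_cons/=; have := Hr u t au ux xt tb ur tr; lra.
  - rewrite big_cons/=; have := ler_normD (f t - f u) (f u - f a).
    rewrite addrA subrK; have : 0 <= e * (t - u) by apply: mulr_ge0; lra.
    move: s4; rewrite !mulrBr; lra.
have {}ax : a < x.
  by rewrite lt_neqAle ax andbT; apply/eqP => E; apply: Nx; right; left; rewrite /= E.
have {}xb : x < b.
  by rewrite lt_neqAle xb andbT; apply/eqP => E; apply: Nx; right; right; rewrite /= E.
have dx : is_derive x 1 f 0.
  by apply: contrapT => nd; apply: Nx; left => /= H; apply: nd; apply: H; rewrite ax xb.
have [r r0 Hr] := is_derive_approx f x 0 e dx e0.
exists r => // u t au ux xt tb ur tr [s [s1 s2 s3 s4]].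
exists s; split => //.
- by apply: sub_all s1 => p /and3P[-> -> h1] /=; lra.
- have : h u <= h t.
    by apply: hm; rewrite ?in_itv/=; lra.
  lra.
- have := Hr t; have := Hr u; rewrite !mul0r !subr0.
  rewrite [`|t - x|]ger0_norm ?[`|u - x|]ler0_norm; [|lra|lra].
  rewrite (distrC (f u)).
  have := ler_normD (f t - f x) (f x - f u); have := ler_normD (f t - f u) (f u - f a).
  rewrite !addrA !subrK => h1 h2 /(_ ltac:(lra)) h3 /(_ ltac:(lra)) h4.
  move: s4 h1 h2 h3 h4; rewrite !mulrDr !mulrN; lra.
Qed.

(** * Integrals over an interval and primitives *)

Definition intg {R : realType} (a b : R) (f : R -> R) : Prop :=
  (@lebesgue_measure R).-integrable `[a, b] (EFin \o f).

Definition rint {R : realType} (a b : R) (f : R -> R) : R :=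
  \int[@lebesgue_measure R]_(x in `[a, b]) f x.

Lemma ac_sub {R : realType} (a b c d : R) (f : R -> R) : a <= c -> d <= b ->
  ac a b f -> ac c d f.
Proof.
move=> ac_ db H e e0; have [r r0 Hr] := H e e0; exists r => // n x y h1 h2 h3.
apply: Hr => // j; have [] := h1 j; lra.
Qed.

Lemma ac_eq {R : realType} (a b : R) (f g : R -> R) :
  (forall x, a <= x <= b -> f x = g x) -> ac a b f -> ac a b g.
Proof.
move=> fg H e e0; have [r r0 Hr] := H e e0; exists r => // n x y h1 h2 h3.
have := Hr n x y h1 h2 h3; congr (_ < _); apply: eq_bigr => j _.
by have [h4 [h5 h6]] := h1 j; rewrite !fg//; apply/andP; split; lra.
Qed.

Lemma ac_dominated {R : realType} (a b L : R) (f g h : R -> R) : 0 <= L ->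
  ac a b f -> ac a b g ->
  (forall x y, a <= x -> x <= y -> y <= b ->
     `|h y - h x| <= L * (`|f y - f x| + `|g y - g x|)) ->
  ac a b h.
Proof.
move=> L0 acf acg H e e0.
(* The factor 2 splits [e] between [f] and [g]; L + 1 keeps the divisor positive when L = 0. *)
have c0 : 0 < e / (2 * (L + 1)) by apply: divr_gt0 => //; lra.
have [r r0 Hr] := acf _ c0; have [s s0 Hs] := acg _ c0.
exists (Num.min r s); first by rewrite lt_min r0.
move=> n x y h1 h2; rewrite lt_min => /andP[hr hs].
have {Hr} := Hr n x y h1 h2 hr; have {Hs} := Hs n x y h1 h2 hs.
set A := \sum_(_ < _) _; set B := \sum_(_ < _) _ => HA HB.
have E : e = (L + 1) * (2 * (e / (2 * (L + 1)))) by field; lra.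
apply: (@le_lt_trans _ _ ((L + 1) * (B + A))); last first.
  by rewrite [X in _ < X]E ltr_pM2l; lra.
rewrite /A /B -big_split mulr_sumr /=; apply: ler_sum => j _.
have [ax [xy yb]] := h1 j; apply: le_trans (H _ _ ax xy yb) _.
by apply: ler_wpM2r; [apply: addr_ge0|lra].
Qed.

Lemma ac_cst {R : realType} (a b c : R) : ac a b (fun=> c).
Proof.
move=> e e0; exists 1 => // n x y _ _ _.
by rewrite big1// => j _; rewrite subrr normr0.
Qed.

Lemma acD {R : realType} (a b : R) (f g : R -> R) :
  ac a b f -> ac a b g -> ac a b (fun x => f x + g x).
Proof.
move=> acf acg; apply: (ac_dominated a b 1 f g) => // x y _ _ _; rewrite mul1r.
have -> : f y + g y - (f x + g x) = f y - f x + (g y - g x) by ring.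
exact: ler_normD.
Qed.

Lemma ac_scale {R : realType} (a b c : R) (f : R -> R) :
  ac a b f -> ac a b (fun x => c * f x).
Proof.
move=> acf; apply: (ac_dominated a b `|c| f f) => // x y _ _ _.
by rewrite -mulrBr normrM ler_wpM2l// lerDl.
Qed.

Lemma ac_unif {R : realType} (a b : R) (f : R -> R) (e : R) : ac a b f -> 0 < e ->
  exists2 d, 0 < d & forall x y, a <= x <= b -> a <= y <= b -> `|y - x| < d ->
    `|f y - f x| < e.
Proof.
move=> acf e0; have [d d0 H] := acf e e0; exists d => //.
have H1 x y : a <= x -> x <= y -> y <= b -> y - x < d -> `|f y - f x| < e.
  move=> ax xy yb dxy; have := H 1%N (fun=> x) (fun=> y).
  rewrite !big_ord1; apply => //.
  by move=> j k; rewrite !ord1.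
move=> x y /andP[ax xb] /andP[ay yb]; rewrite ltr_norml => /andP[h1 h2].
have [xy|yx] := leP x y; first by apply: H1.
by rewrite distrC; apply: H1 => //; lra.
Qed.

Lemma ac_bounded {R : realType} (a b : R) (f : R -> R) : ac a b f ->
  exists2 M, 0 <= M & forall x, a <= x <= b -> `|f x| <= M.
Proof.
move=> acf; have [ab|ba] := leP a b; last first.
  by exists 0 => // x /andP[h1 h2]; lra.
have [d d0 H] := ac_unif a b f 1 acf ltr01.
apply: (real_induction (fun t => exists2 M, 0 <= M & forall x, a <= x <= t -> `|f x| <= M) a b ab).
  by exists `|f a| => // x ?; have -> : x = a by lra.
move=> x /andP[ax xb]; exists d => // s t as_ sx xt tb h1 h2 [M M0 HM].
exists (M + (`|f x| + 1)); first by have := normr_ge0 (f x); lra.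
move=> y /andP[ay yt]; have [ys|sy] := leP y s.
  by have := HM y; rewrite ay ys => /(_ isT); have := normr_ge0 (f x); lra.
have : `|f y - f x| < 1.
  by apply: H; rewrite ?ltr_norml; apply/andP; split; lra.
have := ler_normD (f y - f x) (f x); rewrite subrK; lra.
Qed.

Lemma acM {R : realType} (a b : R) (f g : R -> R) :
  ac a b f -> ac a b g -> ac a b (fun x => f x * g x).
Proof.
move=> acf acg; have [M M0 HM] := ac_bounded _ _ _ acf.
have [N N0 HN] := ac_bounded _ _ _ acg.
apply: (ac_dominated a b (M + N) f g) => //; first by lra.
move=> x y ax xy yb.
have -> : f y * g y - f x * g x = f y * (g y - g x) + g x * (f y - f x) by ring.
apply: le_trans (ler_normD _ _) _; rewrite !normrM mulrDr addrC.
apply: lerD; apply: ler_wpM2r => //.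
  by apply: le_trans (HN x _) _; [apply/andP; split; lra|lra].
by apply: le_trans (HM y _) _; [apply/andP; split; lra|lra].
Qed.

(** Composed with the retraction [k] of the line onto [a, b], the function becomes continuous
    everywhere, hence measurable. *)
Lemma ac_measurable {R : realType} (a b : R) (f : R -> R) :
  ac a b f -> measurable_fun `[a, b] f.
Proof.
move=> acf; have [ab|ba] := leP a b; last first.
  by rewrite set_itv_ge ?bnd_simp -?ltNge//; exact: measurable_fun_set0.
pose k (x : R) := Num.max a (Num.min x b).
have kab x : a <= k x <= b.
  by rewrite /k le_max lexx /= ge_max ab ge_min lexx orbT.
have kd x y : `|k x - k y| <= `|x - y|.
  have n1 := ler_norm (x - y); have n2 := lerNnormlW (lexx `|x - y|).
  rewrite ler_norml /k; case: (leP x b) => ?; case: (leP y b) => ?;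
  case: (leP a x) => ?; case: (leP a y) => ?; case: (leP a b) => ?;
  apply/andP; split; lra.
have kx x : a <= x <= b -> k x = x.
  by move=> /andP[ax xb]; rewrite /k min_l// max_r.
have mg : measurable_fun setT (f \o k).
  apply: continuous_measurable_fun => x; apply/cvgrPdist_lt => e e0.
  have [d d0 H] := ac_unif a b f e acf e0.
  near=> y; apply: H => //; apply: le_lt_trans (kd _ _) _.
  by near: y; apply/nbhs_ballP; exists d.
have := measurable_funS measurableT (@subsetT _ `[a, b]) mg.
by apply: eq_measurable_fun => x; rewrite inE /= in_itv /= => /kx ->.
Unshelve. all: by end_near.
Qed.

Lemma mu_itv_lty {R : realType} (a b : R) : (@lebesgue_measure R `[a, b] < +oo)%E.
Proof. by rewrite lebesgue_measure_itv/=; case: ifP => // _; exact: ltry. Qed.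

Lemma aeS {R : realType} (P Q : R -> Prop) : (forall x, P x -> Q x) ->
  {ae @lebesgue_measure R, forall x, P x} -> {ae @lebesgue_measure R, forall x, Q x}.
Proof. by move=> PQ; apply: negligibleS => x /= nQ /PQ. Qed.

Lemma aeS2 {R : realType} (P Q T : R -> Prop) : (forall x, P x -> Q x -> T x) ->
  {ae @lebesgue_measure R, forall x, P x} -> {ae @lebesgue_measure R, forall x, Q x} ->
  {ae @lebesgue_measure R, forall x, T x}.
Proof.
move=> PQT hP hQ; have := negligibleU hP hQ; apply: negligibleS => x /= nT.
by have [Px|] := pselect (P x); [right => /(PQT x Px)|left].
Qed.

Lemma measurable_bigU {R : realType} (I : Type) (s : seq I) (F : I -> set R) :
  (forall i, measurable (F i)) -> measurable (\big[setU/set0]_(j <- s) F j).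
Proof.
move=> mF; elim: s => [|j s IH]; rewrite ?big_nil ?big_cons; first exact: measurable0.
exact: measurableU.
Qed.

(** The integrand is cut off outside [a, b] so that it is integrable on every [[a, y]], as [FTC1]
    demands. *)
Definition prim {R : realType} (a b : R) (g : R -> R) (x : R) : R :=
  \int[@lebesgue_measure R]_(t in `[a, x]) (g \_ `[a, b]) t.

Lemma intg_sub {R : realType} (a b c d : R) (g : R -> R) : a <= c -> d <= b ->
  intg a b g -> intg c d g.
Proof.
move=> ac_ db; apply: integrableS => //.
by move=> x /=; rewrite !in_itv/= => /andP[h1 h2]; apply/andP; split; lra.
Qed.

Lemma intg_patch {R : realType} (a b : R) (g : R -> R) : intg a b g ->
  (@lebesgue_measure R).-integrable setT (EFin \o (g \_ `[a, b])).
Proof.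
move=> ig; have := (@integrable_mkcond _ _ R mu `[a, b] (EFin \o g) (measurable_itv _)).1 ig.
by congr (integrable _ _ _); apply/funext => x /=; rewrite /patch; case: ifP.
Qed.

Lemma primE {R : realType} (a b x : R) (g : R -> R) : x <= b ->
  prim a b g x = rint a x g.
Proof.
move=> xb; apply: eq_Rintegral => t; rewrite inE /= in_itv /= => /andP[h1 h2].
by rewrite patchE mem_set// /= in_itv/= h1; lra.
Qed.

Lemma prim_a {R : realType} (a b : R) (g : R -> R) : prim a b g a = 0.
Proof. by rewrite /prim set_itv1 Rintegral_set1. Qed.

Lemma primB {R : realType} (a b x y : R) (g : R -> R) : intg a b g ->
  a <= x -> x <= y ->
  prim a b g y - prim a b g x = \int[mu]_(t in `]x, y]) (g \_ `[a, b]) t.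
Proof.
move=> ig ax xy; apply: Rintegral_itvB.
- by apply: integrableS (intg_patch _ _ _ ig).
- by rewrite bnd_simp.
- by rewrite bnd_simp.
Qed.

(** Absolute continuity of the Lebesgue integral, applied to the union of the given intervals. *)
Lemma prim_ac {R : realType} (a b : R) (g : R -> R) : intg a b g ->
  ac a b (prim a b g).
Proof.
move=> ig e e0; set G := g \_ `[a, b].
have iG : (@lebesgue_measure R).-integrable setT (EFin \o G) by exact: intg_patch.
have [d [d0 Hd]] := integral_normr_continuous iG e0.
exists d => // n x y h1 h2 h3.
(* Half-open intervals remain disjoint when they share an endpoint. *)
pose F (j : 'I_n) : set R := `]x j, y j]%classic.
have mF j : measurable (F j) by exact: measurable_itv.
have iF A : measurable A -> (@lebesgue_measure R).-integrable A (EFin \o G).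
  by move=> mA; apply: integrableS iG.
have mG : measurable_fun setT G.
  by have /integrableP[/measurable_EFinP] := iG.
have tF : trivIset [set` index_enum 'I_n] F.
  apply/trivIsetP => j k _ _ jk; rewrite -subset0 => t [] /=.
  rewrite /F /= !in_itv/= => /andP[h4 h5] /andP[h6 h7].
  by have [] := h2 j k jk; lra.
set U := \big[setU/set0]_(j <- index_enum 'I_n) F j.
have mU : measurable U by exact: measurable_bigU.
have muF j : @lebesgue_measure R (F j) = (y j - x j)%:E.
  rewrite /F lebesgue_measure_itv/= lte_fin; have [_ [h4 _]] := h1 j.
  by case: ifPn => // h; rewrite (_ : y j = x j) ?subrr//; lra.
have muU : (@lebesgue_measure R U < d%:E)%E.
  apply: (@le_lt_trans _ _ (\sum_(j <- index_enum 'I_n) (y j - x j)%:E)%E); last first.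
    by rewrite sumEFin lte_fin.
  rewrite /U; elim: (index_enum 'I_n) => [|j s IH].
    by rewrite !big_nil measure0.
  rewrite !big_cons -muF; apply: le_trans (leeD2l _ IH).
  by apply: measureU2; [exact: mF|exact: measurable_bigU].
have := Hd U mU muU; apply: le_lt_trans.
have -> : \int[mu]_(t in U) `|G t| = \sum_(j < n) \int[mu]_(t in F j) `|G t|.
  rewrite /Rintegral /U integral_bigsetU_EFin//; last 2 first.
  - by rewrite index_enum_uniq.
  - apply/measurable_EFinP; apply: measurable_funTS; exact: measurableT_comp.
  rewrite -sum_fine// => j _; apply: integrable_fin_num;
  [exact: mF|exact: (integrable_norm (iF _ (mF j)))].
apply: ler_sum => j _; have [h4 [h5 h6]] := h1 j.
rewrite primB//; apply: le_normr_Rintegral => //; exact: iF.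
Qed.

Lemma prim_derive {R : realType} (a b : R) (g : R -> R) : intg a b g ->
  {ae @lebesgue_measure R, forall x : R, a < x < b -> is_derive x 1 (prim a b g) (g x)}.
Proof.
move=> ig; have iG := intg_patch _ _ _ ig.
have i1 y : (@lebesgue_measure R).-integrable `[a, y] (EFin \o (g \_ `[a, b])).
  exact: integrableS iG.
have i2 : locally_integrable setT (g \_ `[a, b]).
  exact: (integrable_locally (measurable_itv _) ig).
have := @FTC1 R (g \_ `[a, b]) (BLeft a) i1 i2.
apply: aeS => x Hx /andP[ax xb]; have [] := Hx _; first by rewrite (_ : (_ < _)%E = (BLeft a < BRight x)%O)// bnd_simp ltW.
by move=> d1; rewrite derive1E patchE mem_set /= ?in_itv /= ?(ltW ax) ?(ltW xb).
Qed.

Lemma intg_measurable {R : realType} (a b : R) (f : R -> R) : intg a b f ->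
  measurable_fun `[a, b] f.
Proof. by move=> /integrableP[/measurable_EFinP]. Qed.

Lemma le_intg {R : realType} (a b : R) (f g : R -> R) : measurable_fun `[a, b] f ->
  (forall x, a <= x <= b -> `|f x| <= g x) -> intg a b g -> intg a b f.
Proof.
move=> mf fg; apply: le_integrable => //; first exact/measurable_EFinP.
move=> x /=; rewrite in_itv/= => xab; rewrite lee_fin.
by apply: le_trans (fg x xab) _; exact: ler_norm.
Qed.

Lemma intgD {R : realType} (a b : R) (f g : R -> R) : intg a b f -> intg a b g ->
  intg a b (fun x => f x + g x).
Proof.
move=> h1 h2; rewrite /intg (_ : EFin \o _ = ((EFin \o f) \+ (EFin \o g))%E)//.
exact: integrableD.
Qed.

Lemma intgZ {R : realType} (a b c : R) (f : R -> R) : intg a b f ->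
  intg a b (fun x => c * f x).
Proof.
move=> h1; rewrite /intg (_ : EFin \o _ = (fun x => c%:E * (EFin \o f) x)%E)//.
exact: integrableZl.
Qed.

Lemma intgN {R : realType} (a b : R) (f : R -> R) : intg a b f ->
  intg a b (fun x => - f x).
Proof. by move=> h1; have := integrableN h1. Qed.

Lemma intg_cst {R : realType} (a b c : R) : intg a b (fun=> c).
Proof.
apply: measurable_bounded_integrable => //.
- exact: mu_itv_lty.
- by exists `|c|; split => // y cy x _; rewrite /= ltW.
Qed.

Lemma intg_sum {R : realType} (a b : R) (I : Type) (s : seq I) (f : I -> R -> R) :
  (forall i, intg a b (f i)) -> intg a b (fun x => \sum_(i <- s) f i x).
Proof.
move=> H; elim: s => [|i s IH].
  by have := intg_cst a b 0; congr (integrable _ _ _); apply/funext => x /=; rewrite big_nil.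
have := intgD _ _ _ _ (H i) IH.
by congr (integrable _ _ _); apply/funext => x /=; rewrite big_cons.
Qed.

Lemma intg_mul_bounded {R : realType} (a b M : R) (f g : R -> R) :
  measurable_fun `[a, b] f -> (forall x, a <= x <= b -> `|f x| <= M) ->
  intg a b g -> intg a b (fun x => f x * g x).
Proof.
move=> mf fM ig; apply: (le_intg _ _ _ (fun x => M * `|g x|)).
- by apply: measurable_funM => //; exact: intg_measurable.
- by move=> x xab; rewrite normrM; apply: ler_wpM2r => //; exact: fM.
- by apply: intgZ; have := integrable_norm ig.
Qed.

Lemma intg_ac {R : realType} (a b : R) (f : R -> R) : ac a b f -> intg a b f.
Proof.
move=> acf; have [M M0 HM] := ac_bounded _ _ _ acf.
exact: le_intg (ac_measurable _ _ _ acf) HM (intg_cst a b M).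
Qed.

Lemma intg_acM {R : realType} (a b : R) (f g : R -> R) : ac a b f -> intg a b g ->
  intg a b (fun x => f x * g x).
Proof.
move=> acf ig; have [M M0 HM] := ac_bounded _ _ _ acf.
exact: intg_mul_bounded (ac_measurable _ _ _ acf) HM ig.
Qed.

(** The difference between [F] and the primitive of [g] is absolutely continuous with derivative 0
    almost everywhere, so it is constant. *)
Lemma FTC_ac {R : realType} (a b : R) (F g : R -> R) : a <= b -> ac a b F ->
  intg a b g ->
  {ae @lebesgue_measure R, forall x : R, a < x < b -> is_derive x 1 F (g x)} ->
  rint a b g = F b - F a.
Proof.
move=> ab acF ig dF.
have acD' : ac a b (fun x => F x + (-1) * prim a b g x).
  by apply: acD => //; apply: ac_scale; exact: prim_ac.
have := ac_zero_derivative _ _ _ ab acD'.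
rewrite prim_a mulr0 addr0 primE// mulN1r => H.
suff /H : {ae @lebesgue_measure R, forall x : R, a < x < b -> is_derive x 1 (fun x => F x + -1 * prim a b g x) 0} by lra.
apply: aeS2 dF (prim_derive _ _ _ ig) => x h1 h2 xab.
have d1 := h1 xab; have d2 := h2 xab.
have := is_deriveD d1 (is_deriveZ (-1) d2).
by rewrite (_ : g x + -1 *: g x = 0) // /GRing.scale /=; ring.
Qed.

(** * Linear differential systems with integrable coefficients *)

(** With [t n] the sum of the bounds from [n] on, u - t increases and u + t decreases; both
    converge, and the limit of [u] lies between them. *)
Lemma geometric_cvg {R : realType} (u : nat -> R) (B : R) :
  (forall n, `|u n.+1 - u n| <= B / 2 ^+ n) ->
  cvgn u /\ forall n, `|limn u - u n| <= 2 * B / 2 ^+ n.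
Proof.
move=> H.
have B0 : 0 <= B by have := le_trans (normr_ge0 _) (H 0%N); rewrite expr0 divr1.
have h2 n : (2 : R) ^+ n != 0 by rewrite expf_neq0.
pose t n : R := 2 * B / 2 ^+ n.
have tS n : t n.+1 = t n - B / 2 ^+ n by rewrite /t exprS; field; exact: h2.
have t0 n : 0 <= t n by rewrite /t divr_ge0 ?exprn_ge0//; lra.
pose v n := u n - t n; pose w n := u n + t n.
have vS : {homo v : n m / (n <= m)%N >-> n <= m}.
  apply/nondecreasing_seqP => n; rewrite /v tS; have := H n.
  by rewrite ler_norml => /andP[]; lra.
have wS : {homo w : n m / (n <= m)%N >-> m <= n}.
  apply/nonincreasing_seqP => n; rewrite /w tS; have := H n.
  by rewrite ler_norml => /andP[]; lra.
have vw n m : v n <= w m.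
  have [nm|mn] := leqP n m.
    by apply: le_trans (vS _ _ nm) _; rewrite /v /w; have := t0 m; lra.
  by apply: le_trans _ (wS _ _ (ltnW mn)); rewrite /v /w; have := t0 n; lra.
have cv : cvgn v.
  by apply: nondecreasing_is_cvgn => //; exists (w 0%N) => _ [n _ <-].
have cw : cvgn w.
  by apply: nonincreasing_is_cvgn => //; exists (v 0%N) => _ [n _ <-].
have cu : cvgn u.
  have -> : u = (fun n => 2^-1 * (v n + w n)).
    by apply/funext => n; rewrite /v /w; field.
  exact: (is_cvgM (is_cvg_cst _) (is_cvgD cv cw)).
split=> // n; rewrite ler_norml; apply/andP; split.
  rewrite lerBrDl -/(t n) -/(v n); apply: limr_ge => //.
  near=> m; have nm : (n <= m)%N by near: m; exact: nbhs_infty_ge.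
  by apply: le_trans (vS _ _ nm) _; rewrite /v; have := t0 m; lra.
rewrite lerBlDl -/(t n) -/(w n); apply: limr_le => //.
near=> m; have nm : (n <= m)%N by near: m; exact: nbhs_infty_ge.
by apply: le_trans _ (wS _ _ nm); rewrite /w; have := t0 m; lra.
Unshelve. all: by end_near.
Qed.

Lemma le_int {R : realType} (a b : R) (f g : R -> R) : intg a b f -> intg a b g ->
  (forall x, a <= x <= b -> f x <= g x) -> rint a b f <= rint a b g.
Proof.
by move=> h1 h2 fg; apply: le_Rintegral => // x /=; rewrite in_itv/=; exact: fg.
Qed.

Lemma intD {R : realType} (a b : R) (f g : R -> R) : intg a b f -> intg a b g ->
  rint a b (fun x => f x + g x) = rint a b f + rint a b g.
Proof. by move=> h1 h2; rewrite /rint RintegralD. Qed.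

Lemma intZ {R : realType} (a b c : R) (f : R -> R) : intg a b f ->
  rint a b (fun x => c * f x) = c * rint a b f.
Proof. by move=> h1; rewrite /rint RintegralZl. Qed.

Lemma intN {R : realType} (a b : R) (f : R -> R) : intg a b f ->
  rint a b (fun x => - f x) = - rint a b f.
Proof.
move=> h1; rewrite -mulN1r -intZ//; apply: eq_Rintegral => x _; rewrite mulN1r.
by [].
Qed.

Lemma intB {R : realType} (a b : R) (f g : R -> R) : intg a b f -> intg a b g ->
  rint a b (fun x => f x - g x) = rint a b f - rint a b g.
Proof. by move=> h1 h2; rewrite intD ?intN//; exact: intgN. Qed.

Lemma int_norm {R : realType} (a b : R) (f g : R -> R) : intg a b f -> intg a b g ->
  (forall x, a <= x <= b -> `|f x| <= g x) -> `|rint a b f| <= rint a b g.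
Proof.
move=> h1 h2 fg; have h3 : intg a b (fun x => `|f x|) by exact: (integrable_norm h1).
apply: (@le_trans _ _ (rint a b (fun x => `|f x|))); first exact: le_normr_Rintegral.
exact: le_int.
Qed.

Lemma eq_int {R : realType} (a b : R) (f g : R -> R) :
  (forall x, a <= x <= b -> f x = g x) -> rint a b f = rint a b g.
Proof.
by move=> fg; apply: eq_Rintegral => x; rewrite inE /= in_itv/=; exact: fg.
Qed.

Lemma eq_intg {R : realType} (a b : R) (f g : R -> R) :
  (forall x, a <= x <= b -> f x = g x) -> intg a b f -> intg a b g.
Proof.
move=> fg; apply: eq_integrable => // x; rewrite inE /= in_itv/= => xab.
by rewrite fg.
Qed.

(* The weight [expR (2 H)], with [H] a primitive of [h], makes the Volterra
   operator of the Picard iteration a contraction of ratio 1/2. *)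
Lemma int_weight {R : realType} (a b : R) (h : R -> R) (H := prim a b h) : a <= b ->
  intg a b h -> (forall x, a <= x <= b -> 0 <= h x) ->
  [/\ ac a b (fun x => expR (2 * H x)), (forall x, a <= x <= b -> 1 <= expR (2 * H x)) &
    forall x, a <= x <= b ->
      rint a x (fun t => h t * expR (2 * H t)) <= expR (2 * H x) / 2].
Proof.
move=> ab ih h0.
have H0 x : a <= x <= b -> 0 <= H x.
  move=> /andP[ax xb]; rewrite /H primE//; apply: Rintegral_ge0 => t /=.
  by rewrite in_itv/= => /andP[h1 h2]; apply: h0; apply/andP; split; lra.
have acH : ac a b H by exact: prim_ac.
have [M M0 HM] := ac_bounded _ _ _ acH.
have HM' x : a <= x <= b -> H x <= M.
  by move=> xab; apply: le_trans (ler_norm _) (HM x xab).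
(* The tangent inequality [1 + x <= expR x] makes the exponential Lipschitz below [M]; this
   transfers absolute continuity from [H] to the weight. *)
have lip u v : u <= M -> v <= M -> `|expR (2 * u) - expR (2 * v)| <= expR (2 * M) * (2 * `|u - v|).
  have L s t : s <= t -> t <= M -> expR (2 * t) - expR (2 * s) <= expR (2 * M) * (2 * (t - s)).
    move=> st tM; have -> : 2 * s = 2 * t + 2 * (s - t) by ring.
    rewrite expRD; have := expR_ge1Dx (2 * (s - t)).
    have e1 : expR (2 * t) <= expR (2 * M) by rewrite ler_expR; lra.
    have e2 := expR_gt0 (2 * t).
    move=> e3; apply: (@le_trans _ _ (expR (2 * t) * (2 * (t - s)))); last first.
      by apply: ler_wpM2r => //; lra.
    have := ler_wpM2l (ltW e2) e3; rewrite !mulrDr mulr1; lra.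
  move=> uM vM; have [uv|vu] := leP u v.
    have -> : `|u - v| = v - u by rewrite distrC ger0_norm; lra.
    rewrite distrC ger0_norm; first exact: L.
    by rewrite subr_ge0 ler_expR; lra.
  have -> : `|u - v| = u - v by rewrite ger0_norm; lra.
  rewrite ger0_norm; first by apply: L; lra.
  by rewrite subr_ge0 ler_expR; lra.
have acE : ac a b (fun x => expR (2 * H x)).
  apply: (ac_dominated a b (2 * expR (2 * M)) H H) => //.
  move=> x y ax xy yb; apply: le_trans (lip _ _ _ _) _.
  - by apply: HM'; apply/andP; split; lra.
  - by apply: HM'; apply/andP; split; lra.
  - have : 0 <= expR (2 * M) * `|H y - H x| by apply: mulr_ge0 => //; exact: expR_ge0.
    set e := expR (2 * M); set d := `|_| => ed.
    have -> : e * (2 * d) = 2 * (e * d) by ring.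
    have -> : 2 * e * (d + d) = 4 * (e * d) by ring.
    lra.
split => //.
  by move=> x xab; rewrite -[leLHS]expR0 ler_expR; have := H0 x xab; lra.
move=> x /andP[ax xb].
have iE : intg a x (fun t => 2 * (h t * expR (2 * H t))).
  apply: intgZ; apply: (eq_intg _ _ (fun t => expR (2 * H t) * h t)).
    by move=> t _; rewrite mulrC.
  by apply: intg_acM; [exact: ac_sub acE|exact: intg_sub ih].
(* The weight has derivative 2 h times itself, so the integral of h times the weight is half of its
   increment from the value 1 at [a]. *)
have := FTC_ac a x (fun x => expR (2 * H x)) _ ax (ac_sub _ _ _ _ _ (lexx a) xb acE) iE.
have -> : H a = 0 by exact: prim_a.
rewrite mulr0 expR0 intZ; last first.
  apply: (eq_intg _ _ (fun t => expR (2 * H t) * h t)).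
    by move=> t _; rewrite mulrC.
  by apply: intg_acM; [exact: ac_sub acE|exact: intg_sub ih].
move=> E; suff /E : {ae @lebesgue_measure R, forall t : R, a < t < x ->
   is_derive t 1 (fun x => expR (2 * H x)) (2 * (h t * expR (2 * H t)))} by lra.
apply: aeS (prim_derive _ _ _ ih) => t Ht /andP[at_ tx].
have dH : is_derive t 1 H (h t) by apply: Ht; apply/andP; split; lra.
have d2 : is_derive t 1 (fun y => 2 * H y) (2 * h t) by exact: is_deriveZ.
have d3 := is_derive_expR (2 * H t).
have := @is_derive1_comp _ expR (fun y => 2 * H y) t _ _ d3 d2.
by rewrite (_ : expR (2 * H t) * (2 * h t) = 2 * (h t * expR (2 * H t)))//; ring.
Qed.

Lemma pow2_squeeze {R : realType} (x K : R) :
  (forall n : nat, `|x| <= K / 2 ^+ n) -> x = 0.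
Proof.
move=> H; apply/eqP; apply: contraT => x0.
have px : 0 < `|x| by rewrite normr_gt0.
have K0 : 0 <= K by have := le_trans (normr_ge0 x) (H 0%N); rewrite expr0 divr1.
have kx : 0 <= K / `|x| by rewrite divr_ge0.
have := archi_boundP kx; set n := Num.bound _ => Hn.
have n2 : (n%:R : R) <= 2 ^+ n by rewrite -natrX ler_nat ltnW// ltn_expl.
have p2 : 0 < (2 : R) ^+ n by apply: exprn_gt0; lra.
have := H n; rewrite ler_pdivlMr// => h1.
move: Hn; rewrite ltr_pdivrMr// => h2.
have := ler_wpM2l (ltW px) n2; lra.
Qed.

Lemma ae_all {R : realType} (J : finType) (P : J -> R -> Prop) :
  (forall j, {ae @lebesgue_measure R, forall x, P j x}) ->
  {ae @lebesgue_measure R, forall x, forall j, P j x}.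
Proof.
move=> H; suff : {ae @lebesgue_measure R, forall x, forall j, j \in enum J -> P j x}.
  by apply: aeS => x Hx j; apply: Hx; rewrite mem_enum.
elim: (enum J) => [|i s IH].
  by exists set0; split => // x /= nP; case: nP.
apply: aeS2 (H i) IH => x Pi Ps j; rewrite inE => /predU1P[->//|]; exact: Ps.
Qed.

(** Picard iteration in the supremum norm weighted by [E]. Boundedness and measurability of the
    iterates pass to the pointwise limit, and this is all that one more application of the integral
    operator [T] requires. *)
Lemma linear_ode {R : realType} (a b : R) (J : finType) (A : J -> J -> R -> R)
    (F : J -> R -> R) (alpha : J -> R) : a <= b ->
  (forall j k, intg a b (A j k)) -> (forall j, intg a b (F j)) ->
  exists z : J -> R -> R, [/\ forall j, ac a b (z j), forall j, z j a = alpha j &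
    {ae @lebesgue_measure R, forall x : R, forall j, a < x < b ->
       is_derive x 1 (z j) (\sum_k A j k x * z k x + F j x)}].
Proof.
move=> ab iA iF.
(* This sum dominates the coefficients of every row, so a single weight serves the whole system. *)
pose h t := \sum_j \sum_k `|A j k t|.
have ih : intg a b h.
  by apply: intg_sum => j; apply: intg_sum => k; exact: (integrable_norm (iA j k)).
have h0 x : a <= x <= b -> 0 <= h x by move=> _; apply: sumr_ge0 => j _; apply: sumr_ge0.
have [acE E1 EW] := int_weight _ _ _ ab ih h0.
pose E x := expR (2 * prim a b h x).
have [ME ME0 HME] := ac_bounded _ _ _ acE.
have EM x : a <= x <= b -> E x <= ME.
  by move=> xab; apply: le_trans (ler_norm _) (HME x xab).
pose G (Z : J -> R -> R) j t := \sum_k A j k t * Z k t + F j t.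
pose T Z j x := alpha j + prim a b (G Z j) x.
pose good (Z : J -> R -> R) := forall k, measurable_fun `[a, b] (Z k) /\
  exists M, forall x, a <= x <= b -> `|Z k x| <= M.
have iG Z j : good Z -> intg a b (G Z j).
  move=> gZ; apply: intgD => //; apply: intg_sum => k.
  have [mZ [M HM]] := gZ k.
  apply: (eq_intg _ _ (fun t => Z k t * A j k t)); first by move=> t _; rewrite mulrC.
  exact: intg_mul_bounded mZ HM (iA j k).
have ac_good Z : (forall k, ac a b (Z k)) -> good Z.
  move=> H k; split; first exact: ac_measurable.
  by have [M _ HM] := ac_bounded _ _ _ (H k); exists M.
have acT Z j : good Z -> ac a b (T Z j).
  by move=> gZ; apply: acD; [exact: ac_cst|apply: prim_ac; exact: iG].
have Tdiff Z W D j x : good Z -> good W -> 0 <= D ->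
    (forall k t, a <= t <= b -> `|Z k t - W k t| <= D * E t) -> a <= x <= b ->
    `|T Z j x - T W j x| <= D * (E x / 2).
  move=> gZ gW D0 H /andP[ax xb]; rewrite /T !primE//.
  have sub f : intg a b f -> intg a x f by exact: intg_sub.
  have -> : alpha j + rint a x (G Z j) - (alpha j + rint a x (G W j)) =
     rint a x (G Z j) - rint a x (G W j) by ring.
  rewrite -intB; [|by apply/sub/iG|by apply/sub/iG].
  have iE : intg a b (fun t => h t * E t).
    apply: (eq_intg _ _ (fun t => E t * h t)); first by move=> t _; rewrite mulrC.
    exact: intg_acM.
  have xab : a <= x <= b by rewrite ax.
  apply: (@le_trans _ _ (rint a x (fun t => D * (h t * E t)))); last first.
    by rewrite intZ; [apply: ler_wpM2l => //; exact: EW|exact: sub].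
  apply: int_norm.
  - by apply: intgD; [exact/sub/iG|apply/intgN/sub/iG].
  - by apply: intgZ; exact: sub.
  move=> t /andP[at_ tx]; have tab : a <= t <= b by apply/andP; split; lra.
  have -> : G Z j t - G W j t = \sum_k A j k t * (Z k t - W k t).
    rewrite /G opprD addrACA subrr addr0 -sumrB.
    by apply: eq_bigr => k _; rewrite mulrBr.
  apply: le_trans (ler_norm_sum _ _ _) _.
  apply: (@le_trans _ _ (\sum_k `|A j k t| * (D * E t))).
    by apply: ler_sum => k _; rewrite normrM; apply: ler_wpM2l => //; exact: H.
  rewrite -mulr_suml (_ : D * (h t * E t) = h t * (D * E t)); last by ring.
  apply: ler_wpM2r; first by apply: mulr_ge0 => //; exact: expR_ge0.
  rewrite /h [leRHS](bigD1 j) //= lerDl; apply: sumr_ge0 => i _; exact: sumr_ge0.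
pose Z n := iter n T (fun j _ => alpha j).
have acZ n j : ac a b (Z n j).
  elim: n j => [|n IH] j; first exact: ac_cst.
  by apply: acT; exact: ac_good.
have gZ n : good (Z n) by apply: ac_good.
have /choice[C0 HC0] : forall j, exists M : R, forall x, a <= x <= b ->
    `|Z 1%N j x - Z 0%N j x| <= M.
  move=> j.
  have /ac_bounded[M _ HM] : ac a b (fun x => Z 1%N j x + (-1) * Z 0%N j x).
    by apply: acD => //; exact: ac_scale.
  by exists M => x xab; rewrite -[X in _ - X]mul1r -mulNr; exact: HM.
pose C := \sum_j `|C0 j|.
have C_ge0 : 0 <= C by apply: sumr_ge0.
have HC n j x : a <= x <= b -> `|Z n.+1 j x - Z n j x| <= C / 2 ^+ n * E x.
  elim: n j x => [|n IH] j x xab.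
    rewrite expr0 divr1; apply: le_trans (HC0 j x xab) _.
    apply: le_trans (ler_norm _) _.
    apply: (@le_trans _ _ C); first by rewrite /C (bigD1 j)//= lerDl; apply: sumr_ge0.
    by rewrite ler_peMr// /E; exact: E1.
  have -> : C / 2 ^+ n.+1 * E x = C / 2 ^+ n * (E x / 2).
    (* The ratio 1/2 of [Tdiff] is the one that appears in the geometric bound. *)
    by rewrite exprS; field; rewrite expf_neq0.
  apply: (Tdiff (Z n.+1) (Z n)) => //.
    by rewrite divr_ge0// exprn_ge0.
pose B := C * ME.
have HB j x : a <= x <= b -> forall n, `|Z n.+1 j x - Z n j x| <= B / 2 ^+ n.
  move=> xab n; apply: le_trans (HC n j x xab) _.
  rewrite /B mulrAC; apply: ler_wpM2r; first by rewrite invr_ge0 exprn_ge0.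
  by apply: ler_wpM2l => //; exact: EM.
have B0 : 0 <= B by apply: mulr_ge0.
pose z j x := limn (fun n => Z n j x).
have zZ j x : a <= x <= b -> forall n, `|z j x - Z n j x| <= 2 * B / 2 ^+ n.
  by move=> xab; exact: (geometric_cvg _ _ (HB j x xab)).2.
have gz : good z.
  move=> k; split.
    apply: (@measurable_fun_cvg _ _ _ _ (fun n => Z n k)) => [n|x].
      exact: ac_measurable.
    by rewrite /= in_itv/= => xab; exact: (geometric_cvg _ _ (HB k x xab)).1.
  exists (`|alpha k| + 2 * B) => x xab; have := zZ k x xab 0%N.
  rewrite expr0 divr1 /Z /= => h1; have := ler_normD (z k x - alpha k) (alpha k).
  by rewrite subrK; lra.
have Tz j x : a <= x <= b -> T z j x = z j x.
  move=> xab; apply/eqP; rewrite -subr_eq0; apply/eqP.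
  apply: (pow2_squeeze _ (2 * B * (ME + 1))) => n.
  have p2 : 0 < (2 : R) ^+ n by apply: exprn_gt0; lra.
  have h1 : `|T z j x - Z n.+1 j x| <= 2 * B / 2 ^+ n * (E x / 2).
    apply: (Tdiff z (Z n)) => //; first by rewrite divr_ge0 ?mulr_ge0// ltW.
    move=> k t tab; apply: le_trans (zZ k t tab n) _.
    by rewrite ler_peMr ?E1// divr_ge0 ?mulr_ge0// ltW.
  have h2 := zZ j x xab n.+1.
  have -> : T z j x - z j x = (T z j x - Z n.+1 j x) - (z j x - Z n.+1 j x) by ring.
  apply: le_trans (ler_normB _ _) _.
  have q0 : 0 <= 2 * B / 2 ^+ n by rewrite divr_ge0 ?mulr_ge0// ltW.
  apply: le_trans (lerD h1 h2) _.
  have -> : 2 * B / 2 ^+ n.+1 = 2 * B / 2 ^+ n * 2^-1.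
    by rewrite exprS; field; rewrite gt_eqF.
  have -> : 2 * B * (ME + 1) / 2 ^+ n = 2 * B / 2 ^+ n * (ME + 1) by ring.
  by rewrite -mulrDr; apply: ler_wpM2l => //; have := EM x xab; have := E1 x xab; rewrite -/(E x); lra.
(* The solution offered is [T z], which is a primitive by construction; it is shown to agree with
   the pointwise limit [z] on [a, b]. *)
exists (T z); split => [j|j|].
- exact: acT.
- by rewrite /T prim_a addr0.
- apply: ae_all => j; apply: aeS (prim_derive _ _ _ (iG z j gz)) => x Hx xab.
  have d1 := Hx xab.
  have xab' : a <= x <= b by move/andP: xab => [? ?]; apply/andP; split; lra.
  have -> : \sum_k A j k x * T z k x + F j x = 0 + G z j x.
    by rewrite add0r /G; congr (_ + _); apply: eq_bigr => k _; rewrite Tz.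
  exact: (is_deriveD (is_derive_cst _ _ _) d1).
Qed.

(** * Complex-valued functions *)

Lemma CReD {R : realType} (x y : R[i]) : Re (x + y) = Re x + Re y.
Proof. by case: x y => [? ?] [? ?]. Qed.
Lemma CImD {R : realType} (x y : R[i]) : Im (x + y) = Im x + Im y.
Proof. by case: x y => [? ?] [? ?]. Qed.
Lemma CReN {R : realType} (x : R[i]) : Re (- x) = - Re x.
Proof. by case: x. Qed.
Lemma CImN {R : realType} (x : R[i]) : Im (- x) = - Im x.
Proof. by case: x. Qed.
Lemma CReM {R : realType} (x y : R[i]) : Re (x * y) = Re x * Re y - Im x * Im y.
Proof. by case: x y => [? ?] [? ?]. Qed.
Lemma CImM {R : realType} (x y : R[i]) : Im (x * y) = Re x * Im y + Im x * Re y.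
Proof. by case: x y => [? ?] [? ?]. Qed.
Lemma CReJ {R : realType} (x : R[i]) : Re (x^*) = Re x.
Proof. by case: x. Qed.
Lemma CImJ {R : realType} (x : R[i]) : Im (x^*) = - Im x.
Proof. by case: x. Qed.
Lemma cplx_ext {R : realType} (x y : R[i]) : Re x = Re y -> Im x = Im y -> x = y.
Proof. by case: x y => [? ?] [? ?] /= -> ->. Qed.
Definition cplxE {R : realType} := (@CReD R, @CImD R, @CReN R, @CImN R, @CReM R, @CImM R, @CReJ R, @CImJ R).

Lemma cnorm2E {R : realType} (z : R[i]) : (cnorm2 z)%:C%C = z * z^*.
Proof. by apply: cplx_ext; rewrite !cplxE /= /cnorm2; ring. Qed.
Lemma cnorm2_ge0 {R : realType} (z : R[i]) : 0 <= cnorm2 z.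
Proof. by rewrite /cnorm2 addr_ge0// sqr_ge0. Qed.
Lemma cnorm2_eq0 {R : realType} (z : R[i]) : cnorm2 z = 0 -> z = 0.
Proof.
move/eqP; rewrite /cnorm2 paddr_eq0 ?sqr_ge0// !sqrf_eq0 => /andP[/eqP h1 /eqP h2].
exact: cplx_ext.
Qed.

Definition cintg {R : realType} (a b : R) (f : R -> R[i]) : Prop :=
  intg a b (fun x => Re (f x)) /\ intg a b (fun x => Im (f x)).
Definition cint {R : realType} (a b : R) (f : R -> R[i]) : R[i] :=
  Complex (rint a b (fun x => Re (f x))) (rint a b (fun x => Im (f x))).
Definition cac {R : realType} (a b : R) (f : R -> R[i]) : Prop :=
  ac a b (fun x => Re (f x)) /\ ac a b (fun x => Im (f x)).

Lemma normc_ge {R : realType} (z : R[i]) : `|z| <= (`|Re z| + `|Im z|)%:C%C.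
Proof.
rewrite normc_def lecR -[leRHS]ger0_norm ?addr_ge0// -sqrtr_sqr ler_wsqrtr//.
rewrite sqrrD !real_normK ?num_real//.
have : 0 <= `|Re z| * `|Im z| by apply: mulr_ge0.
rewrite -mulr_natr; lra.
Qed.

Lemma abs_contP {R : realType} (a b : R) (f : R -> R[i]) : abs_cont a b f <-> cac a b f.
Proof.
split.
  move=> H; split => e e0; have [d d0 Hd] := H e e0; exists d => // n x y h1 h2 h3.
    rewrite -ltcR; apply: le_lt_trans (Hd n x y h1 h2 h3).
    rewrite [X in X <= _](rmorph_sum (real_complex R)) /=; apply: ler_sum => j _.
    by rewrite -CReN -CReD; exact: normc_ge_Re.
  rewrite -ltcR; apply: le_lt_trans (Hd n x y h1 h2 h3).
  rewrite [X in X <= _](rmorph_sum (real_complex R)) /=; apply: ler_sum => j _.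
  rewrite -CImN -CImD; set z := _ - _.
  (* Multiplication by the imaginary unit preserves the modulus and turns the bound on the real part
     into one on the imaginary part. *)
  have -> : `|z| = `|z * 'i%C| by rewrite normrM (_ : `|'i%C| = 1) ?mulr1// normc_def /= expr0n/= add0r expr1n sqrtr1.
  by apply: le_trans (normc_ge_Re _); rewrite lecR !cplxE /= mulr0 mulr1 sub0r normrN.
move=> [H1 H2] e e0.
have e2 : 0 < e / 2 by lra.
have [d d0 Hd] := H1 _ e2; have [c c0 Hc] := H2 _ e2.
exists (Num.min d c); first by rewrite lt_min d0.
move=> n x y h1 h2; rewrite lt_min => /andP[h3 h4].
have g1 := Hd n x y h1 h2 h3; have g2 := Hc n x y h1 h2 h4.
apply: (@le_lt_trans _ _ ((\sum_(j < n) `|Re (f (y j)) - Re (f (x j))| + \sum_(j < n) `|Im (f (y j)) - Im (f (x j))|)%:C%C)).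
  rewrite -big_split /= [X in _ <= X](rmorph_sum (real_complex R)) /=.
  by apply: ler_sum => j _; rewrite -CReN -CReD -CImN -CImD; exact: normc_ge.
by rewrite ltcR; lra.
Qed.

Lemma cacD {R : realType} (a b : R) (f g : R -> R[i]) :
  cac a b f -> cac a b g -> cac a b (fun x => f x + g x).
Proof.
move=> [f1 f2] [g1 g2]; split.
  by apply: ac_eq (acD _ _ _ _ f1 g1) => x _; rewrite !cplxE.
by apply: ac_eq (acD _ _ _ _ f2 g2) => x _; rewrite !cplxE.
Qed.

Lemma acN {R : realType} (a b : R) (f : R -> R) : ac a b f -> ac a b (fun x => - f x).
Proof. by move=> H; apply: ac_eq (ac_scale _ _ (-1) _ H) => x _; rewrite mulN1r. Qed.

Lemma cacM {R : realType} (a b : R) (f g : R -> R[i]) :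
  cac a b f -> cac a b g -> cac a b (fun x => f x * g x).
Proof.
move=> [f1 f2] [g1 g2]; split.
  by apply: ac_eq (acD _ _ _ _ (acM _ _ _ _ f1 g1) (acN _ _ _ (acM _ _ _ _ f2 g2))) => x _; rewrite !cplxE.
by apply: ac_eq (acD _ _ _ _ (acM _ _ _ _ f1 g2) (acM _ _ _ _ f2 g1)) => x _; rewrite !cplxE.
Qed.

Lemma cac_cst {R : realType} (a b : R) (c : R[i]) : cac a b (fun=> c).
Proof. by split; exact: ac_cst. Qed.

Lemma cacJ {R : realType} (a b : R) (f : R -> R[i]) : cac a b f -> cac a b (fun x => (f x)^*).
Proof.
move=> [f1 f2]; split; first by apply: ac_eq f1 => x _; rewrite CReJ.
by apply: ac_eq (acN _ _ _ f2) => x _; rewrite CImJ.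
Qed.

Lemma cac_sum {R : realType} (a b : R) (I : Type) (s : seq I) (f : I -> R -> R[i]) :
  (forall i, cac a b (f i)) -> cac a b (fun x => \sum_(i <- s) f i x).
Proof.
move=> H; elim: s => [|i s IH].
  by have := cac_cst a b 0; congr (cac _ _ _); apply/funext => x; rewrite big_nil.
have := cacD _ _ _ _ (H i) IH.
by congr (cac _ _ _); apply/funext => x; rewrite big_cons.
Qed.

Lemma is_derive_congr {R : realType} (f g : R -> R) (x l k : R) :
  is_derive x 1 f l -> f = g -> l = k -> is_derive x 1 g k.
Proof. by move=> ? <- <-. Qed.

Lemma has_cderivD {R : realType} (f g : R -> R[i]) (x : R) (d e : R[i]) :
  has_cderiv f x d -> has_cderiv g x e -> has_cderiv (fun t => f t + g t) x (d + e).
Proof.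
move=> [f1 f2] [g1 g2]; split.
  by apply: is_derive_congr (is_deriveD f1 g1) _ _; [apply/funext => t|]; rewrite cplxE.
by apply: is_derive_congr (is_deriveD f2 g2) _ _; [apply/funext => t|]; rewrite cplxE.
Qed.

Lemma has_cderivM {R : realType} (f g : R -> R[i]) (x : R) (d e : R[i]) :
  has_cderiv f x d -> has_cderiv g x e ->
  has_cderiv (fun t => f t * g t) x (d * g x + f x * e).
Proof.
move=> [f1 f2] [g1 g2]; split.
  apply: is_derive_congr (is_deriveB (is_deriveM f1 g1) (is_deriveM f2 g2)) _ _.
    by apply/funext => t; rewrite cplxE.
  by rewrite !cplxE /GRing.scale /=; ring.
apply: is_derive_congr (is_deriveD (is_deriveM f1 g2) (is_deriveM f2 g1)) _ _.
  by apply/funext => t; rewrite cplxE.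
by rewrite !cplxE /GRing.scale /=; ring.
Qed.

Lemma has_cderivJ {R : realType} (f : R -> R[i]) (x : R) (d : R[i]) :
  has_cderiv f x d -> has_cderiv (fun t => (f t)^*) x (d^*).
Proof.
move=> [f1 f2]; split.
  by apply: is_derive_congr f1 _ _; [apply/funext => t|]; rewrite cplxE.
by apply: is_derive_congr (is_deriveN f2) _ _; [apply/funext => t|]; rewrite cplxE.
Qed.

Lemma has_cderiv_cst {R : realType} (c : R[i]) (x : R) : has_cderiv (fun=> c) x 0.
Proof. by split; exact: is_derive_cst. Qed.

Lemma has_cderivZ {R : realType} (c : R[i]) (f : R -> R[i]) (x : R) (d : R[i]) :
  has_cderiv f x d -> has_cderiv (fun t => c * f t) x (c * d).
Proof.
move=> H; have := has_cderivM _ _ _ _ _ (has_cderiv_cst c x) H.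
by rewrite mul0r add0r.
Qed.

Lemma has_cderiv_sum {R : realType} (I : Type) (s : seq I) (f : I -> R -> R[i]) (x : R)
    (d : I -> R[i]) : (forall i, has_cderiv (f i) x (d i)) ->
  has_cderiv (fun t => \sum_(i <- s) f i t) x (\sum_(i <- s) d i).
Proof.
move=> H; elim: s => [|i s IH].
  have := has_cderiv_cst (R := R) 0 x; rewrite big_nil; congr (has_cderiv _ _ _).
  by apply/funext => t; rewrite big_nil.
have := has_cderivD _ _ _ _ _ (H i) IH; rewrite big_cons; congr (has_cderiv _ _ _).
by apply/funext => t; rewrite big_cons.
Qed.

Lemma cintgD {R : realType} (a b : R) (f g : R -> R[i]) :
  cintg a b f -> cintg a b g -> cintg a b (fun x => f x + g x).
Proof.
move=> [f1 f2] [g1 g2]; split.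
  by apply: eq_intg (intgD _ _ _ _ f1 g1) => x _; rewrite cplxE.
by apply: eq_intg (intgD _ _ _ _ f2 g2) => x _; rewrite cplxE.
Qed.

Lemma cintgJ {R : realType} (a b : R) (f : R -> R[i]) :
  cintg a b f -> cintg a b (fun x => (f x)^*).
Proof.
move=> [f1 f2]; split; first by apply: eq_intg f1 => x _; rewrite cplxE.
by apply: eq_intg (intgN _ _ _ f2) => x _; rewrite cplxE.
Qed.

Lemma cintg_cacM {R : realType} (a b : R) (f g : R -> R[i]) :
  cac a b f -> cintg a b g -> cintg a b (fun x => f x * g x).
Proof.
move=> [f1 f2] [g1 g2]; split.
  by apply: eq_intg (intgD _ _ _ _ (intg_acM _ _ _ _ f1 g1) (intgN _ _ _ (intg_acM _ _ _ _ f2 g2))) => x _; rewrite cplxE.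
by apply: eq_intg (intgD _ _ _ _ (intg_acM _ _ _ _ f1 g2) (intg_acM _ _ _ _ f2 g1)) => x _; rewrite cplxE.
Qed.

Lemma cintgZ {R : realType} (a b : R) (c : R[i]) (f : R -> R[i]) :
  cintg a b f -> cintg a b (fun x => c * f x).
Proof. by apply: cintg_cacM; exact: cac_cst. Qed.

Lemma cintD {R : realType} (a b : R) (f g : R -> R[i]) :
  cintg a b f -> cintg a b g -> cint a b (fun x => f x + g x) = cint a b f + cint a b g.
Proof.
move=> [f1 f2] [g1 g2]; apply: cplx_ext; rewrite ?cplxE /= -intD//; apply: eq_int => x _;
by rewrite cplxE.
Qed.

Lemma cintJ {R : realType} (a b : R) (f : R -> R[i]) :
  cintg a b f -> cint a b (fun x => (f x)^*) = (cint a b f)^*.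
Proof.
move=> [f1 f2]; apply: cplx_ext; rewrite ?cplxE /= -?intN//; apply: eq_int => x _;
by rewrite cplxE.
Qed.

Lemma cintZ {R : realType} (a b : R) (c : R[i]) (f : R -> R[i]) :
  cintg a b f -> cint a b (fun x => c * f x) = c * cint a b f.
Proof.
move=> [f1 f2]; apply: cplx_ext; rewrite !cplxE /= -!intZ//.
  by rewrite -intB; [|exact: intgZ|exact: intgZ]; apply: eq_int => x _; rewrite cplxE.
by rewrite -intD; [|exact: intgZ|exact: intgZ]; apply: eq_int => x _; rewrite cplxE.
Qed.

Lemma ae_eq_int {R : realType} (a b : R) (f g : R -> R) : measurable_fun `[a, b] f ->
  measurable_fun `[a, b] g -> {ae @lebesgue_measure R, forall x, a <= x <= b -> f x = g x} ->
  rint a b f = rint a b g.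
Proof.
move=> mf mg fg; congr fine; apply: ae_eq_integral => //.
- exact/measurable_EFinP.
- exact/measurable_EFinP.
- by apply: aeS fg => x H /=; rewrite in_itv/= => /H ->.
Qed.

Lemma ae_eq_cint {R : realType} (a b : R) (f g : R -> R[i]) : cintg a b f -> cintg a b g ->
  aeeq a b f g -> cint a b f = cint a b g.
Proof.
move=> [f1 f2] [g1 g2] fg; apply: cplx_ext => /=; apply: ae_eq_int;
  try exact: intg_measurable; by apply: aeS fg => x H /H ->.
Qed.

Lemma cFTC {R : realType} (a b : R) (F g : R -> R[i]) : a <= b -> cac a b F -> cintg a b g ->
  {ae @lebesgue_measure R, forall x, a < x < b -> has_cderiv F x (g x)} ->
  cint a b g = F b - F a.
Proof.
move=> ab [F1 F2] [g1 g2] dF; apply: cplx_ext; rewrite !cplxE /=.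
  by apply: (FTC_ac _ _ _ _ ab F1 g1); apply: aeS dF => x H /H [].
by apply: (FTC_ac _ _ _ _ ab F2 g2); apply: aeS dF => x H /H [].
Qed.

(** Real and imaginary parts form a real system indexed by [J * bool], [true] marking the imaginary
    part; each complex coefficient acts as a real 2 by 2 matrix. *)
Lemma clinear_ode {R : realType} (a b : R) (J : finType) (A : J -> J -> R -> R[i])
    (F : J -> R -> R[i]) (alpha : J -> R[i]) : a <= b ->
  (forall j k, cintg a b (A j k)) -> (forall j, cintg a b (F j)) ->
  exists z : J -> R -> R[i], [/\ forall j, cac a b (z j), forall j, z j a = alpha j &
    {ae @lebesgue_measure R, forall x : R, forall j, a < x < b ->
       has_cderiv (z j) x (\sum_k A j k x * z k x + F j x)}].
Proof.
move=> ab iA iF.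
pose A' (j k : J * bool) t := if j.2 then if k.2 then Re (A j.1 k.1 t) else Im (A j.1 k.1 t)
  else if k.2 then - Im (A j.1 k.1 t) else Re (A j.1 k.1 t).
pose F' (j : J * bool) t := if j.2 then Im (F j.1 t) else Re (F j.1 t).
pose al' (j : J * bool) := if j.2 then Im (alpha j.1) else Re (alpha j.1).
have iA' j k : intg a b (A' j k).
  have [h1 h2] := iA j.1 k.1; rewrite /A'; case: j.2; case: k.2 => //; exact: intgN.
have iF' j : intg a b (F' j) by have [h1 h2] := iF j.1; rewrite /F'; case: j.2.
have [w [w1 w2 w3]] := linear_ode a b (J * bool)%type A' F' al' ab iA' iF'.
exists (fun j x => Complex (w (j, false) x) (w (j, true) x)); split.
- by move=> j; split => /=; exact: w1.
- by move=> j; rewrite !w2 /al' /=; case: (alpha j).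
- apply: aeS w3 => x H j xab.
  have sumE (g : J * bool -> R) : \sum_k g k = \sum_k (g (k, true) + g (k, false)).
    transitivity (\sum_k \sum_(e : bool) g (k, e)); last first.
      by apply: eq_bigr => k _; rewrite big_bool.
    by rewrite pair_bigA /=; apply: eq_bigr => -[].
  have ReS (f : J -> R[i]) : Re (\sum_k f k) = \sum_k Re (f k).
    by apply: (big_morph _ (@CReD R) (erefl _)).
  have ImS (f : J -> R[i]) : Im (\sum_k f k) = \sum_k Im (f k).
    by apply: (big_morph _ (@CImD R) (erefl _)).
  split.
    apply: is_derive_congr (H (j, false) xab) (erefl _) _.
    rewrite CReD ReS sumE /A' /F' /=; congr (_ + _); apply: eq_bigr => k _.
    by rewrite CReM /=; ring.
  apply: is_derive_congr (H (j, true) xab) (erefl _) _.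
  rewrite CImD ImS sumE /A' /F' /=; congr (_ + _); apply: eq_bigr => k _.
  by rewrite CImM /=; ring.
Qed.

(** * Square-integrable functions *)

Definition nrm2 {R : realType} (a b : R) (u : R -> R[i]) : R := rint a b (fun x => cnorm2 (u x)).
Definition ip {R : realType} (a b : R) (u v : R -> R[i]) : R[i] :=
  cint a b (fun x => u x * (v x)^*).

Lemma measurable_cnorm2 {R : realType} (a b : R) (u : R -> R[i]) :
  measurable_fun `[a, b] (fun x => Re (u x)) -> measurable_fun `[a, b] (fun x => Im (u x)) ->
  measurable_fun `[a, b] (fun x => cnorm2 (u x)).
Proof.
move=> m1 m2; rewrite /cnorm2; apply: measurable_funD.
  by apply: measurable_funX.
by apply: measurable_funX.
Qed.

Lemma integral_cnorm2_abs {R : realType} (a b : R) (u : R -> R[i]) :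
  (\int[@lebesgue_measure R]_(x in `[a, b]) `|(cnorm2 (u x))%:E| =
  \int[@lebesgue_measure R]_(x in `[a, b]) (cnorm2 (u x))%:E)%E.
Proof. by apply: eq_integral => x _; rewrite gee0_abs// lee_fin cnorm2_ge0. Qed.

Lemma L2P {R : realType} (a b : R) (u : R -> R[i]) : L2 a b u <->
  [/\ measurable_fun `[a, b] (fun x => Re (u x)), measurable_fun `[a, b] (fun x => Im (u x)) &
   intg a b (fun x => cnorm2 (u x))].
Proof.
have E := integral_cnorm2_abs a b u.
split=> [[m1 [m2 f]]|[m1 m2 /integrableP[_ f]]].
  split => //; apply/integrableP; split; last by rewrite E.
  by apply/measurable_EFinP; exact: measurable_cnorm2.
by split => //; split => //; move: f; rewrite E.
Qed.

Lemma L2_mul {R : realType} (a b : R) (u v : R -> R[i]) : L2 a b u -> L2 a b v ->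
  cintg a b (fun x => u x * (v x)^*).
Proof.
move=> /L2P[u1 u2 u3] /L2P[v1 v2 v3]; have i3 := intgD _ _ _ _ u3 v3.
have bd (p q r s : R) : `|p * q + r * s| <= (p ^+ 2 + r ^+ 2) + (q ^+ 2 + s ^+ 2).
  have h1 := sqr_ge0 (p + q); have h2 := sqr_ge0 (p - q).
  have h3 := sqr_ge0 (r + s); have h4 := sqr_ge0 (r - s).
  have h5 := sqr_ge0 p; have h6 := sqr_ge0 q; have h7 := sqr_ge0 r; have h8 := sqr_ge0 s.
  by rewrite ler_norml; apply/andP; split; nra.
split.
  apply: (eq_intg _ _ (fun x => Re (u x) * Re (v x) + Im (u x) * Im (v x))).
    by move=> x _; rewrite !cplxE; ring.
  apply: le_intg _ i3.
    by apply: measurable_funD; apply: measurable_funM.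
  by move=> x _; exact: bd.
apply: (eq_intg _ _ (fun x => Im (u x) * Re (v x) + Re (u x) * - Im (v x))).
  by move=> x _; rewrite !cplxE; ring.
apply: le_intg _ i3.
  apply: measurable_funD; apply: measurable_funM => //.
  exact: measurableT_comp.
move=> x _; apply: le_trans (bd _ _ _ _) _; rewrite sqrrN /cnorm2; lra.
Qed.

Lemma L2D {R : realType} (a b : R) (u v : R -> R[i]) : L2 a b u -> L2 a b v ->
  L2 a b (fun x => u x + v x).
Proof.
move=> /L2P[u1 u2 u3] /L2P[v1 v2 v3]; apply/L2P.
have m1 : measurable_fun `[a, b] (fun x => Re (u x + v x)).
  by rewrite (_ : (fun _ => _) = (fun x => Re (u x)) \+ (fun x => Re (v x)));
    [exact: measurable_funD|apply/funext => x /=; rewrite CReD].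
have m2 : measurable_fun `[a, b] (fun x => Im (u x + v x)).
  by rewrite (_ : (fun _ => _) = (fun x => Im (u x)) \+ (fun x => Im (v x)));
    [exact: measurable_funD|apply/funext => x /=; rewrite CImD].
split => //; apply: le_intg (measurable_cnorm2 _ _ _ m1 m2) _ (intgZ _ _ 2 _ (intgD _ _ _ _ u3 v3)).
move=> x _; rewrite ger0_norm ?cnorm2_ge0// /cnorm2 !cplxE.
have h1 := sqr_ge0 (Re (u x) - Re (v x)); have h2 := sqr_ge0 (Im (u x) - Im (v x)).
nra.
Qed.

Lemma cnorm2M {R : realType} (x y : R[i]) : cnorm2 (x * y) = cnorm2 x * cnorm2 y.
Proof. by rewrite /cnorm2 !cplxE; ring. Qed.

Lemma L2Z {R : realType} (a b : R) (c : R[i]) (u : R -> R[i]) : L2 a b u ->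
  L2 a b (fun x => c * u x).
Proof.
move=> /L2P[u1 u2 u3]; apply/L2P.
have m1 : measurable_fun `[a, b] (fun x => Re (c * u x)).
  rewrite (_ : (fun _ => _) = (fun x => Re c * Re (u x) + (- Im c) * Im (u x))).
    by apply: measurable_funD; apply: measurable_funM => //; exact: measurable_cst.
  by apply/funext => x /=; rewrite CReM mulNr.
have m2 : measurable_fun `[a, b] (fun x => Im (c * u x)).
  rewrite (_ : (fun _ => _) = (fun x => Re c * Im (u x) + Im c * Re (u x))).
    by apply: measurable_funD; apply: measurable_funM => //; exact: measurable_cst.
  by apply/funext => x /=; rewrite CImM.
split => //; apply: (eq_intg _ _ (fun x => cnorm2 c * cnorm2 (u x))).
  by move=> x _; rewrite cnorm2M.
exact: intgZ.
Qed.

Lemma L2_cac {R : realType} (a b : R) (u : R -> R[i]) : cac a b u -> L2 a b u.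
Proof.
move=> [h1 h2]; apply/L2P; split; [exact: ac_measurable|exact: ac_measurable|].
apply: intg_ac; apply: ac_eq (acD _ _ _ _ (acM _ _ _ _ h1 h1) (acM _ _ _ _ h2 h2)).
by move=> x _; rewrite /cnorm2 !expr2.
Qed.

Lemma L2_0 {R : realType} (a b : R) : L2 a b (fun=> 0).
Proof. by apply: L2_cac; exact: cac_cst. Qed.

Lemma L2_cintg {R : realType} (a b : R) (u : R -> R[i]) : L2 a b u -> cintg a b u.
Proof.
move=> hu; have [h1 h2] := L2_mul _ _ _ _ hu (L2_cac _ _ _ (cac_cst a b 1)).
by split; [apply: eq_intg h1|apply: eq_intg h2] => x _; rewrite rmorph1 mulr1.
Qed.

Lemma L2N {R : realType} (a b : R) (u : R -> R[i]) : L2 a b u -> L2 a b (fun x => - u x).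
Proof.
by move=> /(L2Z _ _ (-1)); congr L2; apply/funext => x; rewrite mulN1r.
Qed.

Lemma L2B {R : realType} (a b : R) (u v : R -> R[i]) : L2 a b u -> L2 a b v ->
  L2 a b (fun x => u x - v x).
Proof. by move=> hu hv; exact: L2D hu (L2N _ _ _ hv). Qed.

Lemma L2_sum {R : realType} (a b : R) (I : Type) (s : seq I) (f : I -> R -> R[i]) :
  (forall i, L2 a b (f i)) -> L2 a b (fun x => \sum_(i <- s) f i x).
Proof.
move=> H; elim: s => [|i s IH].
  by have := L2_0 a b; congr (L2 _ _ _); apply/funext => x; rewrite big_nil.
have := L2D _ _ _ _ (H i) IH.
by congr (L2 _ _ _); apply/funext => x; rewrite big_cons.
Qed.

Lemma ipDl {R : realType} (a b : R) (u v w : R -> R[i]) : L2 a b u -> L2 a b v -> L2 a b w ->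
  ip a b (fun x => u x + v x) w = ip a b u w + ip a b v w.
Proof.
move=> hu hv hw; rewrite /ip -cintD; [|exact: L2_mul|exact: L2_mul].
by congr cint; apply/funext => x; rewrite mulrDl.
Qed.

Lemma ipZl {R : realType} (a b : R) (c : R[i]) (u w : R -> R[i]) : L2 a b u -> L2 a b w ->
  ip a b (fun x => c * u x) w = c * ip a b u w.
Proof.
move=> hu hw; rewrite /ip -cintZ; last exact: L2_mul.
by congr cint; apply/funext => x; rewrite mulrA.
Qed.

Lemma ipC {R : realType} (a b : R) (u v : R -> R[i]) : L2 a b u -> L2 a b v ->
  ip a b v u = (ip a b u v)^*.
Proof.
move=> hu hv; rewrite /ip -cintJ; last exact: L2_mul.
by congr cint; apply/funext => x; rewrite rmorphM /= conjCK mulrC.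
Qed.

Lemma ipDr {R : realType} (a b : R) (u v w : R -> R[i]) : L2 a b u -> L2 a b v -> L2 a b w ->
  ip a b w (fun x => u x + v x) = ip a b w u + ip a b w v.
Proof.
move=> hu hv hw; have huv := L2D _ _ _ _ hu hv.
by rewrite (ipC _ _ _ _ huv hw) ipDl// rmorphD /= -!ipC.
Qed.

Lemma ipZr {R : realType} (a b : R) (c : R[i]) (u w : R -> R[i]) : L2 a b u -> L2 a b w ->
  ip a b w (fun x => c * u x) = c^* * ip a b w u.
Proof.
move=> hu hw; have hcu := L2Z _ _ c _ hu.
by rewrite (ipC _ _ _ _ hcu hw) ipZl// rmorphM /= -ipC.
Qed.

Lemma ip0l {R : realType} (a b : R) (w : R -> R[i]) : L2 a b w -> ip a b (fun=> 0) w = 0.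
Proof.
move=> hw; have := ipZl _ _ 0 _ _ hw hw; rewrite mul0r => H.
rewrite -[RHS]H; congr ip; by apply/funext => x; rewrite mul0r.
Qed.

Lemma ip_suml {R : realType} (a b : R) (I : Type) (s : seq I) (c : I -> R[i]) (f : I -> R -> R[i])
    (w : R -> R[i]) : (forall i, L2 a b (f i)) -> L2 a b w ->
  ip a b (fun x => \sum_(i <- s) c i * f i x) w = \sum_(i <- s) c i * ip a b (f i) w.
Proof.
move=> H hw; elim: s => [|i s IH].
  rewrite big_nil -[RHS](ip0l a b w hw); congr ip; by apply/funext => x; rewrite big_nil.
rewrite big_cons -IH -ipZl// -ipDl//; [|exact: L2Z|by apply: L2_sum => j; exact: L2Z].
by congr ip; apply/funext => x; rewrite big_cons.
Qed.

Lemma ipuu {R : realType} (a b : R) (u : R -> R[i]) : ip a b u u = (nrm2 a b u)%:C%C.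
Proof.
apply: cplx_ext => /=.
  by apply: eq_int => x _; rewrite !cplxE /cnorm2; ring.
rewrite -[RHS](_ : rint a b (fun=> 0) = 0); first by apply: eq_int => x _; rewrite !cplxE; ring.
rewrite /rint /Rintegral integral0//.
Qed.

Lemma nrm2_ge0 {R : realType} (a b : R) (u : R -> R[i]) : 0 <= nrm2 a b u.
Proof. by apply: Rintegral_ge0 => x _; exact: cnorm2_ge0. Qed.

Lemma nrm2_eq0 {R : realType} (a b : R) (u : R -> R[i]) : L2 a b u -> nrm2 a b u = 0 ->
  aeeq a b u (fun=> 0).
Proof.
move=> /L2P[u1 u2 u3] h.
have h1 : (\int[@lebesgue_measure R]_(x in `[a, b]) `|(cnorm2 (u x))%:E| = 0)%E.
  rewrite integral_cnorm2_abs.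
  rewrite -[LHS]fineK; first by congr EFin.
  exact: integrable_fin_num.
have mf : measurable_fun `[a, b] (fun x => (cnorm2 (u x))%:E).
  by apply/measurable_EFinP; exact: measurable_cnorm2.
have [h2 _] := ae_eq_integral_abs (@lebesgue_measure R) (measurable_itv `[a, b]) mf.
apply: aeS (h2 h1) => x H xab; apply: cnorm2_eq0.
by have := H; rewrite /= in_itv/= => /(_ xab) [].
Qed.

Lemma ae_ip {R : realType} (a b : R) (u u' v : R -> R[i]) : L2 a b u -> L2 a b u' -> L2 a b v ->
  aeeq a b u u' -> ip a b u v = ip a b u' v.
Proof.
move=> h1 h2 h3 E; apply: ae_eq_cint; [exact: L2_mul|exact: L2_mul|].
by apply: aeS E => x H /H ->.
Qed.

Lemma aeeq_refl {R : realType} (a b : R) (u : R -> R[i]) : aeeq a b u u.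
Proof. by exists set0; split => // x /= nP; case: nP. Qed.

Lemma aeeq_sym {R : realType} (a b : R) (u v : R -> R[i]) : aeeq a b u v -> aeeq a b v u.
Proof. by apply: aeS => x H /H. Qed.

Lemma aeeq_trans {R : realType} (a b : R) (u v w : R -> R[i]) : aeeq a b u v -> aeeq a b v w ->
  aeeq a b u w.
Proof. by apply: aeS2 => x H1 H2 xab; rewrite H1// H2. Qed.

Lemma aeeq_nrm2 {R : realType} (a b : R) (u v : R -> R[i]) : L2 a b u -> L2 a b v ->
  aeeq a b u v -> nrm2 a b (fun x => u x - v x) = 0.
Proof.
move=> hu hv E; have := ipuu a b (fun x => u x - v x).
rewrite (ae_ip _ _ _ (fun=> 0)) ?ip0l; [by case| exact: L2B|exact: L2B|exact: L2_0|exact: L2B|].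
by apply: aeS E => x H /H ->; rewrite subrr.
Qed.

Lemma nrm2B {R : realType} (a b : R) (u v : R -> R[i]) : L2 a b u -> L2 a b v ->
  nrm2 a b (fun x => u x - v x) = nrm2 a b u + nrm2 a b v - 2 * Re (ip a b u v).
Proof.
move=> hu hv; have /L2P[_ _ iu] := hu; have /L2P[_ _ iv] := hv.
have [iuv _] := L2_mul _ _ _ _ hu hv.
rewrite /nrm2 /= -intD// -intZ// -intB//; [|exact: intgD|exact: intgZ].
by apply: eq_int => x _; rewrite /cnorm2 !cplxE; ring.
Qed.

Lemma nrm2Z {R : realType} (a b : R) (c : R[i]) (u : R -> R[i]) : L2 a b u ->
  nrm2 a b (fun x => c * u x) = cnorm2 c * nrm2 a b u.
Proof.
move=> /L2P[_ _ iu]; rewrite /nrm2 -intZ//.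
by apply: eq_int => x _; rewrite cnorm2M.
Qed.

(* Summing the squared increments with weights 4^n bounds them almost everywhere
   by a geometric sequence, so [f] converges pointwise off a null set. *)
Lemma real_L2_cvg {R : realType} (a b C : R) (f : nat -> R -> R) :
  (forall n, measurable_fun `[a, b] (f n)) ->
  (forall n, intg a b (fun x => f n x ^+ 2)) ->
  (forall n, intg a b (fun x => (f n.+1 x - f n x) ^+ 2)) ->
  (forall n, rint a b (fun x => (f n.+1 x - f n x) ^+ 2) <= C / 16 ^+ n) ->
  exists g : R -> R, exists2 D : R, measurable_fun `[a, b] g &
    forall n, intg a b (fun x => (g x - f n x) ^+ 2) /\
      rint a b (fun x => (g x - f n x) ^+ 2) <= D / 4 ^+ n.
Proof.
move=> mf if2 idf Hdf.
(* The rate 16^-n is split evenly: the weight 4^n leaves integrals of order 4^-n, so the series [S]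
   is integrable, and each squared increment is at most S / 4^n where [S] is finite. *)
pose q n x : R := 4 ^+ n * (f n.+1 x - f n x) ^+ 2.
have q0 n x : 0 <= q n x by apply: mulr_ge0; [exact: exprn_ge0|exact: sqr_ge0].
have iq n : intg a b (q n) by apply: intgZ.
have C0 : 0 <= C.
  have := Hdf 0%N; rewrite expr0 divr1; apply: le_trans.
  by apply: Rintegral_ge0 => x _; exact: sqr_ge0.
pose S x : \bar R := (\sum_(0 <= n <oo) (q n x)%:E)%E.
have mq n : measurable_fun `[a, b] (fun x => (q n x)%:E).
  by apply/measurable_EFinP; exact: intg_measurable.
have S0 x : (0 <= S x)%E by apply: nneseries_ge0 => n _ _; rewrite lee_fin.
have mS : measurable_fun `[a, b] S.
  by apply: ge0_emeasurable_sum => [n x _ _|n _]; [rewrite lee_fin|exact: mq].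
have intS : (\int[@lebesgue_measure R]_(x in `[a, b]) S x <= (2 * C)%:E)%E.
  rewrite /S integral_nneseries//; last by move=> n x _; rewrite lee_fin.
  apply: lime_le.
    by apply: is_cvg_nneseries => n _ _; apply: integral_ge0 => x _; rewrite lee_fin.
  apply: nearW => n; rewrite (eq_bigr (fun k => (rint a b (q k))%:E)); last first.
    by move=> k _; rewrite /rint /Rintegral fineK//; apply: integrable_fin_num => //; exact: iq.
  rewrite sumEFin lee_fin.
  have B k : rint a b (q k) <= C / 4 ^+ k.
    rewrite intZ//; have := Hdf k; have p4 : 0 < (4 : R) ^+ k by apply: exprn_gt0; lra.
    move=> /(ler_wpM2l (ltW p4)); congr (_ <= _).
    rewrite (_ : (16 : R) = 4 * 4); last by ring.
    by rewrite exprMn; field; rewrite gt_eqF.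
  (* A majorant suited to induction: it grows by (3/2) C / 4^n, more than the term added. *)
  suff : \sum_(0 <= k < n) rint a b (q k) <= C * (2 - 2 / 4 ^+ n).
    move=> /le_trans; apply; rewrite mulrC; apply: ler_wpM2r => //.
    have : 0 <= 2 / (4 : R) ^+ n by rewrite divr_ge0// exprn_ge0.
    lra.
  elim: n => [|n IH]; first by rewrite big_nil expr0 divr1 subrr mulr0.
  rewrite big_nat_recr//=; have := B n; move: IH; rewrite exprS invfM !mulrA.
  set r := (4 ^+ n)^-1; have r0 : 0 <= C * r by rewrite mulr_ge0// invr_ge0 exprn_ge0.
  have -> : C * (2 - 2 * r) = C * 2 - 2 * (C * r) by ring.
  have -> : C * (2 - 2 / 4 * r) = C * 2 - 2^-1 * (C * r) by field.
  lra.
have iS : (@lebesgue_measure R).-integrable `[a, b] S.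
  apply/integrableP; split => //; apply: le_lt_trans (ltry (2 * C)).
  apply: le_trans intS; rewrite le_eqVlt; apply/orP; left; apply/eqP.
  by apply: eq_integral => x _; rewrite gee0_abs.
have [N [mN N0 SN]] : {ae @lebesgue_measure R, forall x, `[a, b]%classic x -> S x \is a fin_num}.
  exact: integrable_ae.
pose s x := fine (S x).
have s0 x : 0 <= s x by exact: fine_ge0.
have is_ : intg a b s.
  apply: le_integrable iS => //.
    by apply/measurable_EFinP; apply: measurableT_comp => //; exact: measurable_fine.
  move=> x _ /=; rewrite ger0_norm// gee0_abs// /s.
  by case: (S x) (S0 x) => //= _; rewrite leey.
have qs n x : a <= x <= b -> ~ N x -> q n x <= s x.
  move=> xab nNx; have fS : S x \is a fin_num.
    apply: contrapT => nf; apply: nNx; apply: SN => /= H.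
    by apply: nf; apply: H; rewrite /= in_itv.
  rewrite -lee_fin /s fineK//; apply: le_trans (nneseries_lim_ge n.+1 _).
    rewrite big_nat_recr//= leeDr// sume_ge0// => k _; rewrite lee_fin; exact: q0.
  by move=> k _; rewrite lee_fin.
(* Replacing the functions by 0 on the null set [N] gives convergence at every point of [a, b], so
   the limit is measurable. *)
pose h n x := f n x * \1_(~` N) x.
have mh n : measurable_fun `[a, b] (h n).
  apply: measurable_funM => //.
  by apply: measurable_indic; exact: measurableC.
have hS n x : a <= x <= b -> `|h n.+1 x - h n x| <= Num.sqrt (s x) / 2 ^+ n.
  move=> xab; have p2 : 0 < (2 : R) ^+ n by apply: exprn_gt0; lra.
  have [Nx|nNx] := pselect (N x).
    have -> : h n.+1 x - h n x = 0.
      by rewrite /h indicE memNset ?mulr0 ?subrr //= => H; exact: H.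
    by rewrite normr0 divr_ge0 ?sqrtr_ge0// ltW.
  have -> : h n.+1 x - h n x = f n.+1 x - f n x.
    by rewrite /h indicE mem_set ?mulr1.
  have H := qs n x xab nNx.
  rewrite ler_pdivlMr// -[X in X <= _]ger0_norm ?mulr_ge0 ?(ltW p2)//.
  rewrite -sqrtr_sqr ler_wsqrtr// exprMn real_normK ?num_real//.
  move: H; rewrite /q (_ : (4 : R) = 2 ^+ 2); last by rewrite expr2; ring.
  by rewrite -exprM mulnC exprM mulrC.
pose g x := limn (fun n => h n x).
have gh n x : a <= x <= b -> (g x - h n x) ^+ 2 <= 4 * s x / 4 ^+ n.
  move=> xab; have [_ /(_ n) H] := geometric_cvg _ _ (hS^~ x ^~ xab).
  have p2 : 0 < (2 : R) ^+ n by apply: exprn_gt0; lra.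
  have r0 : 0 <= 2 * Num.sqrt (s x) / 2 ^+ n.
    by rewrite divr_ge0 ?mulr_ge0 ?sqrtr_ge0// ltW.
  rewrite -[X in X ^+ 2]/(_) -real_normK ?num_real//.
  apply: (@le_trans _ _ ((2 * Num.sqrt (s x) / 2 ^+ n) ^+ 2)).
    by rewrite ler_sqr ?nnegrE.
  rewrite !exprMn sqr_sqrtr// exprVn -exprM mulnC exprM.
  by rewrite (_ : (2 : R) ^+ 2 = 4)//; rewrite expr2; ring.
have mg : measurable_fun `[a, b] g.
  apply: (@measurable_fun_cvg _ _ _ _ (fun n => h n)) => // x.
  by rewrite /= in_itv/= => xab; have [] := geometric_cvg _ _ (hS^~ x ^~ xab).
have igh n : intg a b (fun x => (g x - h n x) ^+ 2).
  apply: (le_intg _ _ _ (fun x => 4 * s x / 4 ^+ n)).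
  - by apply: measurable_funX; apply: measurable_funB.
  - by move=> x xab; rewrite ger0_norm ?sqr_ge0//; exact: gh.
  - apply: (eq_intg _ _ (fun x => (4 / 4 ^+ n) * s x)); last exact: intgZ.
    by move=> x _; rewrite mulrAC.
exists g; exists (4 * rint a b s) => // n.
have i1 : intg a b (fun x => (g x - f n x) ^+ 2).
  apply: (le_intg _ _ _ (fun x => 2 * (g x - h n x) ^+ 2 + 2 * f n x ^+ 2)).
  - by apply: measurable_funX; apply: measurable_funB.
  - move=> x _; rewrite ger0_norm ?sqr_ge0// /h indicE.
    have h1 := sqr_ge0 (g x); have h2 := sqr_ge0 (g x + f n x).
    have h3 := sqr_ge0 (f n x); have h4 := sqr_ge0 (g x - f n x).
    by case: (x \in ~` N); rewrite ?mulr1 ?mulr0 ?subr0; nra.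
  - by apply: intgD; apply: intgZ.
split => //; rewrite (ae_eq_int _ _ _ (fun x => (g x - h n x) ^+ 2)).
- apply: (@le_trans _ _ (rint a b (fun x => (4 / 4 ^+ n) * s x))).
    apply: le_int => //; first exact: intgZ.
    by move=> x xab; rewrite mulrAC; exact: gh.
  by rewrite intZ// mulrAC.
- by apply: measurable_funX; apply: measurable_funB.
- by apply: measurable_funX; apply: measurable_funB.
- exists N; split => // x /= H; apply: contrapT => nN; apply: H => _.
  by rewrite /h indicE mem_set ?mulr1.
Qed.

(** * Orthogonality, completeness and density in L_2 *)

Lemma pow4_small {R : realType} (K e : R) : 0 < e -> exists n : nat, K / 4 ^+ n < e.
Proof.
move=> e0; apply: contrapT => H.
suff : e = 0 by lra.
apply: (pow2_squeeze e `|K|) => n; rewrite (ger0_norm (ltW e0)).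
have p2 : 0 < (2 : R) ^+ n by apply: exprn_gt0; lra.
have p4 : 0 < (4 : R) ^+ n by apply: exprn_gt0; lra.
have h1 : e <= K / 4 ^+ n by rewrite leNgt; apply/negP => h; apply: H; exists n.
apply: le_trans h1 _; apply: (@le_trans _ _ (`|K| / 4 ^+ n)).
  by apply: ler_wpM2r; [rewrite invr_ge0 ltW|exact: ler_norm].
apply: ler_wpM2l => //; rewrite lef_pV2 ?posrE//.
by rewrite lerXn2r ?nnegrE; lra.
Qed.

(* When [d] is (nearly) the squared distance from [x] to a subspace containing
   [u], this says that [x] is (nearly) orthogonal to [u]. *)
Lemma minimal_ip {R : realType} (a b d : R) (x u : R -> R[i]) : L2 a b x -> L2 a b u ->
  (forall t : R[i], d <= nrm2 a b (fun y => x y - t * u y)) ->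
  cnorm2 (ip a b x u) <= (nrm2 a b x - d) * (nrm2 a b u + 1).
Proof.
move=> hx hu H; set z := ip a b x u; set N := nrm2 a b u.
have N0 : 0 <= N by exact: nrm2_ge0.
have c0 := cnorm2_ge0 z.
(* The minimizing multiplier of [u] would be z / N; the denominator N + 1 also covers u = 0. *)
pose s := (N + 1)^-1; have s0 : 0 < s by rewrite invr_gt0; lra.
have := H (s%:C%C * z); rewrite nrm2B//; last exact: L2Z.
rewrite ipZr// nrm2Z// -/z -/N.
have E (y : R[i]) : Re ((s%:C%C * y)^* * y) = s * cnorm2 y.
  by rewrite !cplxE /= /cnorm2; ring.
rewrite E.
rewrite cnorm2M (_ : cnorm2 s%:C%C = s ^+ 2); last by rewrite /cnorm2 /= expr0n /= addr0.
have sN : s * N <= 1 by rewrite /s mulrC ler_pdivrMr; lra.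
have sN1 : s * (N + 1) = 1 by rewrite /s mulVf//; lra.
move=> h1.
have h2 : s * cnorm2 z * (s * N) <= s * cnorm2 z * 1 by apply: ler_wpM2l => //; rewrite mulr_ge0// ltW.
have h3 : s * cnorm2 z <= nrm2 a b x - d.
  have e1 : s ^+ 2 * cnorm2 z * N = s * cnorm2 z * (s * N) by ring.
  move: h1; rewrite e1; lra.
have N1 : 0 <= N + 1 by lra.
have := ler_wpM2r N1 h3.
by rewrite mulrAC sN1 mul1r.
Qed.

(** A weak form of the Cauchy-Schwarz inequality: [minimal_ip] with the lower bound 0. *)
Lemma ip_bound {R : realType} (a b : R) (x u : R -> R[i]) : L2 a b x -> L2 a b u ->
  cnorm2 (ip a b x u) <= nrm2 a b x * (nrm2 a b u + 1).
Proof.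
move=> hx hu; have := minimal_ip a b 0 x u hx hu; rewrite subr0; apply => t; exact: nrm2_ge0.
Qed.

Lemma cnorm2D_le {R : realType} (x y : R[i]) : cnorm2 (x + y) <= 2 * cnorm2 x + 2 * cnorm2 y.
Proof.
rewrite /cnorm2 !cplxE; have := sqr_ge0 (Re x - Re y); have := sqr_ge0 (Im x - Im y); nra.
Qed.

Lemma nrm2D_le {R : realType} (a b : R) (x y : R -> R[i]) : L2 a b x -> L2 a b y ->
  nrm2 a b (fun t => x t + y t) <= 2 * nrm2 a b x + 2 * nrm2 a b y.
Proof.
move=> hx hy; have /L2P[_ _ ix] := hx; have /L2P[_ _ iy] := hy.
have /L2P[_ _ ixy] := L2D _ _ _ _ hx hy.
rewrite /nrm2 -!intZ// -intD; [|exact: intgZ|exact: intgZ].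
apply: le_int => //; first by apply: intgD; exact: intgZ.
by move=> t _; exact: cnorm2D_le.
Qed.

(** The midpoint form is the one that makes a minimizing sequence Cauchy: the midpoint is again at
    squared distance at least [d] from [w]. *)
Lemma parallelogram {R : realType} (a b : R) (w x y : R -> R[i]) :
  L2 a b w -> L2 a b x -> L2 a b y ->
  nrm2 a b (fun t => x t - y t) = 2 * nrm2 a b (fun t => w t - x t) +
    2 * nrm2 a b (fun t => w t - y t) - 4 * nrm2 a b (fun t => w t - 2^-1 * (x t + y t)).
Proof.
move=> hw hx hy.
have /L2P[_ _ i1] := L2B _ _ _ _ hw hx; have /L2P[_ _ i2] := L2B _ _ _ _ hw hy.
have /L2P[_ _ i3] := L2B _ _ _ _ hw (L2Z _ _ 2^-1 _ (L2D _ _ _ _ hx hy)).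
rewrite /nrm2 -!intZ// -intD; [|exact: intgZ|exact: intgZ].
rewrite -intB; [|by apply: intgD; exact: intgZ|exact: intgZ].
apply: eq_int => t _; set p := w t; set q := x t; set r := y t.
have -> : cnorm2 (p - 2^-1 * (q + r)) = 4^-1 * cnorm2 (2 * p - (q + r)).
  have -> : p - 2^-1 * (q + r) = 2^-1 * (2 * p - (q + r)) by field.
  rewrite cnorm2M; congr (_ * _).
  have -> : (2^-1 : R[i]) = (2^-1)%:C%C by rewrite fmorphV rmorphMn rmorph1.
  by rewrite /cnorm2 /=; field.
have -> : (2 : R[i]) * p = p + p by ring.
by rewrite /cnorm2 !cplxE; field.
Qed.

Lemma L2_complete {R : realType} (a b C : R) (f : nat -> R -> R[i]) :
  (forall n, L2 a b (f n)) ->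
  (forall n, nrm2 a b (fun x => f n.+1 x - f n x) <= C / 16 ^+ n) ->
  exists g, exists2 D, L2 a b g & forall n, nrm2 a b (fun x => g x - f n x) <= D / 4 ^+ n.
Proof.
move=> hf Hd.
have hfd n := L2B _ _ _ _ (hf n.+1) (hf n).
have split_sq (u : R -> R[i]) : L2 a b u -> intg a b (fun x => Re (u x) ^+ 2) /\ intg a b (fun x => Im (u x) ^+ 2).
  move=> /L2P[m1 m2 iu]; split; apply: le_intg iu.
  - exact: measurable_funX.
  - by move=> x _; rewrite ger0_norm ?sqr_ge0// /cnorm2 lerDl sqr_ge0.
  - exact: measurable_funX.
  - by move=> x _; rewrite ger0_norm ?sqr_ge0// /cnorm2 lerDr sqr_ge0.
have [] := @real_L2_cvg R a b C (fun n x => Re (f n x)).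
- by move=> n; have /L2P[] := hf n.
- by move=> n; exact: (split_sq _ (hf n)).1.
- by move=> n; apply: (eq_intg _ _ _ _ _ (split_sq _ (hfd n)).1) => x _; rewrite !cplxE.
- move=> n; apply: le_trans (Hd n); have /L2P[_ _ i1] := hfd n.
  apply: le_int => //.
    by apply: (eq_intg _ _ _ _ _ (split_sq _ (hfd n)).1) => x _; rewrite !cplxE.
  by move=> x _; rewrite /cnorm2 !cplxE lerDl sqr_ge0.
move=> g1 [D1 mg1 H1].
have [] := @real_L2_cvg R a b C (fun n x => Im (f n x)).
- by move=> n; have /L2P[] := hf n.
- by move=> n; exact: (split_sq _ (hf n)).2.
- by move=> n; apply: (eq_intg _ _ _ _ _ (split_sq _ (hfd n)).2) => x _; rewrite !cplxE.
- move=> n; apply: le_trans (Hd n); have /L2P[_ _ i1] := hfd n.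
  apply: le_int => //.
    by apply: (eq_intg _ _ _ _ _ (split_sq _ (hfd n)).2) => x _; rewrite !cplxE.
  by move=> x _; rewrite /cnorm2 !cplxE lerDr sqr_ge0.
move=> g2 [D2 mg2 H2].
have hgf n : L2 a b (fun x => Complex (g1 x) (g2 x) - f n x).
  have [i1 _] := H1 n; have [i2 _] := H2 n; have /L2P[m1 m2 _] := hf n.
  apply/L2P; split.
  - rewrite (_ : (fun _ => _) = g1 \- (fun x => Re (f n x))); first exact: measurable_funB.
    by apply/funext => x /=; rewrite !cplxE.
  - rewrite (_ : (fun _ => _) = g2 \- (fun x => Im (f n x))); first exact: measurable_funB.
    by apply/funext => x /=; rewrite !cplxE.
  - by apply: (eq_intg _ _ _ _ _ (intgD _ _ _ _ i1 i2)) => x _; rewrite /cnorm2 !cplxE.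
exists (fun x => Complex (g1 x) (g2 x)), (D1 + D2).
  have := L2D _ _ _ _ (hgf 0%N) (hf 0%N).
  by congr L2; apply/funext => x; rewrite subrK.
move=> n; have [i1 h1] := H1 n; have [i2 h2] := H2 n.
rewrite mulrDl; apply: le_trans (lerD h1 h2); rewrite -intD//.
by rewrite le_eqVlt; apply/orP; left; apply/eqP/eq_int => x _; rewrite /cnorm2 !cplxE.
Qed.

(** Projection onto the closure of [D]. A minimizing sequence for the distance from [w] converges to
    some [p]; since w - p is orthogonal to [D], it is null, and the members of the sequence
    approximate [w]. *)
Lemma dense_of_orthogonal {R : realType} (a b : R) (D : (R -> R[i]) -> Prop) :
  (forall u, D u -> L2 a b u) -> D (fun=> 0) ->
  (forall u v, D u -> D v -> D (fun x => u x + v x)) ->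
  (forall c u, D u -> D (fun x => c * u x)) ->
  (forall w, L2 a b w -> (forall u, D u -> ip a b w u = 0) -> nrm2 a b w = 0) ->
  forall w, L2 a b w -> forall e : R, 0 < e ->
    exists2 u, D u & nrm2 a b (fun x => w x - u x) < e.
Proof.
move=> DL D0 DD DZ Dorth w hw e e0.
pose E := [set nrm2 a b (fun x => w x - u x) | u in D].
have hE : has_inf E.
  split; first by exists (nrm2 a b (fun x => w x - 0)), (fun=> 0).
  by exists 0 => _ [u _ <-]; exact: nrm2_ge0.
pose d := inf E.
have dE u : D u -> d <= nrm2 a b (fun x => w x - u x).
  by move=> Du; apply: ge_inf; [exact: hE.2|exists u].
(* An excess of 16^-n in the squared distance makes the squared increments at most 4 * 16^-n by the
   parallelogram identity, the rate that [L2_complete] asks for. *)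
have /choice[f Hf] : forall n, exists u, D u /\ nrm2 a b (fun x => w x - u x) < d + 16^-1 ^+ n.
  move=> n; have p : 0 < (16^-1 : R) ^+ n by apply: exprn_gt0; lra.
  by have [_ [u Du <-] h] := inf_adherent p hE; exists u.
have hf n : L2 a b (f n) by apply: DL; have [] := Hf n.
have [n|p [C hp Hp]] := L2_complete a b 4 f hf.
  have [D1 h1] := Hf n.+1; have [D2 h2] := Hf n.
  rewrite (parallelogram _ _ w)//.
  have h3 := dE _ (DZ 2^-1 _ (DD _ _ D1 D2)).
  move: h1; rewrite exprS; have -> : 4 / 16 ^+ n = 4 * (16^-1 : R) ^+ n by rewrite exprVn.
  have := exprn_ge0 n (_ : 0 <= (16^-1 : R)); move=> /(_ ltac:(lra)).
  move: h2 h3; lra.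
have hwp := L2B _ _ _ _ hw hp.
have C0 : 0 <= C by have := Hp 0%N; rewrite expr0 divr1; apply: le_trans; exact: nrm2_ge0.
have h0 : nrm2 a b (fun x => w x - p x) = 0.
  apply: Dorth => // u Du; have hu := DL u Du.
  apply: cnorm2_eq0; set N := nrm2 a b u + 1; have N0 : 0 <= N by rewrite addr_ge0// nrm2_ge0.
  apply: (pow2_squeeze _ (2 * (1 + C) * N)) => n; rewrite ger0_norm ?cnorm2_ge0//.
  have [Dn hn] := Hf n.
  have hwn := L2B _ _ _ _ hw (hf n); have hpn := L2B _ _ _ _ hp (hf n).
  (* The first summand is small because [f n] nearly minimizes the distance, the second because
     [f n] is close to [p]. *)
  have -> : ip a b (fun x => w x - p x) u =
     ip a b (fun x => w x - f n x) u + ip a b (fun x => (-1) * (p x - f n x)) u.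
    rewrite -ipDl//; last exact: L2Z.
    by congr ip; apply/funext => x; ring.
  apply: le_trans (cnorm2D_le _ _) _; rewrite ipZl// cnorm2M.
  have -> : cnorm2 (-1 : R[i]) = 1 by rewrite /cnorm2 !cplxE /=; ring.
  rewrite mul1r.
  have b1 : cnorm2 (ip a b (fun x => w x - f n x) u) <= (16^-1) ^+ n * N.
    apply: le_trans (minimal_ip a b d _ _ hwn hu _) _.
      move=> t; have := dE _ (DD _ _ Dn (DZ t _ Du)).
      by congr (_ <= nrm2 _ _ _); apply/funext => x; ring.
    by apply: ler_wpM2r => //; lra.
  have b2 : cnorm2 (ip a b (fun x => p x - f n x) u) <= C / 4 ^+ n * N.
    by apply: le_trans (ip_bound _ _ _ _ hpn hu) _; apply: ler_wpM2r.
  have q0 : 0 < (2 : R) ^+ n by apply: exprn_gt0; lra.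
  have q1 : (16^-1 : R) ^+ n <= (2^-1) ^+ n by rewrite lerXn2r ?nnegrE; lra.
  have q2 : (4 ^+ n)^-1 <= (2 ^+ n)^-1 :> R.
    by rewrite -!exprVn lerXn2r ?nnegrE; lra.
  have b3 : (16^-1) ^+ n * N <= (2 ^+ n)^-1 * N by apply: ler_wpM2r => //; rewrite -exprVn.
  have b4 : C / 4 ^+ n * N <= C / 2 ^+ n * N by apply: ler_wpM2r => //; apply: ler_wpM2l.
  have -> : 2 * (1 + C) * N / 2 ^+ n = 2 * ((2 ^+ n)^-1 * N) + 2 * (C / 2 ^+ n * N) by ring.
  lra.
have [n hn] := pow4_small (2 * C) e e0.
exists (f n); first by have [] := Hf n.
apply: le_lt_trans hn.
have -> : nrm2 a b (fun x => w x - f n x) = nrm2 a b (fun x => (w x - p x) + (p x - f n x)).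
  by congr nrm2; apply/funext => x; ring.
apply: le_trans (nrm2D_le _ _ _ _ hwp (L2B _ _ _ _ hp (hf n))) _.
by rewrite h0 mulr0 add0r -mulrA; have := Hp n; lra.
Qed.

(** * Quasi-derivatives *)

Section Operators.
Context {R : realType} (a b : R) (m : nat) (Q : R -> R).
Context (ab : a < b) (m3 : (3 <= m)%N) (iQ : intg a b Q).

Local Notation ci := (iC R).
Local Notation qd := (qd_data m a b Q).

Lemma iC_sqr : ci * ci = -1.
Proof. by apply: cplx_ext; rewrite !cplxE /=; ring. Qed.

Lemma iC_conj : ci^* = - ci.
Proof. by apply: cplx_ext; rewrite !cplxE /=; ring. Qed.

Lemma iC_neq0 : ci != 0.
Proof. by apply/eqP => h; have := iC_sqr; rewrite h mul0r => /eqP; rewrite eq_sym oppr_eq0 oner_eq0. Qed.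

Lemma iCX_unit : ci ^+ m * ci ^- m = 1.
Proof. by rewrite divff// expf_neq0// iC_neq0. Qed.

Lemma iC_inv : ci^-1 = - ci.
Proof.
apply: (mulfI iC_neq0); rewrite divff ?iC_neq0// mulrN iC_sqr opprK.
by [].
Qed.

Lemma iCX_conj : (ci ^+ m)^* = ci ^- m.
Proof. by rewrite rmorphXn /= iC_conj -iC_inv exprVn. Qed.

Lemma iCVX_conj : (ci ^- m)^* = ci ^+ m.
Proof. by rewrite -iCX_conj conjCK. Qed.

Lemma iCX_sign : ci ^- m = (-1) ^+ m * ci ^+ m.
Proof. by rewrite -exprVn iC_inv; exact: exprNn. Qed.

Lemma ae_closed (P : R -> Prop) : {ae @lebesgue_measure R, forall x, a < x < b -> P x} ->
  {ae @lebesgue_measure R, forall x, a <= x <= b -> P x}.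
Proof.
move=> H; have nA : (@lebesgue_measure R).-negligible ([set a] `|` [set b]).
  by apply: negligibleU; apply/negligibleP => //; exact: lebesgue_measure_set1.
have := negligibleU H nA; apply: negligibleS => x /= nP.
have [xa|xa] := eqVneq x a; first by right; left.
have [xb|xb] := eqVneq x b; first by right; right.
left => h; apply: nP => /andP[h1 h2]; apply: h; rewrite !lt_neqAle h1 h2 xb eq_sym xa.
by [].
Qed.

Lemma cac_ae0 (z : R -> R[i]) : cac a b z -> aeeq a b z (fun=> 0) ->
  forall x, a <= x <= b -> z x = 0.
Proof.
have H (g : R -> R) : ac a b g -> {ae @lebesgue_measure R, forall x, a <= x <= b -> g x = 0} ->
    forall x, a <= x <= b -> g x = 0.
  move=> acg g0 x xab; apply/eqP; rewrite -normr_le0; apply/ler_addgt0Pl => e e0.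
  rewrite addr0; have [d d0 Hd] := ac_unif a b g e acg e0.
  pose c := Num.max a (x - d / 2); pose c' := Num.min b (x + d / 2).
  have cc : c < c' by rewrite /c /c' gt_max !lt_min ab; move/andP: xab => [? ?]; rewrite andbC; do ?[apply/andP; split]; lra.
  have [y /andP[cy yc] Py] := ae_itv_ex _ _ _ cc g0.
  move: cy yc; rewrite /c /c' gt_max lt_min => /andP[ay xdy] /andP[yb yxd].
  have yab : a <= y <= b by rewrite !ltW.
  have := Hd y x yab xab; rewrite (Py yab) subr0 => h; apply: ltW; apply: h.
  by rewrite ltr_norml; apply/andP; split; lra.
move=> [h1 h2] h0 x xab; apply: cplx_ext.
  by apply: (H _ h1) => //; apply: aeS h0 => y Hy /Hy ->.
by apply: (H _ h2) => //; apply: aeS h0 => y Hy /Hy ->.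
Qed.

Lemma has_cderiv_uniq (z : R -> R[i]) (x : R) (d e : R[i]) : has_cderiv z x d -> has_cderiv z x e -> d = e.
Proof.
move=> [[_ h1] [_ h2]] [[_ h3] [_ h4]]; apply: cplx_ext; by rewrite -?h1 -?h2 -?h3 -?h4.
Qed.


Lemma has_cderiv0 (z : R -> R[i]) (x : R) (d : R[i]) : a < x < b ->
  (forall y, a <= y <= b -> z y = 0) -> has_cderiv z x d -> d = 0.
Proof.
move=> xab z0 hz; apply: (has_cderiv_uniq z x) => //.
have nz : \near x, z x = 0.
  near=> y; apply: z0; have : y \in `]a, b[ by near: y; apply: near_in_itvoo; rewrite in_itv.
  by rewrite in_itv/= => /andP[? ?]; rewrite !ltW.
split; apply: near_eq_is_derive (is_derive_cst 0 _ _); by apply: filterS nz => y ->.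
Unshelve. all: by end_near.
Qed.

Lemma qd_cac z f k : qd z f -> (k < m)%N -> cac a b (z k).
Proof. by move=> [h _] km; apply/abs_contP; exact: h. Qed.

Lemma qdD z w f g : qd z f -> qd w g ->
  qd (fun k x => z k x + w k x) (fun x => f x + g x).
Proof.
move=> [z1 z2] [w1 w2]; split.
  by move=> k km; apply/abs_contP/cacD; apply/abs_contP; [exact: z1|exact: w1].
apply: aeS2 z2 w2 => x hz hw xab; have [z3 [z4 z5]] := hz xab; have [w3 [w4 w5]] := hw xab.
split; first by move=> k km; apply: has_cderivD; [exact: z3|exact: w3].
split.
  by have := has_cderivD _ _ _ _ _ z4 w4; congr has_cderiv; ring.
by have := has_cderivD _ _ _ _ _ z5 w5; congr has_cderiv; ring.
Qed.

Lemma qdZ c z f : qd z f -> qd (fun k x => c * z k x) (fun x => c * f x).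
Proof.
move=> [z1 z2]; split.
  by move=> k km; apply/abs_contP/cacM; [exact: cac_cst|apply/abs_contP; exact: z1].
apply: aeS z2 => x hz xab; have [z3 [z4 z5]] := hz xab.
split; first by move=> k km; apply: has_cderivZ; exact: z3.
split.
  by have := has_cderivZ c _ _ _ z4; congr has_cderiv; ring.
by have := has_cderivZ c _ _ _ z5; congr has_cderiv; ring.
Qed.

Lemma qd0 : qd (fun _ _ => 0) (fun=> 0).
Proof.
split; first by move=> k km; apply/abs_contP; exact: cac_cst.
exists set0; split => // x /= nP; case: nP => _.
split; first by move=> k _; exact: has_cderiv_cst.
by split; rewrite !mulr0 ?subr0 ?addr0; exact: has_cderiv_cst.
Qed.

Lemma qd_sum (I : Type) (s : seq I) (z : I -> nat -> R -> R[i]) (f : I -> R -> R[i]) :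
  (forall i, qd (z i) (f i)) ->
  qd (fun k x => \sum_(i <- s) z i k x) (fun x => \sum_(i <- s) f i x).
Proof.
move=> H; elim: s => [|i s IH].
  have := qd0; congr (qd_data _ _ _ _ _ _); [apply/funext => k|]; apply/funext => x; by rewrite big_nil.
have := qdD _ _ _ _ (H i) IH; congr (qd_data _ _ _ _ _ _); [apply/funext => k|]; apply/funext => x;
by rewrite big_cons.
Qed.

Lemma qd_ae z f g : qd z f -> aeeq a b f g -> qd z g.
Proof.
move=> [z1 z2] fg; split => //; apply: aeS2 z2 fg => x hz E xab.
have xab' : a <= x <= b by move/andP: xab => [? ?]; rewrite !ltW.
by have [z3 [z4 z5]] := hz xab; rewrite -(E xab').
Qed.

(* The right-hand side of the first-order system: [dq z f k] is the derivative
   of [z k], for all [k < m] at once. *)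
Definition dq (z : nat -> R -> R[i]) (f : R -> R[i]) (k : nat) (x : R) : R[i] :=
  (if (k == m - 1)%N then f x else z k.+1 x) +
  ((k == m - 1)%N%:R * (ci ^- m * (Q x)%:C%C * z 1%N x) -
   (k == m - 2)%N%:R * (ci ^- m * (Q x)%:C%C * z 0%N x)).

Lemma qd_dq z f : qd z f -> {ae @lebesgue_measure R, forall x, a < x < b ->
  forall k, (k < m)%N -> has_cderiv (z k) x (dq z f k x)}.
Proof.
move=> [_]; apply: aeS => x H xab k km; have [z3 [z4 z5]] := H xab; rewrite /dq.
have [k1|k1] := eqVneq k (m - 1)%N.
  rewrite k1 (_ : (m - 1 == m - 2)%N = false); last by apply/eqP; lia.
  by rewrite mul1r mul0r subr0.
have [k2|k2] := eqVneq k (m - 2)%N.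
  rewrite k2 mul0r mul1r add0r; rewrite (_ : (m - 2).+1 = (m - 1)%N); last by lia.
  exact: z4.
rewrite !mul0r subr0 addr0; apply: z3; lia.
Qed.

Lemma qd_of_dq z f : (forall k, (k < m)%N -> cac a b (z k)) ->
  {ae @lebesgue_measure R, forall x, a < x < b ->
    forall k, (k < m)%N -> has_cderiv (z k) x (dq z f k x)} -> qd z f.
Proof.
move=> hz H; split; first by move=> k km; apply/abs_contP; exact: hz.
apply: aeS H => x H xab; split.
  move=> k km; have := H xab k; rewrite /dq (_ : (k == m - 1)%N = false); last by apply/eqP; lia.
  rewrite (_ : (k == m - 2)%N = false); last by apply/eqP; lia.
  by rewrite !mul0r subr0 addr0; apply; lia.
split.
  have := H xab (m - 2)%N; rewrite /dq (_ : (m - 2 == m - 1)%N = false); last by apply/eqP; lia.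
  rewrite eqxx mul0r mul1r add0r (_ : (m - 2).+1 = (m - 1)%N); last by lia.
  by apply; lia.
have := H xab (m - 1)%N; rewrite /dq (_ : (m - 1 == m - 2)%N = false); last by apply/eqP; lia.
by rewrite eqxx mul1r mul0r subr0; apply; lia.
Qed.

(** This makes quasi-derivatives and L_max y depend only on the class of [y]. The continuous
    function [z 0] vanishes identically, and each later quasi-derivative is read off the derivative
    of its predecessor; the Q-terms vanish because [z 0] and [z 1] do. *)
Lemma qd_eq0 z f : qd z f -> aeeq a b (z 0%N) (fun=> 0) ->
  (forall k, (k < m)%N -> forall x, a <= x <= b -> z k x = 0) /\ aeeq a b f (fun=> 0).
Proof.
move=> hz z0.
have H k : (k < m)%N -> forall x, a <= x <= b -> z k x = 0.
  have [n kn] := ubnP k; elim: n k kn => // n IH [|k] kn km.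
    by apply: cac_ae0 => //; exact: qd_cac hz _.
  apply: cac_ae0; first exact: qd_cac hz _.
  apply: ae_closed; apply: aeS (qd_dq _ _ hz) => x Hx xab.
  have zk y : a <= y <= b -> z k y = 0 by apply: IH; lia.
  have z0' y : a <= y <= b -> z 0%N y = 0 by apply: IH; lia.
  have xab' : a <= x <= b by move/andP: xab => [? ?]; rewrite !ltW.
  have := has_cderiv0 _ _ _ xab zk (Hx xab k ltac:(lia)).
  rewrite /dq (_ : (k == m - 1)%N = false); last by apply/eqP; lia.
  by rewrite z0'// !mulr0 mul0r subr0 addr0.
split => //; apply: ae_closed; apply: aeS (qd_dq _ _ hz) => x Hx xab.
have xab' : a <= x <= b by move/andP: xab => [? ?]; rewrite !ltW.
have m1 : (m - 1 < m)%N by lia.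
have := has_cderiv0 _ _ _ xab (H _ m1) (Hx xab _ m1).
rewrite /dq eqxx H ?H//; [|lia..].
by rewrite !mulr0 subr0 addr0.
Qed.

Lemma cintg_Q c : cintg a b (fun x => c * (Q x)%:C%C).
Proof. by apply: cintgZ; split => //=; exact: intg_cst. Qed.

Lemma sum_delta (n : nat) (F : 'I_n -> R[i]) (j : nat) (jn : (j < n)%N) :
  \sum_(k < n) (val k == j)%:R * F k = F (Ordinal jn).
Proof.
rewrite (bigD1 (Ordinal jn)) //= eqxx mul1r big1 ?addr0// => k kj.
by rewrite (_ : (val k == j) = false) ?mul0r//; apply: contraNF kj => /eqP kj; apply/eqP/val_inj.
Qed.

(** One statement covers ker (L_max - la) with g = 0, the equation L_max y = g with la = 0, and the
    inhomogeneous equation for L_max + i. *)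
Lemma qd_exists (la : R[i]) (g : R -> R[i]) (al : nat -> R[i]) : cintg a b g ->
  exists z, qd z (fun x => g x + la * z 0%N x) /\ forall k, (k < m)%N -> z k a = al k.
Proof.
move=> ig.
pose A (j k : 'I_m) (x : R) : R[i] :=
  (if (val j == m - 1)%N then (val k == 0)%N%:R * la else (val k == (val j).+1)%N%:R) +
  ((val j == m - 1)%N%:R * ((val k == 1)%N%:R * (ci ^- m * (Q x)%:C%C)) -
   (val j == m - 2)%N%:R * ((val k == 0)%N%:R * (ci ^- m * (Q x)%:C%C))).
pose F (j : 'I_m) (x : R) : R[i] := (val j == m - 1)%N%:R * g x.
have iA j k : cintg a b (A j k).
  apply: cintgD; first by split; exact: intg_cst.
  apply: cintgD; first by apply: cintgZ; apply: cintgZ; exact: cintg_Q.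
  have := cintgZ _ _ (-1) _ (cintgZ _ _ (val j == m - 2)%N%:R _ (cintgZ _ _ (val k == 0)%N%:R _ (cintg_Q (ci ^- m)))).
  by congr cintg; apply/funext => x; rewrite mulN1r.
have iF j : cintg a b (F j) by apply: cintgZ.
have [w [w1 w2 w3]] := clinear_ode a b _ A F (fun j => al (val j)) (ltW ab) iA iF.
(* The default value 0 concerns only the indices k >= m, which [qd_data] does not read. *)
pose z k x := if insub k is Some j then w j x else 0.
have zw (j : 'I_m) x : z (val j) x = w j x by rewrite /z valK.
have zk k (km : (k < m)%N) x : z k x = w (Ordinal km) x by rewrite -zw.
exists z; split; last by move=> k km; rewrite zk w2.
apply: qd_of_dq.
  by move=> k km; have := w1 (Ordinal km); congr cac; apply/funext => x; rewrite zk.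
apply: aeS w3 => x H xab k km; have := H (Ordinal km) xab.
congr has_cderiv; first by apply/funext => t; rewrite -zk.
rewrite /A /F /dq /=.
have m0 : (0 < m)%N by lia.
have m1 : (1 < m)%N by lia.
under eq_bigr do rewrite !mulrDl mulNr -!mulrA.
rewrite big_split sumrB /= -!mulr_sumr.
have -> : \sum_i (val i == 1)%N%:R * (ci ^- m * ((Q x)%:C%C * w i x)) = ci ^- m * (Q x)%:C%C * z 1%N x.
  by rewrite (sum_delta _ (fun i => ci ^- m * ((Q x)%:C%C * w i x)) 1 m1) zk !mulrA.
have -> : \sum_i (val i == 0)%N%:R * (ci ^- m * ((Q x)%:C%C * w i x)) = ci ^- m * (Q x)%:C%C * z 0%N x.
  by rewrite (sum_delta _ (fun i => ci ^- m * ((Q x)%:C%C * w i x)) 0 m0) zk !mulrA.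
rewrite addrAC; congr (_ + _).
case: eqVneq => [k1|k1].
  under eq_bigr do rewrite -mulrA.
  by rewrite (sum_delta _ (fun i => la * w i x) 0 m0) mul1r zk addrC.
have k2 : (k.+1 < m)%N by lia.
by rewrite mul0r addr0 (sum_delta _ (fun i => w i x) _ k2) zk.
Qed.
End Operators.

Arguments ae_closed {R a b P}.
Arguments qd_cac {R a b m Q z f k}.
Arguments qdD {R a b m Q z w f g}.
Arguments qdZ {R a b m Q} c {z f}.
Arguments qd_sum {R a b m Q I} s {z f}.
Arguments qd_ae {R a b m Q z f g}.
Arguments qd_dq {R a b m Q} ab m3 {z f}.
Arguments qd_eq0 {R a b m Q} ab m3 {z f}.
Arguments qd_exists {R a b m Q} ab m3 iQ la {g} al.

(** * Green's identity *)

Section Green.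
Local Set Implicit Arguments.
Context {R : realType} {a b : R} {m : nat} {Q : R -> R}.
Context (ab : a < b) (m3 : (3 <= m)%N) (iQ : intg a b Q).

Local Notation ci := (iC R).
Local Notation qd := (qd_data m a b Q).

(* The Lagrange bracket of [z] and [w]. *)
Definition br (z w : nat -> R -> R[i]) (x : R) : R[i] :=
  \sum_(k < m) (-1) ^+ k * (z (m - 1 - k)%N x * (w k x)^*).

Lemma conj_sign (k : nat) : ((-1) ^+ k)^* = (-1) ^+ k :> R[i].
Proof. by rewrite rmorphXn /= rmorphN1. Qed.

(** The derivative of the bracket. Differentiating the left and the right factor gives T k and - T
    k.+1 up to the Q-terms, so the sum telescopes to its two ends. *)
Lemma dq_bracket (z : nat -> R -> R[i]) (f : R -> R[i]) (w : nat -> R -> R[i]) (g : R -> R[i]) (x : R) :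
  \sum_(k < m) (-1) ^+ k * (dq m Q z f (m - 1 - k)%N x * (w k x)^* +
     z (m - 1 - k)%N x * (dq m Q w g k x)^*) =
  f x * (w 0%N x)^* - (-1) ^+ m * (z 0%N x * (g x)^*).
Proof.
(* Treating [f] and [g] as entries of index [m] lets the telescoping run up to that index. *)
pose zs j := if j == m then f x else z j x.
pose ws j := if j == m then g x else w j x.
pose T k : R[i] := (-1) ^+ k * (zs (m - k)%N * (ws k)^*).
pose q : R[i] := (Q x)%:C%C.
have qJ : q^* = q by apply: cplx_ext; rewrite !cplxE /= ?oppr0.
pose F1 (k : nat) := (-1) ^+ k * (ci ^- m * q * z 1%N x * (w k x)^*).
pose F2 (k : nat) := - ((-1) ^+ k * (ci ^- m * q * z 0%N x * (w k x)^*)).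
pose F3 (k : nat) := (-1) ^+ k * (z (m - 1 - k)%N x * (ci ^+ m * q * (w 1%N x)^*)).
pose F4 (k : nat) := - ((-1) ^+ k * (z (m - 1 - k)%N x * (ci ^+ m * q * (w 0%N x)^*))).
transitivity (\sum_(k < m) ((T k - T k.+1) + ((val k == 0)%N%:R * F1 k + (val k == 1)%N%:R * F2 k +
   ((val k == m - 1)%N%:R * F3 k + (val k == m - 2)%N%:R * F4 k)))).
  apply: eq_bigr => k _; have km := ltn_ord k.
  rewrite /T /dq /zs /ws /F1 /F2 /F3 /F4 -/q.
  rewrite (_ : (m - 1 - k == m - 1)%N = (val k == 0)%N); last by apply/eqP/eqP => /=; lia.
  rewrite (_ : (m - 1 - k == m - 2)%N = (val k == 1)%N); last by apply/eqP/eqP => /=; lia.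
  rewrite (_ : (m - k == m)%N = (val k == 0)%N); last by apply/eqP/eqP => /=; lia.
  rewrite (_ : (k == m :> nat) = false); last by apply/eqP => /=; lia.
  rewrite (_ : (k.+1 == m)%N = (val k == m - 1)%N); last by apply/eqP/eqP => /=; lia.
  rewrite (_ : (m - k.+1 == m)%N = false); last by apply/eqP => /=; lia.
  rewrite (_ : (m - 1 - k).+1 = (m - k)%N); last by lia.
  rewrite (_ : (m - k.+1 = m - 1 - k)%N); last by lia.
  rewrite rmorphD rmorphB !rmorphM /= iCVX_conj qJ !rmorph_nat.
  rewrite (_ : (if val k == (m - 1)%N then g x else w k.+1 x)^* =
     (if val k == (m - 1)%N then g x else w k.+1 x)^*)//.
  by rewrite exprS; ring.
rewrite !big_split /=.
have m0 : (0 < m)%N by lia.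
have m1 : (1 < m)%N by lia.
have m2 : (m - 1 < m)%N by lia.
have m4 : (m - 2 < m)%N by lia.
have := sum_delta m (fun k => F1 k) 0 m0; rewrite /= => ->.
have := sum_delta m (fun k => F2 k) 1 m1; rewrite /= => ->.
have := sum_delta m (fun k => F3 k) (m - 1) m2; rewrite /= => ->.
have := sum_delta m (fun k => F4 k) (m - 2) m4; rewrite /= => ->.
have -> : \sum_(i < m) T i + \sum_(i < m) - T i.+1 = T 0%N - T m.
  rewrite -big_split /=.
  rewrite -(big_mkord xpredT (fun i => T i - T i.+1)).
  rewrite -[LHS]opprK -sumrN; under eq_bigr do rewrite opprB.
  by rewrite telescope_sumr// opprB.
have -> : T 0%N - T m = f x * (w 0%N x)^* - (-1) ^+ m * (z 0%N x * (g x)^*).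
  rewrite /T /zs /ws subn0 subnn eqxx (_ : (0 == m)%N = false); last by apply/eqP; lia.
  by rewrite expr0 mul1r.
(* The Q-terms cancel in pairs, F1 with F4 and F2 with F3: Q is real, and the conjugate of i^-m is
   i^m = (-1)^m i^-m. *)
rewrite -[RHS]addr0; congr (_ + _).
rewrite /F1 /F2 /F3 /F4 iCX_sign subnn (_ : (m - 1 - (m - 2) = 1)%N); last by lia.
rewrite (_ : m = (m - 3).+3); last by lia.
set p := (m - 3)%N; rewrite (_ : (p.+3 - 1 = p.+2)%N)// (_ : (p.+3 - 2 = p.+1)%N)//.
by rewrite !exprS; ring.
Qed.

Lemma br_cac z f w g : qd z f -> qd w g -> cac a b (br z w).
Proof.
move=> hz hw; apply: cac_sum => k; apply: cacM; first exact: cac_cst.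
apply: cacM; first by apply: (qd_cac hz); have := ltn_ord k; lia.
by apply: cacJ; apply: (qd_cac hw).
Qed.

Lemma green z f w g : cintg a b f -> cintg a b g -> qd z f -> qd w g ->
  cint a b (fun x => f x * (w 0%N x)^* - (-1) ^+ m * (z 0%N x * (g x)^*)) = br z w b - br z w a.
Proof.
move=> hf hg hz hw; apply: (cFTC a b (br z w) _ (ltW ab) (br_cac hz hw)).
  have m0 : (0 < m)%N by lia.
  have i1 := cintg_cacM _ _ _ _ (cacJ _ _ _ (qd_cac hw m0)) hf.
  have i2 := cintg_cacM _ _ _ _ (qd_cac hz m0) (cintgJ _ _ _ hg).
  have := cintgD _ _ _ _ i1 (cintgZ _ _ (- (-1) ^+ m) _ i2).
  by congr cintg; apply/funext => x; ring.
apply: aeS2 (qd_dq ab m3 hz) (qd_dq ab m3 hw) => x h1 h2 xab.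
rewrite -dq_bracket; apply: has_cderiv_sum => k; apply: has_cderivZ; apply: has_cderivM.
  by apply: h1 => //; have := ltn_ord k; lia.
by apply: has_cderivJ; exact: h2.
Qed.

(* [z] is the sequence of quasi-derivatives of a function that L_max maps to [v]. *)
Definition sol (z : nat -> R -> R[i]) (v : R -> R[i]) : Prop :=
  qd z (fun x => ci ^- m * v x) /\ L2 a b v.

Lemma sol_L2 z v : sol z v -> L2 a b (z 0%N).
Proof. by move=> [hz _]; apply/L2_cac/(qd_cac hz); lia. Qed.

Lemma green_ip z v w g : sol z v -> sol w g ->
  ip a b v (w 0%N) - ip a b (z 0%N) g = ci ^+ m * (br z w b - br z w a).
Proof.
move=> sz sw; have z0 := sol_L2 sz; have w0 := sol_L2 sw.
move: sz sw => [hz hv] [hw hg].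
rewrite -(green (cintgZ _ _ _ _ (L2_cintg _ _ _ hv)) (cintgZ _ _ _ _ (L2_cintg _ _ _ hg)) hz hw).
have i1 := L2_mul _ _ _ _ hv w0; have i2 := L2_mul _ _ _ _ z0 hg.
rewrite -cintZ; last first.
  have := cintgD _ _ _ _ (cintgZ _ _ (ci ^- m) _ i1) (cintgZ _ _ (- (-1) ^+ m * ci ^+ m) _ i2).
  by congr cintg; apply/funext => x; rewrite rmorphM /= iCVX_conj; ring.
rewrite /ip -[- cint _ _ _]mulN1r -cintZ// -cintD//; last exact: cintgZ.
congr cint; apply/funext => x; rewrite rmorphM /= iCVX_conj.
have e1 := iCX_unit (R := R) m.
have e2 : (-1) ^+ m * ci ^+ m * ci ^+ m = 1 :> R[i] by rewrite -iCX_sign mulrC.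
set I := ci ^+ m in e1 e2 *; set J := ci ^- m in e1 *; set s := (-1) ^+ m in e2 *.
have -> : I * (J * v x * (w 0%N x)^* - s * (z 0%N x * (I * (g x)^*))) =
  (I * J) * (v x * (w 0%N x)^*) - (s * I * I) * (z 0%N x * (g x)^*) by ring.
by rewrite e1 e2; ring.
Qed.

Definition vdot (x y : 'cV[R[i]]_m) : R[i] := \sum_(j < m) x j 0 * (y j 0)^*.

(** The layout of the boundary maps: [n] coordinates at a, [n] at b, and the middle coordinate when
    [m] is odd. *)
Lemma sum_halves (F : nat -> R[i]) (n := m./2) :
  \sum_(j < m) F j = \sum_(j < n) F j + \sum_(j < n) F (n + j)%N + (odd m)%:R * F (2 * n)%N.
Proof.
have mE : m = (n + n + odd m)%N by rewrite addnn addnC odd_double_half.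
rewrite -(big_mkord xpredT F) {1}mE big_mkord !big_split_ord /=; congr (_ + _ + _).
case: (odd m); rewrite ?big_ord1 ?big_ord0 ?mul1r ?mul0r//=.
by congr F; lia.
Qed.

(** The layout of the bracket: index k is paired with m - 1 - k, and for odd [m] the index [n] is
    its own partner. *)
Lemma sum_mirror (F : nat -> R[i]) (n := m./2) :
  \sum_(j < m) F j = \sum_(j < n) F j + \sum_(j < n) F (m - 1 - j)%N + (odd m)%:R * F n.
Proof.
have mE : m = (n + (odd m + n))%N by rewrite addnCA addnn odd_double_half.
rewrite -(big_mkord xpredT F) {1}mE big_mkord !big_split_ord /= -addrA; congr (_ + _).
rewrite addrC; congr (_ + _).
  rewrite (reindex_inj rev_ord_inj); apply: eq_bigr => i _ /=; congr F.
  by have := ltn_ord i; lia.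
by case: (odd m); rewrite ?big_ord1 ?big_ord0 ?mul1r ?mul0r//= addn0.
Qed.

(** For j < n, coordinate j receives the bracket terms of indices j and m - 1 - j at a, and
    coordinate n + j those at b. The conjugate of i^m is (-1)^m i^m, which accounts for the sign
    between the two terms of a pair. *)
Lemma Gamma_green z w : ci ^+ m * (br z w b - br z w a) =
  vdot (Gamma1 m a b z) (Gamma2 m a b w) - vdot (Gamma2 m a b z) (Gamma1 m a b w).
Proof.
pose n := m./2.
have mE : m = (odd m + n.*2)%N by rewrite odd_double_half.
pose G1 (z : nat -> R -> R[i]) (j : nat) : R[i] := ci ^+ m *
    (if (j < n)%N then (-1) ^+ j.+1 * z (m - 1 - j)%N a
     else if (j < 2 * n)%N then (-1) ^+ (j - n) * z (m - 1 - (j - n))%N b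
     else z n b + z n a).
pose ga : R[i] := (-1) ^+ n / 2 + ci.
pose de : R[i] := (-1) ^+ n.+1 / 2 + ci.
pose G2 (z : nat -> R -> R[i]) (j : nat) : R[i] :=
    (if (j < n)%N then z j a
     else if (j < 2 * n)%N then z (j - n)%N b
     else ga * z n b + de * z n a).
have G1E y (j : 'I_m) : Gamma1 m a b y j 0 = G1 y j by rewrite mxE.
have G2E y (j : 'I_m) : Gamma2 m a b y j 0 = G2 y j by rewrite mxE.
have -> : vdot (Gamma1 m a b z) (Gamma2 m a b w) = \sum_(j < m) G1 z j * (G2 w j)^*.
  by apply: eq_bigr => j _; rewrite G1E G2E.
have -> : vdot (Gamma2 m a b z) (Gamma1 m a b w) = \sum_(j < m) G2 z j * (G1 w j)^*.
  by apply: eq_bigr => j _; rewrite G1E G2E.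
rewrite (sum_halves (fun j => G1 z j * (G2 w j)^*)) (sum_halves (fun j => G2 z j * (G1 w j)^*)) -/n.
rewrite /br (sum_mirror (fun k => (-1) ^+ k * (z (m - 1 - k)%N b * (w k b)^*))).
rewrite (sum_mirror (fun k => (-1) ^+ k * (z (m - 1 - k)%N a * (w k a)^*))) -/n.
have lo (j : 'I_n) y : G1 y j = ci ^+ m * ((-1) ^+ j.+1 * y (m - 1 - j)%N a) /\ G2 y j = y j a.
  by rewrite /G1 /G2 ltn_ord.
have hi (j : 'I_n) y : G1 y (n + j)%N = ci ^+ m * ((-1) ^+ j * y (m - 1 - j)%N b) /\ G2 y (n + j)%N = y j b.
  rewrite /G1 /G2 (_ : (n + j < n)%N = false); last by apply/negP; lia.
  by rewrite (_ : (n + j < 2 * n)%N = true) ?addKn//; have := ltn_ord j; lia.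
have mi y : G1 y (2 * n)%N = ci ^+ m * (y n b + y n a) /\ G2 y (2 * n)%N = ga * y n b + de * y n a.
  rewrite /G1 /G2 (_ : (2 * n < n)%N = false); last by apply/negP; lia.
  by rewrite ltnn.
have IJ : (ci ^+ m)^* = (-1) ^+ m * ci ^+ m :> R[i] by rewrite iCX_conj iCX_sign.
set mid1 := (odd m)%:R * _; set mid2 := (odd m)%:R * _; set mid3 := (odd m)%:R * _; set mid4 := (odd m)%:R * _.
(* For odd [m] the conjugate of i^m is - i^m, so the products combine with gamma + conj gamma =
   (-1)^n at b, delta + conj delta = (-1)^(n+1) at a, and gamma + conj delta = 0 on the mixed
   terms. *)
have Hmid : ci ^+ m * (mid1 - mid2) = mid3 - mid4.
  rewrite /mid1 /mid2 /mid3 /mid4; have [e1 e2] := mi z; have [e3 e4] := mi w.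
  rewrite e1 e2 e3 e4; case E : (odd m); last by rewrite !mul0r !subrr mulr0.
  rewrite (_ : (m - 1 - n = n)%N); last by move: mE; rewrite E; lia.
  rewrite !mul1r !rmorphM !rmorphD !rmorphM /= IJ.
  have sm : (-1) ^+ m = -1 :> R[i] by rewrite -signr_odd E expr1.
  rewrite sm /ga /de !rmorphD !rmorphM /= !conj_sign iC_conj fmorphV rmorph_nat exprS.
  by field.
set X1 := \sum_(j < n) _; set X2 := \sum_(j < n) _; set X3 := \sum_(j < n) _; set X4 := \sum_(j < n) _.
set X5 := \sum_(j < n) _; set X6 := \sum_(j < n) _; set X7 := \sum_(j < n) _; set X8 := \sum_(j < n) _.
have H : ci ^+ m * (X1 + X2 - (X3 + X4)) = X5 + X6 - (X7 + X8).
  rewrite /X1 /X2 /X3 /X4 /X5 /X6 /X7 /X8 -!big_split /= -!sumrB mulr_sumr.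
  apply: eq_bigr => j _; have jn := ltn_ord j.
  have [e1 e2] := lo j z; have [e3 e4] := lo j w; have [e5 e6] := hi j z; have [e7 e8] := hi j w.
  rewrite e1 e2 e3 e4 e5 e6 e7 e8 !rmorphM /= !conj_sign IJ.
  rewrite (_ : (m - 1 - (m - 1 - j) = j)%N); last by lia.
  have -> : (-1) ^+ (m - 1 - j) = - ((-1) ^+ m * (-1) ^+ j) :> R[i].
    rewrite -exprD (_ : (m + j = (m - 1 - j) + (j.*2).+1)%N); last by lia.
    have ev : (-1) ^+ (j.*2) = 1 :> R[i] by rewrite -signr_odd odd_double.
    by rewrite exprD exprS ev; ring.
  by rewrite exprS; ring.
transitivity (ci ^+ m * (X1 + X2 - (X3 + X4)) + ci ^+ m * (mid1 - mid2)); first by ring.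
by rewrite H Hmid; ring.
Qed.
End Green.

Arguments sol {R} a b m Q z v.
Arguments br {R} m z w x.

Lemma solve_row {F : fieldType} {n : nat} (M : 'M[F]_n) :
  (forall v : 'rV_n, v *m M = 0 -> v = 0) -> forall w : 'rV_n, exists v, v *m M = w.
Proof.
move=> /inj_row_free; rewrite row_free_unit => uM w.
by exists (w *m invmx M); rewrite mulmxKV.
Qed.

Lemma sol_congr {R : realType} (a b : R) m Q z v w : sol a b m Q z v -> v = w -> sol a b m Q z w.
Proof. by move=> ? <-. Qed.

(** * Boundary data *)

Section BoundaryData.
Local Set Implicit Arguments.
Context {R : realType} {a b : R} {m : nat} {Q : R -> R}.
Context (ab : a < b) (m3 : (3 <= m)%N) (iQ : intg a b Q).

Local Notation ci := (iC R).
Local Notation qd := (qd_data m a b Q).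
Local Notation sol := (sol a b m Q).
Local Notation traj := (nat -> R -> R[i]).

Definition zadd (z w : traj) : traj := fun k x => z k x + w k x.
Definition zscale (c : R[i]) (z : traj) : traj := fun k x => c * z k x.
Definition comb {N : nat} (c : 'rV[R[i]]_N) (ka : 'I_N -> traj) : traj :=
  fun k x => \sum_(j < N) c 0 j * ka j k x.

Lemma lin_comb (V : lmodType R[i]) (rho : traj -> V) (N : nat) (c : 'rV[R[i]]_N) (ka : 'I_N -> traj) :
  (forall z w, rho (zadd z w) = rho z + rho w) ->
  (forall e z, rho (zscale e z) = e *: rho z) ->
  rho (comb c ka) = \sum_(j < N) c 0 j *: rho (ka j).
Proof.
move=> D Z; rewrite /comb; elim: (index_enum _) => [|j s IH].
  rewrite big_nil -(scale0r (rho (fun _ _ => 0))) -Z; congr rho.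
  by apply/funext => k; apply/funext => x; rewrite big_nil /zscale mul0r.
rewrite big_cons -IH -Z -D; congr rho.
by apply/funext => k; apply/funext => x; rewrite big_cons.
Qed.

Lemma Gamma1D z w : Gamma1 m a b (zadd z w) = Gamma1 m a b z + Gamma1 m a b w.
Proof. by apply/colP => j; rewrite !mxE /zadd; case: ifP => _; [|case: ifP => _]; ring. Qed.

Lemma Gamma1Z c z : Gamma1 m a b (zscale c z) = c *: Gamma1 m a b z.
Proof. by apply/colP => j; rewrite !mxE /zscale; case: ifP => _; [|case: ifP => _]; ring. Qed.

Lemma Gamma2D z w : Gamma2 m a b (zadd z w) = Gamma2 m a b z + Gamma2 m a b w.
Proof. by apply/colP => j; rewrite !mxE /zadd; case: ifP => _; [|case: ifP => _]; ring. Qed.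

Lemma Gamma2Z c z : Gamma2 m a b (zscale c z) = c *: Gamma2 m a b z.
Proof. by apply/colP => j; rewrite !mxE /zscale; case: ifP => _; [|case: ifP => _]; ring. Qed.

Lemma Gamma_ext (z w : traj) : (forall k, (k < m)%N -> z k a = w k a /\ z k b = w k b) ->
  Gamma1 m a b z = Gamma1 m a b w /\ Gamma2 m a b z = Gamma2 m a b w.
Proof.
move=> H; have n2 : (m./2 < m)%N by rewrite -divn2; lia.
have [h1 h2] := H _ n2.
split; apply/colP => j; have jm := ltn_ord j; rewrite !mxE ?h1 ?h2.
  have [e1 _] := H (m - 1 - j)%N ltac:(lia); have [_ e2] := H (m - 1 - (j - m./2))%N ltac:(lia).
  by rewrite e1 e2.
have [e1 _] := H j jm; have [_ e2] := H (j - m./2)%N ltac:(lia).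
by rewrite e1 e2.
Qed.

Definition pv (z : traj) : 'cV[R[i]]_m := Gamma1 m a b z + ci *: Gamma2 m a b z.
Definition qv (z : traj) : 'cV[R[i]]_m := Gamma1 m a b z - ci *: Gamma2 m a b z.

Lemma pvD z w : pv (zadd z w) = pv z + pv w.
Proof. by rewrite /pv Gamma1D Gamma2D scalerDr addrACA. Qed.
Lemma qvD z w : qv (zadd z w) = qv z + qv w.
Proof. by rewrite /qv Gamma1D Gamma2D scalerDr opprD addrACA. Qed.
Lemma pvZ c z : pv (zscale c z) = c *: pv z.
Proof. by rewrite /pv Gamma1Z Gamma2Z scalerDr !scalerA mulrC. Qed.
Lemma qvZ c z : qv (zscale c z) = c *: qv z.
Proof. by rewrite /qv Gamma1Z Gamma2Z scalerBr !scalerA mulrC. Qed.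

Lemma boundary_condE (K : 'M[R[i]]_m) z :
  (K - 1%:M) *m Gamma1 m a b z + ci *: ((K + 1%:M) *m Gamma2 m a b z) = K *m pv z - qv z.
Proof.
rewrite /pv /qv mulmxDr mulmxBl mulmxDl !mul1mx scalerDr -scalemxAr opprB.
by rewrite addrACA; congr (_ + _); rewrite addrC.
Qed.

Lemma Gamma_of_pq z : pv z = 0 -> qv z = 0 -> Gamma1 m a b z = 0 /\ Gamma2 m a b z = 0.
Proof.
move=> hp hq; have e1 : 2%:R *: Gamma1 m a b z = 0.
  have -> : 2%:R *: Gamma1 m a b z = pv z + qv z.
    by rewrite /pv /qv addrACA subrr addr0 scaler_nat mulr2n.
  by rewrite hp hq addr0.
have e2 : (2%:R * ci) *: Gamma2 m a b z = 0.
  have -> : (2%:R * ci) *: Gamma2 m a b z = pv z - qv z.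
    by rewrite /pv /qv opprB addrC addrA subrK -scalerA scaler_nat mulr2n.
  by rewrite hp hq subr0.
have n2 : (2 : R[i]) != 0 by rewrite pnatr_eq0.
split; apply/eqP.
  by have := e1; move/eqP; rewrite scaler_eq0 (negbTE n2).
by have := e2; move/eqP; rewrite scaler_eq0 mulf_eq0 (negbTE n2) (negbTE (iC_neq0 (R := R))).
Qed.

Lemma solD z v w g : sol z v -> sol w g -> sol (zadd z w) (fun x => v x + g x).
Proof.
move=> [z1 z2] [w1 w2]; split; last exact: L2D.
by have := qdD z1 w1; congr qd_data; apply/funext => x; rewrite mulrDr.
Qed.

Lemma solZ c z v : sol z v -> sol (zscale c z) (fun x => c * v x).
Proof.
move=> [z1 z2]; split; last exact: L2Z.
by have := qdZ c z1; congr qd_data; apply/funext => x; rewrite mulrCA.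
Qed.

Lemma sol_comb N (c : 'rV[R[i]]_N) (ka : 'I_N -> traj) (v : 'I_N -> R -> R[i]) :
  (forall j, sol (ka j) (v j)) -> sol (comb c ka) (fun x => \sum_(j < N) c 0 j * v j x).
Proof.
move=> H; split; last by apply: L2_sum => j; apply: L2Z; exact: (H j).2.
have := qd_sum (index_enum 'I_N) (fun j => qdZ (c 0 j) (H j).1).
by congr qd_data; apply/funext => x; rewrite mulr_sumr; apply: eq_bigr => j _; rewrite mulrCA.
Qed.

(** Green's identity with w = z equates the imaginary parts of (Ly, y) and of the product of Gamma1
    y with Gamma2 y; polarization expresses the latter by [pv] and [qv]. *)
Lemma energy z v : sol z v ->
  vnorm2 m (pv z) - vnorm2 m (qv z) = 4 * Im (ip a b v (z 0%N)).
Proof.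
move=> sz; have L0 := sol_L2 ab m3 sz; have Lv := sz.2.
have := green_ip ab m3 sz sz.
rewrite (Gamma_green ab m3).
rewrite (ipC _ _ _ _ Lv L0).
have -> : vdot (Gamma2 m a b z) (Gamma1 m a b z) = (vdot (Gamma1 m a b z) (Gamma2 m a b z))^*.
  by rewrite /vdot rmorph_sum; apply: eq_bigr => j _; rewrite rmorphM /= conjCK mulrC.
set X := ip a b v _; set Y := vdot _ _ => /(congr1 (@complex.Im R)); rewrite !cplxE => h.
have {h} -> : Im X = Im Y by lra.
rewrite /vnorm2 -sumrB /Y /vdot (big_morph _ (@CImD R) (erefl (Im (0 : R[i])))) mulr_sumr.
by apply: eq_bigr => j _; rewrite /pv /qv !mxE /cnorm2 !cplxE /=; ring.
Qed.

Lemma fundamental (la : R[i]) : exists ka : 'I_m -> traj,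
  (forall j, sol (ka j) (fun x => la * ka j 0%N x)) /\
  forall j k, (k < m)%N -> ka j k a = (k == j)%:R.
Proof.
have /choice[ka Hka] : forall j : 'I_m, exists z : traj,
    sol z (fun x => la * z 0%N x) /\ forall k, (k < m)%N -> z k a = (k == j)%:R.
  move=> j; have i0 : cintg a b (fun=> 0) by split; exact: intg_cst.
  have [z [hz za]] := qd_exists ab m3 iQ (ci ^- m * la) (fun k => (k == j)%:R) i0.
  exists z; split => //; split.
    by have := hz; congr qd_data; apply/funext => x; rewrite add0r mulrA.
  by apply/L2Z/L2_cac/(qd_cac hz); lia.
by exists ka; split => j; have [] := Hka j.
Qed.

(** The coefficients are the values of the combination at a, and these vanish together with its
    class. *)
Lemma comb_independent (ka : 'I_m -> traj) (v : 'I_m -> R -> R[i]) (c : 'rV[R[i]]_m) :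
  (forall j, sol (ka j) (v j)) ->
  (forall j k, (k < m)%N -> ka j k a = (k == j)%:R) ->
  nrm2 a b (comb c ka 0%N) = 0 -> c = 0.
Proof.
move=> H Ha n0; have sc := sol_comb c ka _ H.
have [h _] := qd_eq0 ab m3 sc.1 (nrm2_eq0 _ _ _ (sol_L2 ab m3 sc) n0).
apply/rowP => j; rewrite mxE; have := h j (ltn_ord j) a.
rewrite lexx ltW// => /(_ isT); rewrite /comb (bigD1 j)//= Ha ?ltn_ord// eqxx mulr1 big1 ?addr0//.
move=> i ij; rewrite Ha ?ltn_ord// (_ : (val j == i) = false) ?mulr0//.
by apply: contraNF ij => /eqP/val_inj ->.
Qed.

Arguments comb_independent {ka v c}.

Lemma comb_eigen (la : R[i]) (ka : 'I_m -> traj) (c : 'rV[R[i]]_m) :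
  (forall j, sol (ka j) (fun x => la * ka j 0%N x)) ->
  sol (comb c ka) (fun x => la * comb c ka 0%N x).
Proof.
move=> H; apply: (sol_congr _ _ _ _ _ _ _ (sol_comb c ka _ H)); apply/funext => x.
by rewrite /comb mulr_sumr; apply: eq_bigr => j _; rewrite mulrCA.
Qed.

Arguments comb_eigen {la ka} c.

(** Let L y1 = i y1 and L y2 = -i y2, and let y1 + y2 have zero boundary data. Green's identity for
    y1 + y2 against y1, then against y2, loses its mixed terms and leaves 2i |y1|^2 = 0 and -2i
    |y2|^2 = 0. *)
Lemma boundary_surjective (p q : 'cV[R[i]]_m) : exists z v, [/\ sol z v, pv z = p & qv z = q].
Proof.
have [k1 [s1 i1]] := fundamental ci; have [k2 [s2 i2]] := fundamental (- ci).
pose rho (z : traj) : 'rV_(m + m) := row_mx (pv z)^T (qv z)^T.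
have rD z w : rho (zadd z w) = rho z + rho w.
  by rewrite /rho pvD qvD [X in row_mx X _]linearD [X in row_mx _ X]linearD add_row_mx.
have rZ c z : rho (zscale c z) = c *: rho z.
  by rewrite /rho pvZ qvZ !linearZ /= scale_row_mx.
have rC (c : 'rV[R[i]]_m) ka : c *m (\matrix_j rho (ka j)) = rho (comb c ka).
  rewrite (@lin_comb _ rho _ c _ rD rZ) mulmx_sum_row; apply: eq_bigr => j _; by rewrite rowK.
pose M := col_mx (\matrix_j rho (k1 j)) (\matrix_j rho (k2 j)).
have injM (v : 'rV_(m + m)) : v *m M = 0 -> v = 0.
  rewrite -[v]hsubmxK mul_row_col !rC -rD; set c1 := lsubmx v; set c2 := rsubmx v.
  set z1 := comb c1 k1; set z2 := comb c2 k2.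
  have sz1 : sol z1 (fun x => ci * z1 0%N x) by exact: comb_eigen.
  have sz2 : sol z2 (fun x => - ci * z2 0%N x) by exact: comb_eigen.
  have sz := solD sz1 sz2; have L1 := sol_L2 ab m3 sz1; have L2' := sol_L2 ab m3 sz2.
  rewrite -[0]row_mx0 => /eq_row_mx[/(congr1 trmx) + /(congr1 trmx)].
  rewrite !trmxK !trmx0 => hp hq; have [g1 g2] := Gamma_of_pq hp hq.
  have v0 (x : 'cV[R[i]]_m) : vdot 0 x = 0.
    by rewrite /vdot big1// => j _; rewrite mxE mul0r.
  have e1 := green_ip ab m3 sz sz1; have e2 := green_ip ab m3 sz sz2.
  move: e1 e2; rewrite !(Gamma_green ab m3) g1 g2 !v0 subrr /zadd.
  have Z1 := L2Z _ _ ci _ L1; have Z2 := L2Z _ _ (- ci) _ L2'.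
  rewrite !ipDl ?ipZl ?ipZr//; try by [exact: L2D | exact: L2Z].
  rewrite !rmorphN /= !iC_conj.
  set x11 := ip a b (z1 0%N) (z1 0%N); set x21 := ip a b (z2 0%N) (z1 0%N).
  set x12 := ip a b (z1 0%N) (z2 0%N); set x22 := ip a b (z2 0%N) (z2 0%N).
  move=> e1 e2.
  have n2 : (2 * ci : R[i]) != 0 by rewrite mulf_neq0 ?pnatr_eq0// iC_neq0.
  have x0 : x11 = 0.
    by apply: (mulfI n2); rewrite mulr0 -[RHS]e1; ring.
  have y0 : x22 = 0.
    by apply: (mulfI n2); rewrite mulr0 -[RHS]oppr0 -[X in - X]e2; ring.
  have nz1 : nrm2 a b (z1 0%N) = 0 by have := ipuu a b (z1 0%N); rewrite -/x11 x0 => -[].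
  have nz2 : nrm2 a b (z2 0%N) = 0 by have := ipuu a b (z2 0%N); rewrite -/x22 y0 => -[].
  by rewrite (comb_independent s1 i1 nz1) (comb_independent s2 i2 nz2) row_mx0.
have [c Hc] := solve_row M injM (row_mx p^T q^T).
move: Hc; rewrite -[c]hsubmxK mul_row_col !rC -rD => /eq_row_mx[/(congr1 trmx) + /(congr1 trmx)].
rewrite !trmxK => hp hq.
exists (zadd (comb (lsubmx c) k1) (comb (rsubmx c) k2)).
exists (fun x => ci * comb (lsubmx c) k1 0%N x + - ci * comb (rsubmx c) k2 0%N x).
by split => //; apply: solD; exact: comb_eigen.
Qed.

(** If Ly = -iy and K p = q, the energy identity reads |p|^2 - |K p|^2 = -4 |y|^2; the left side is
    nonnegative for a contraction, so y = 0. A particular solution can hence be corrected by an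
    element of ker (L_max + i) so as to meet the boundary condition. *)
Lemma resolvent (K : 'M[R[i]]_m) (g : R -> R[i]) : mx_contraction m K -> L2 a b g ->
  exists z, sol z (fun x => g x - ci * z 0%N x) /\ K *m pv z = qv z.
Proof.
move=> cK Lg; have [ka [s1 i1]] := fundamental (- ci).
pose rho (z : traj) : 'rV_m := (K *m pv z - qv z)^T.
have rD z w : rho (zadd z w) = rho z + rho w.
  by rewrite /rho pvD qvD mulmxDr opprD addrACA linearD.
have rZ c z : rho (zscale c z) = c *: rho z.
  by rewrite /rho pvZ qvZ -scalemxAr -scalerBr linearZ.
pose M := \matrix_j rho (ka j).
have rC (c : 'rV[R[i]]_m) : c *m M = rho (comb c ka).
  rewrite (@lin_comb _ rho _ c _ rD rZ) mulmx_sum_row; apply: eq_bigr => j _; by rewrite rowK.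
have injM (c : 'rV_m) : c *m M = 0 -> c = 0.
  rewrite rC => /(congr1 trmx); rewrite trmxK trmx0 => /eqP; rewrite subr_eq0 => /eqP Kpq.
  have sc := comb_eigen c s1.
  have L0 := sol_L2 ab m3 sc.
  have := energy sc; rewrite -Kpq (ipZl _ _ _ _ _ L0 L0) ipuu => E.
  apply: (comb_independent s1 i1); have := cK (pv (comb c ka)).
  have := nrm2_ge0 a b (comb c ka 0%N); move: E; rewrite !cplxE /=; lra.
have iG : cintg a b (fun x => ci ^- m * g x) by apply: cintgZ; exact: L2_cintg.
have [zp [hz _]] := qd_exists ab m3 iQ (- (ci ^- m * ci)) (fun=> 0) iG.
have sp : sol zp (fun x => g x - ci * zp 0%N x).
  split; first by have := hz; congr qd_data; apply/funext => x; ring.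
  apply: L2B => //; apply/L2Z/L2_cac/(qd_cac hz); lia.
have [c Hc] := solve_row M injM (- rho zp).
exists (zadd zp (comb c ka)); split.
  apply: (sol_congr _ _ _ _ _ _ _ (solD sp (comb_eigen c s1))).
  by apply/funext => x; rewrite /zadd; ring.
apply/eqP; rewrite -subr_eq0; apply/eqP/trmx_inj; rewrite -/(rho _) rD -rC Hc subrr.
by rewrite trmx0.
Qed.
End BoundaryData.

Arguments pv {R} a b m z.
Arguments qv {R} a b m z.

(** * The adjoint of the minimal operator *)

Section Adjoint.
Local Set Implicit Arguments.
Context {R : realType} {a b : R} {m : nat} {Q : R -> R}.
Context (ab : a < b) (m3 : (3 <= m)%N) (iQ : intg a b Q).

Local Notation ci := (iC R).
Local Notation sol := (sol a b m Q).
Local Notation traj := (nat -> R -> R[i]).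

(* The Gram matrix of the bracket [br]. *)
Definition brmx : 'M[R[i]]_m := \matrix_(i, k) ((i == rev_ord k)%:R * (-1) ^+ k).

Lemma brmx_unit : brmx \in unitmx.
Proof.
rewrite -row_free_unit; apply/inj_row_free => v hv; apply/rowP => j; rewrite mxE.
have := congr1 (fun r : 'rV_m => r 0 (rev_ord j)) hv.
rewrite !mxE (bigD1 j)//= !mxE rev_ordK eqxx mul1r big1 => [|i ij].
  move=> /eqP; rewrite addr0 mulf_eq0 signr_eq0 orbF.
  by move=> /eqP.
by rewrite mxE rev_ordK (negbTE ij) mul0r mulr0.
Qed.

Definition cur (z : traj) (x : R) : 'rV[R[i]]_m := \row_k z k x.

Lemma br_mx z w x : br m z w x = (cur z x *m brmx *m map_mx Num.conj (cur w x)^T) 0 0.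
Proof.
rewrite /br !mxE; apply: eq_bigr => k _; rewrite !mxE (bigD1 (rev_ord k))//= !mxE eqxx.
rewrite big1 => [|i ik]; last by rewrite !mxE (negbTE ik) mul0r mulr0.
rewrite addr0 mul1r (_ : (m - 1 - k = m - k.+1)%N); last by lia.
by ring.
Qed.

(* The bracket of two elements of the kernel of L_max is constant, so the matrix Z
   of their values at [b] satisfies Z J Z^* = J with J = [brmx]; hence Z is
   invertible. *)
Lemma kernel_nondegenerate (ka : 'I_m -> traj) (w : traj) :
  (forall j, sol (ka j) (fun x => 0 * ka j 0%N x)) ->
  (forall j k, (k < m)%N -> ka j k a = (k == j)%:R) ->
  (forall j, br m w (ka j) b = 0) -> forall k, (k < m)%N -> w k b = 0.
Proof.
move=> s1 i1 Hw.
have Hba i j : br m (ka i) (ka j) b = br m (ka i) (ka j) a.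
  have := green_ip ab m3 (s1 i) (s1 j).
  have Li := sol_L2 ab m3 (s1 i); have Lj := sol_L2 ab m3 (s1 j).
  rewrite ipZr// ipZl// rmorph0 !mul0r subrr => /esym/eqP.
  by rewrite mulf_eq0 expf_eq0 (negbTE (iC_neq0 (R := R))) andbF /= subr_eq0 => /eqP.
pose Z : 'M[R[i]]_m := \matrix_(i, k) ka i k b.
pose Zs : 'M[R[i]]_m := map_mx Num.conj Z^T.
have rowZ i : row i Z = cur (ka i) b by apply/rowP => k; rewrite !mxE.
have colZ j : col j Zs = map_mx Num.conj (cur (ka j) b)^T by apply/colP => k; rewrite !mxE.
have E : Z *m brmx *m Zs = brmx.
  apply/matrixP => i j.
  have -> : (Z *m brmx *m Zs) i j = (row i Z *m brmx *m col j Zs) 0 0.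
    by rewrite -row_mul [LHS]mxE [RHS]mxE; apply: eq_bigr => k _; rewrite [row _ _ _ _]mxE [col _ _ _ _]mxE.
  rewrite rowZ colZ -br_mx Hba br_mx.
  have ai l : cur (ka l) a = delta_mx 0 l.
    by apply/rowP => k; rewrite !mxE i1 ?ltn_ord//= eqxx.
  rewrite !ai -rowE !mxE (bigD1 j)//= !mxE !eqxx rmorph1 mulr1 big1 ?addr0// => k kj.
  by rewrite !mxE (negbTE kj) rmorph0 mulr0.
have uJ : brmx *m Zs \in unitmx.
  have := brmx_unit; rewrite -{1}E -mulmxA unitmx_mul => /andP[_ //].
have w0 : cur w b *m (brmx *m Zs) = 0.
  apply/rowP => j; rewrite [RHS]mxE -[RHS](Hw j) br_mx -colZ mulmxA.
  by rewrite [LHS]mxE [RHS]mxE; apply: eq_bigr => k _; rewrite [col _ _ _ _]mxE.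
have : cur w b = 0 by rewrite -[LHS](mulmxK uJ) w0 mul0mx.
move=> c0 k km; have := congr1 (fun r : 'rV_m => r 0 (Ordinal km)) c0.
by rewrite !mxE.
Qed.

Arguments kernel_nondegenerate {ka w}.

(** The solution of L_max y = h with zero data at a is the candidate. By Green's identity,
    orthogonality of [h] to the kernel makes its brackets with the kernel vanish at b too, and these
    determine its data there. *)
Lemma range_min (ka : 'I_m -> traj) (h : R -> R[i]) :
  (forall j, sol (ka j) (fun x => 0 * ka j 0%N x)) ->
  (forall j k, (k < m)%N -> ka j k a = (k == j)%:R) ->
  L2 a b h -> (forall j, ip a b h (ka j 0%N) = 0) ->
  exists w, sol w h /\ forall k, (k < m)%N -> w k a = 0 /\ w k b = 0.
Proof.
move=> s1 i1 Lh Horth.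
have ih : cintg a b (fun x => ci ^- m * h x) by apply: cintgZ; exact: L2_cintg.
have [w [hw wa]] := qd_exists ab m3 iQ 0 (fun=> 0) ih.
have sw : sol w h.
  split => //; have := hw; congr qd_data; apply/funext => x; by rewrite mul0r addr0.
exists w; split => // k km; split; first exact: wa.
move: k km; apply: (kernel_nondegenerate s1 i1) => j.
have Lj := sol_L2 ab m3 (s1 j); have Lw := sol_L2 ab m3 sw.
have := green_ip ab m3 sw (s1 j); rewrite ipZr// Horth rmorph0 mul0r subrr => /esym/eqP.
rewrite mulf_eq0 expf_eq0 (negbTE (iC_neq0 (R := R))) andbF /= subr_eq0 => /eqP ->.
rewrite /br big1// => k _; rewrite wa ?mul0r ?mulr0//; have := ltn_ord k; lia.
Qed.

Arguments range_min {ka h}.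

(** The Gram matrix is invertible: a combination with coefficients in its kernel is orthogonal to
    itself. *)
Lemma gram_projection (ka : 'I_m -> traj) (v : 'I_m -> R -> R[i]) (h : R -> R[i]) :
  (forall j, sol (ka j) (v j)) ->
  (forall j k, (k < m)%N -> ka j k a = (k == j)%:R) ->
  L2 a b h -> exists c, forall j, ip a b (fun x => h x - comb c ka 0%N x) (ka j 0%N) = 0.
Proof.
move=> s1 i1 Lh; have Lj j := sol_L2 ab m3 (s1 j).
pose M : 'M[R[i]]_m := \matrix_(i, j) ip a b (ka i 0%N) (ka j 0%N).
have ME c j : ip a b (comb c ka 0%N) (ka j 0%N) = (c *m M) 0 j.
  rewrite /comb (ip_suml _ _ _ _ (fun i => c 0 i) (fun i => ka i 0%N) _ Lj (Lj j)) mxE.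
  by apply: eq_bigr => i _; rewrite mxE.
have injM (c : 'rV_m) : c *m M = 0 -> c = 0.
  move=> h0; apply: (comb_independent ab m3 _ _ _ s1 i1).
  have Lc : L2 a b (comb c ka 0%N) := sol_L2 ab m3 (sol_comb c ka _ s1).
  have := ipuu a b (comb c ka 0%N).
  rewrite {1}/comb (ip_suml _ _ _ _ (fun i => c 0 i) (fun i => ka i 0%N) _ Lj Lc) big1.
    by case.
  by move=> i _; rewrite (ipC _ _ _ _ Lc (Lj i)) ME h0 mxE rmorph0 mulr0.
have [c Hc] := solve_row M injM (\row_j ip a b h (ka j 0%N)).
exists c => j; have Lc : L2 a b (comb c ka 0%N) := sol_L2 ab m3 (sol_comb c ka _ s1).
have -> : (fun x => h x - comb c ka 0%N x) = (fun x => h x + (-1) * comb c ka 0%N x).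
  by apply/funext => x; rewrite mulN1r.
have Lm := L2Z _ _ (-1) _ Lc.
by rewrite ipDl// ipZl// ME Hc mxE mulN1r subrr.
Qed.

Arguments gram_projection {ka v h}.

(** Choose [z0] with L_max z0 = v. Then h = u - z0 is orthogonal to the range of L_min. Its
    component [d] orthogonal to the kernel of L_max lies in that range, so [d] is orthogonal to [h]
    and to h - d, hence to itself; thus [u] differs from [z0] by an element of the kernel. *)
Lemma adjoint_of_min (u v : R -> R[i]) : L2 a b u -> L2 a b v ->
  (forall w g, sol w g -> (forall k, (k < m)%N -> w k a = 0 /\ w k b = 0) ->
     ip a b v (w 0%N) = ip a b u g) ->
  exists2 z, sol z v & aeeq a b (z 0%N) u.
Proof.
move=> Lu Lv H.
have [ka [s1 i1]] := fundamental ab m3 iQ 0.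
have iv : cintg a b (fun x => ci ^- m * v x) by apply: cintgZ; exact: L2_cintg.
have [z0 [hz0 _]] := qd_exists ab m3 iQ 0 (fun=> 0) iv.
have sz0 : sol z0 v.
  split => //; have := hz0; congr qd_data; apply/funext => x; by rewrite mul0r addr0.
have Lz0 := sol_L2 ab m3 sz0.
pose h x := u x - z0 0%N x.
have Lh : L2 a b h by exact: L2B.
have [c Hc] := gram_projection s1 i1 Lh.
pose k := comb c ka.
have sk : sol k (fun x => 0 * k 0%N x) by exact: comb_eigen.
have Lk := sol_L2 ab m3 sk.
pose d x := h x - k 0%N x.
have Ld : L2 a b d by exact: L2B.
have [w [sw wz]] := range_min s1 i1 Ld Hc.
have Lw := sol_L2 ab m3 sw.
have e1 : ip a b h d = 0.
  have -> : h = (fun x => u x + (-1) * z0 0%N x) by apply/funext => x; rewrite mulN1r.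
  have Lm := L2Z _ _ (-1) _ Lz0.
  rewrite ipDl// ipZl// -(H w d sw wz) mulN1r.
  rewrite (green_ip ab m3 sz0 sw) /br !big1 ?subrr ?mulr0// => j _.
    by rewrite (wz j (ltn_ord j)).1 rmorph0 !mulr0.
  by rewrite (wz j (ltn_ord j)).2 rmorph0 !mulr0.
have e2 : ip a b (k 0%N) d = 0.
  rewrite (ipC _ _ _ _ Ld Lk).
  have -> : ip a b d (k 0%N) = 0; last by rewrite rmorph0.
  rewrite (ipC _ _ _ _ Lk Ld) /k /comb.
  rewrite (ip_suml _ _ _ _ (fun i => c 0 i) (fun i => ka i 0%N) _ (fun j => sol_L2 ab m3 (s1 j)) Ld).
  rewrite big1 ?rmorph0// => j _.
  by rewrite (ipC _ _ _ _ Ld (sol_L2 ab m3 (s1 j))) Hc rmorph0 mulr0.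
have nd : nrm2 a b d = 0.
  have : ip a b d d = 0.
    rewrite {1}(_ : d = (fun x => h x + (-1) * k 0%N x)); last by apply/funext => x; rewrite mulN1r.
    have Lm := L2Z _ _ (-1) _ Lk.
    by rewrite ipDl// ipZl// e1 e2 mulr0 addr0.
  by rewrite ipuu => -[].
exists (zadd z0 k).
  by apply: (sol_congr _ _ _ _ _ _ _ (solD sz0 sk)); apply/funext => x; rewrite mul0r addr0.
apply: aeS (nrm2_eq0 _ _ _ Ld nd) => x Hx xab; have := Hx xab.
rewrite /d /h /zadd => /eqP; rewrite subr_eq0 subr_eq addrC => /eqP ->.
by [].
Qed.
End Adjoint.

(** * Contractions *)

(** Among the square matrices with row space inside [S], one of maximal rank spans [S]: a vector of
    [S] outside its row space would raise the rank. *)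
Lemma subspace_matrix {F : fieldType} {n : nat} (S : 'rV[F]_n -> Prop) :
  S 0 -> (forall x y, S x -> S y -> S (x + y)) -> (forall c x, S x -> S (c *: x)) ->
  exists r (B : 'M[F]_(r, n)), [/\ row_free B, forall c, S (c *m B) & forall x, S x -> exists c, x = c *m B].
Proof.
move=> S0 SD SZ.
have Scomb k (A : 'M[F]_(k, n)) : (forall i, S (row i A)) -> forall c, S (c *m A).
  move=> H c; rewrite mulmx_sum_row; elim: (index_enum _) => [|i s IH]; first by rewrite big_nil.
  by rewrite big_cons; apply: SD => //; exact: SZ.
pose P k := `[< exists B : 'M[F]_n, (forall c, S (c *m B)) /\ \rank B = k >].
have P0 : exists k, P k.
  exists 0%N; apply/asboolP; exists 0; split; last exact: mxrank0.
  by move=> c; rewrite mulmx0.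
have Pn k : P k -> (k <= n)%N by move=> /asboolP[B [_ <-]]; exact: rank_leq_col.
case: (ex_maxnP P0 Pn) => k /asboolP[B [SB rB]] kmax.
have SBx x : S x -> (x <= B)%MS.
  move=> Sx; apply: contraT => xB.
  have SC c : S (c *m col_mx B x).
    rewrite -[c]hsubmxK mul_row_col; apply: SD => //.
    by rewrite [rsubmx c]mx11_scalar mul_scalar_mx; exact: SZ.
  pose C := <<col_mx B x>>%MS.
  have : (\rank C <= k)%N.
    apply: kmax; apply/asboolP; exists C; split => // c.
    have /submxP[d ->] : (c *m C <= col_mx B x)%MS by rewrite (submx_trans (submxMl _ _)) ?genmxE.
    exact: SC.
  rewrite mxrank_gen -rB => hr.
  have BC : (B <= col_mx B x)%MS by rewrite -addsmxE addsmxSl.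
  have := mxrank_leqif_sup BC => -[_ /esym]; rewrite eqn_leq hr (mxrankS BC) /= => h.
  by move: xB; rewrite (submx_trans _ h) // -addsmxE addsmxSr.
exists (\rank B), (row_base B); split; first exact: row_base_free.
  move=> c; have /submxP[d ->] : (c *m row_base B <= B)%MS by rewrite (submx_trans (submxMl _ _)) ?eq_row_base.
  exact: SB.
by move=> x /SBx; rewrite -(eq_row_base B) => /submxP.
Qed.

Section Contractions.
Local Set Implicit Arguments.
Context {R : realType}.

Definition ctr {p q : nat} (A : 'M[R[i]]_(p, q)) : 'M[R[i]]_(q, p) := map_mx Num.conj A^T.

Lemma ctrM p q r (A : 'M[R[i]]_(p, q)) (B : 'M[R[i]]_(q, r)) : ctr (A *m B) = ctr B *m ctr A.
Proof. by rewrite /ctr trmx_mul map_mxM. Qed.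

Lemma ctrK p q (A : 'M[R[i]]_(p, q)) : ctr (ctr A) = A.
Proof. by apply/matrixP => i j; rewrite !mxE conjCK. Qed.

Lemma ctrD p q (A B : 'M[R[i]]_(p, q)) : ctr (A + B) = ctr A + ctr B.
Proof. by apply/matrixP => i j; rewrite !mxE rmorphD. Qed.

Lemma vnorm2_ge0 p (v : 'cV[R[i]]_p) : 0 <= vnorm2 p v.
Proof. by apply: sumr_ge0 => j _; exact: cnorm2_ge0. Qed.

Lemma vnorm2_eq0 p (v : 'cV[R[i]]_p) : vnorm2 p v = 0 -> v = 0.
Proof.
move=> /eqP; rewrite psumr_eq0 => [/allP H|j _]; last exact: cnorm2_ge0.
apply/colP => j; rewrite mxE; apply: cnorm2_eq0; apply/eqP.
by have := H j; rewrite mem_index_enum => /(_ isT).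
Qed.

Lemma vnorm2_ctr p (x : 'rV[R[i]]_p) : (vnorm2 p x^T)%:C%C = (x *m ctr x) 0 0.
Proof.
rewrite mxE (rmorph_sum (real_complex R)) /=; apply: eq_bigr => j _.
by rewrite !mxE cnorm2E.
Qed.

(** The pairs are encoded as rows of length 2m, with basis [B] split into [Bl] and [T]. Since |q| <=
    |p|, p = 0 forces q = 0, so the rows of [Bl] remain independent and p determines q. [K] projects
    orthogonally onto the possible p and then applies this map. *)
Lemma contraction_extension (m : nat) (S : 'cV[R[i]]_m -> 'cV[R[i]]_m -> Prop) : S 0 0 ->
  (forall p q p' q', S p q -> S p' q' -> S (p + p') (q + q')) ->
  (forall c p q, S p q -> S (c *: p) (c *: q)) ->
  (forall p q, S p q -> vnorm2 m q <= vnorm2 m p) ->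
  exists2 K : 'M[R[i]]_m, mx_contraction m K & forall p q, S p q -> K *m p = q.
Proof.
move=> S0 SD SZ Sle.
pose S' (r : 'rV[R[i]]_(m + m)) := S (lsubmx r)^T (rsubmx r)^T.
have [|||r [B [fB SB BS]]] := @subspace_matrix _ _ S'.
- by rewrite /S' !linear0.
- by move=> x y; rewrite /S' !linearD; exact: SD.
- by move=> c x; rewrite /S' !linearZ; exact: SZ.
pose Bl := lsubmx B; pose T := rsubmx B.
have SBl (c : 'rV_r) : S (c *m Bl)^T (c *m T)^T.
  by have := SB c; rewrite /S' -{1 2}(hsubmxK B) mul_mx_row row_mxKl row_mxKr.
have injBl (c : 'rV_r) : c *m Bl = 0 -> c = 0.
  move=> h; have := Sle _ _ (SBl c); rewrite h trmx0.
  have -> : vnorm2 m (0 : 'cV[R[i]]_m) = 0.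
    by rewrite /vnorm2 big1// => j _; rewrite mxE /cnorm2 /= expr0n /= addr0.
  move=> le0; have T0 : (c *m T)^T = 0.
    by apply: vnorm2_eq0; have := vnorm2_ge0 (c *m T)^T; lra.
  have cB : c *m B = 0.
    rewrite -(hsubmxK B) mul_mx_row -/Bl -/T h -[c *m T]trmxK T0 trmx0; exact: row_mx0.
  exact: (row_free_inj fB (etrans cB (esym (mul0mx _ B)))).
pose H := Bl *m ctr Bl.
have uH : H \in unitmx.
  rewrite -row_free_unit; apply/inj_row_free => c hc; apply: injBl.
  apply: trmx_inj; rewrite trmx0; apply: vnorm2_eq0.
  have := vnorm2_ctr (c *m Bl); rewrite ctrM mulmxA -[c *m Bl *m _]mulmxA hc mul0mx mxE.
  by case.
(* A right inverse of [Bl] for which [X *m Bl] is the orthogonal projection onto the row space of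
   [Bl]. *)
pose X := ctr Bl *m invmx H.
have BlX : Bl *m X = 1%:M by rewrite /X mulmxA mulmxV.
exists (X *m T)^T; last first.
  move=> p q Spq; have [|c Hc] := BS (row_mx p^T q^T).
    by rewrite /S' row_mxKl row_mxKr !trmxK.
  move: Hc; rewrite -(hsubmxK B) mul_mx_row -/Bl -/T => /eq_row_mx[hp hq].
  apply: trmx_inj; rewrite trmx_mul trmxK hp hq -mulmxA (mulmxA Bl) BlX mul1mx.
  by [].
move=> p; pose c := p^T *m X.
have -> : (X *m T)^T *m p = (c *m T)^T.
  by rewrite /c -mulmxA [RHS]trmx_mul trmxK.
apply: le_trans (Sle _ _ (SBl c)) _.
(* [y] is the projection of [p^T] and [d] the remainder; Pythagoras gives |y| <= |p|. *)
pose y := c *m Bl; pose d := p^T - y.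
have dB : d *m ctr Bl = 0.
  have e : c *m Bl *m ctr Bl = p^T *m ctr Bl.
    by rewrite -mulmxA -/H /c /X -!mulmxA mulVmx// mulmx1.
  by rewrite /d mulmxBl /y e subrr.
have dy : d *m ctr y = 0 by rewrite /y ctrM mulmxA dB mul0mx.
have yd : y *m ctr d = 0.
  have : ctr (d *m ctr y) = 0 by rewrite dy; apply/matrixP => i j; rewrite !mxE rmorph0.
  by rewrite ctrM ctrK.
have E : p^T *m ctr p^T = y *m ctr y + d *m ctr d.
  have -> : p^T = y + d by rewrite /d addrC subrK.
  by rewrite ctrD mulmxDl !mulmxDr dy yd add0r addr0.
have := congr1 (fun A : 'M[R[i]]_1 => A 0 0) E; rewrite [RHS]mxE -!vnorm2_ctr trmxK -rmorphD /=.
move=> [->]; rewrite lerDl; exact: vnorm2_ge0.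
Qed.
End Contractions.

(** * Maximal dissipative extensions *)

Section MaximalDissipative.
Local Set Implicit Arguments.
Context {R : realType} {a b : R} {m : nat} {Q : R -> R}.
Context (ab : a < b) (m3 : (3 <= m)%N) (iQ : intg a b Q).

Local Notation ci := (iC R).
Local Notation sol := (sol a b m Q).
Local Notation traj := (nat -> R -> R[i]).

Lemma Lmax_dataP u v z f : Lmax_data m a b Q u v z f ->
  [/\ sol z v, aeeq a b (z 0%N) u & L2 a b u].
Proof.
move=> [Lu [Lv [hz [zu vf]]]]; split => //; split => //.
apply: (qd_ae hz); apply: aeS vf => x Hx xab; rewrite (Hx xab) mulrA mulrC.
by rewrite [_ * ci ^+ m]mulrC iCX_unit mulr1.
Qed.

Lemma sol_Lmax_data u v z : sol z v -> L2 a b u -> aeeq a b (z 0%N) u ->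
  Lmax_data m a b Q u v z (fun x => ci ^- m * v x).
Proof.
move=> [hz Lv] Lu zu; split => //; split => //; split => //; split => //.
rewrite (_ : (fun x => ci ^+ m * (ci ^- m * v x)) = v); first exact: aeeq_refl.
by apply/funext => x; rewrite mulrA iCX_unit mul1r.
Qed.

Lemma LKP K u v : LK m a b Q K u v <->
  exists z, [/\ sol z v, aeeq a b (z 0%N) u, L2 a b u & K *m pv a b m z = qv a b m z].
Proof.
split=> [[z [f [D]]]|[z [sz zu Lu Kpq]]].
  rewrite boundary_condE => /eqP; rewrite subr_eq0 => /eqP Kpq.
  by have [sz zu Lu] := Lmax_dataP D; exists z.
exists z, (fun x => ci ^- m * v x); split; first exact: sol_Lmax_data.
by rewrite boundary_condE Kpq subrr.
Qed.

Lemma sol_aeeq z v v' : sol z v -> L2 a b v' -> aeeq a b v v' -> sol z v'.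
Proof.
move=> [hz Lv] Lv' vv'; split => //; apply: (qd_ae hz).
by apply: aeS vv' => x H /H ->.
Qed.

(** Boundary data and the value of L_max depend only on the class: [qd_eq0] for the difference. *)
Lemma sol_unique z v w g : sol z v -> sol w g -> aeeq a b (z 0%N) (w 0%N) ->
  (forall k, (k < m)%N -> z k a = w k a /\ z k b = w k b) /\ aeeq a b v g.
Proof.
move=> sz sw zw; have sd := solD sz (solZ (-1) sw).
have d0 : aeeq a b (zadd z (zscale (-1) w) 0%N) (fun=> 0).
  by apply: aeS zw => x H /H; rewrite /zadd /zscale => ->; rewrite mulN1r subrr.
have [h1 h2] := qd_eq0 ab m3 sd.1 d0; split.
  move=> k km; have ha := h1 k km a; have hb := h1 k km b.
  move: ha hb; rewrite !lexx (ltW ab) => /(_ isT) ha /(_ isT) hb.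
  move/eqP: ha; move/eqP: hb; rewrite /zadd /zscale !mulN1r !subr_eq0 => /eqP -> /eqP ->.
  by [].
apply: aeS h2 => x H xab; have /eqP := H xab.
rewrite mulf_eq0 invr_eq0 expf_eq0 (negbTE (iC_neq0 (R := R))) andbF /= mulN1r subr_eq0.
by move=> /eqP.
Qed.

Lemma pq_ext (z w : traj) : (forall k, (k < m)%N -> z k a = w k a /\ z k b = w k b) ->
  pv a b m z = pv a b m w /\ qv a b m z = qv a b m w.
Proof. by move=> /(Gamma_ext ab m3)[h1 h2]; rewrite /pv /qv h1 h2. Qed.

Arguments pq_ext {z w}.

Lemma pq0 (z : traj) : (forall k, (k < m)%N -> z k a = 0 /\ z k b = 0) ->
  pv a b m z = 0 /\ qv a b m z = 0.
Proof.
move=> H; have [|h1 h2] := @pq_ext z (zscale 0 z).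
  by move=> k km; have [h1 h2] := H k km; rewrite /zscale !mul0r.
by rewrite h1 h2 pvZ qvZ !scale0r.
Qed.

Arguments pq0 {z}.

Lemma sol0 : sol (fun _ _ => 0) (fun=> 0).
Proof.
split; last exact: L2_0.
by have := qd0 a b m Q; congr qd_data; apply/funext => x; rewrite mulr0.
Qed.

Lemma LK_is_operator K : is_operator a b (LK m a b Q K).
Proof.
split; [|split; [|split; [|split; [|split]]]].
- by move=> u v /LKP[z [[_ Lv] _ Lu _]].
- move=> u v u' v' /LKP[z [sz zu Lu Kpq]] Lu' Lv' uu' vv'; apply/LKP; exists z; split => //.
    exact: sol_aeeq sz Lv' vv'.
  exact: aeeq_trans zu uu'.
- apply/LKP; exists (fun _ _ => 0); split; [exact: sol0|exact: aeeq_refl|exact: L2_0|].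
  by have [|-> ->] := @pq0 (fun _ _ => 0); rewrite ?mulmx0.
- move=> u v u' v' /LKP[z [sz zu Lu Kpq]] /LKP[w [sw wu Lu' Kpq']]; apply/LKP.
  exists (zadd z w); split; [exact: solD| |exact: L2D|].
    by apply: aeS2 zu wu => x h1 h2 xab; rewrite /zadd (h1 xab) (h2 xab).
  by rewrite pvD qvD mulmxDr Kpq Kpq'.
- move=> c u v /LKP[z [sz zu Lu Kpq]]; apply/LKP.
  exists (zscale c z); split; [exact: solZ| |exact: L2Z|].
    by apply: aeS zu => x h1 xab; rewrite /zscale (h1 xab).
  by rewrite pvZ qvZ -scalemxAr Kpq.
- move=> u v v' /LKP[z [sz zu _ _]] /LKP[w [sw wu _ _]].
  by have [] := sol_unique sz sw (aeeq_trans _ _ _ _ _ zu (aeeq_sym _ _ _ _ wu)).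
Qed.

Lemma dissipative_ipE (u v : R -> R[i]) : L2 a b u -> L2 a b v ->
  (0 <= \int[@lebesgue_measure R]_(x in `[a, b]) (complex.Im (v x * (u x)^*))%:E)%E <->
  0 <= Im (ip a b v u).
Proof.
move=> Lu Lv; have [_ iI] := L2_mul _ _ _ _ Lv Lu.
rewrite -lee_fin /ip /cint /= /rint /Rintegral fineK//.
exact: integrable_fin_num.
Qed.

Lemma energy_ge0 K z v : mx_contraction m K -> sol z v -> K *m pv a b m z = qv a b m z ->
  0 <= Im (ip a b v (z 0%N)).
Proof. by move=> cK sz Kpq; have := energy ab m3 sz; have := cK (pv a b m z); rewrite Kpq; lra. Qed.

Lemma ip_aer (u u' v : R -> R[i]) : L2 a b u -> L2 a b u' -> L2 a b v -> aeeq a b u u' ->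
  ip a b v u = ip a b v u'.
Proof.
move=> Lu Lu' Lv uu'; rewrite (ipC _ _ _ _ Lu Lv) (ipC _ _ _ _ Lu' Lv).
by rewrite (ae_ip _ _ _ _ _ Lu Lu' Lv uu').
Qed.

Lemma LK_dissipative K : mx_contraction m K -> dissipative a b (LK m a b Q K).
Proof.
move=> cK; have [oL [_ [G00 [oD [oZ _]]]]] := LK_is_operator K; split; last first.
  move=> u v /LKP[z [sz zu Lu Kpq]]; have Lz := sol_L2 ab m3 sz; have Lv := sz.2.
  apply/(dissipative_ipE Lu Lv); rewrite -(ip_aer Lz Lu Lv zu).
  exact: energy_ge0 cK sz Kpq.
move=> w Lw e e0; pose D u := exists v, LK m a b Q K u v.
have [|||||u [v Guv] h] := dense_of_orthogonal a b D _ _ _ _ _ w Lw e e0.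
- by move=> u [v /oL[]].
- by exists (fun=> 0).
- by move=> u u' [v h] [v' h']; exists (fun x => v x + v' x); exact: oD.
- by move=> c u [v h]; exists (fun x => c * v x); exact: oZ.
(* With z in the domain and L z + iz = g, orthogonality of [g] to z leaves Im (L z, z) = -|z|^2.
   Dissipativity forces z = 0, and then g = 0. *)
- move=> g Lg Hg; have [z [sz Kpq]] := resolvent ab m3 iQ cK Lg.
  have Lz := sol_L2 ab m3 sz; have Lv := sz.2.
  have e1 : ip a b g (z 0%N) = 0.
    by apply: Hg; exists (fun x => g x - ci * z 0%N x); apply/LKP; exists z; split => //; exact: aeeq_refl.
  have := energy_ge0 cK sz Kpq.
  have -> : (fun x => g x - ci * z 0%N x) = (fun x => g x + (- ci) * z 0%N x).
    by apply/funext => x; ring.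
  have Lm := L2Z _ _ (- ci) _ Lz.
  rewrite ipDl// ipZl// e1 ipuu !cplxE /= => h.
  have n0 : nrm2 a b (z 0%N) = 0 by have := nrm2_ge0 a b (z 0%N); lra.
  have z0 := nrm2_eq0 _ _ _ Lz n0.
  have [_ v0] := sol_unique sz sol0 z0.
  have g0 : aeeq a b g (fun=> 0).
    apply: aeS2 v0 z0 => x h1 h2 xab; have := h1 xab; rewrite (h2 xab).
    by rewrite mulr0 subr0.
  rewrite -(aeeq_nrm2 _ _ _ _ Lg (L2_0 a b) g0).
  by congr nrm2; apply/funext => x; rewrite subr0.
exists u, v; split => //.
have Lu := (oL _ _ Guv).1; have /L2P[_ _ i1] := L2B _ _ _ _ Lw Lu.
by move: h; rewrite -lte_fin /nrm2 /rint /Rintegral fineK//; exact: integrable_fin_num.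
Qed.

Lemma LK_maximal K : mx_contraction m K -> maximal_dissipative a b (LK m a b Q K).
Proof.
move=> cK; split; first exact: LK_is_operator.
split; first exact: LK_dissipative.
move=> G' [oL [_ [_ [oD [oZ _]]]]] [_ dG] sub u v Guv.
have [Lu Lv] := oL _ _ Guv.
have Lg := L2D _ _ _ _ Lv (L2Z _ _ ci _ Lu).
(* This [z] solves L_K z + iz = v + iu. The extension then maps d = u - z to -i d, and its
   dissipativity gives -|d|^2 >= 0, so u = z. *)
have [z [sz Kpq]] := resolvent ab m3 iQ cK Lg.
have Lz := sol_L2 ab m3 sz; have Lv' := sz.2.
set v' := (fun x => _) in sz Lv'.
have Kz : LK m a b Q K (z 0%N) v' by apply/LKP; exists z; split => //; exact: aeeq_refl.
have Gd := oD _ _ _ _ Guv (oZ (-1) _ _ (sub _ _ Kz)).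
have [Ld Ldv] := oL _ _ Gd.
have := dG _ _ Gd => /(dissipative_ipE Ld Ldv).
have -> : (fun x => v x + -1 * v' x) = (fun x => (- ci) * (u x + -1 * z 0%N x)).
  by apply/funext => x; rewrite /v'; ring.
rewrite ipZl// ipuu !cplxE /= => h.
have n0 : nrm2 a b (fun x => u x + -1 * z 0%N x) = 0.
  by have := nrm2_ge0 a b (fun x => u x + -1 * z 0%N x); lra.
have d0 := nrm2_eq0 _ _ _ Ld n0.
have zu : aeeq a b (z 0%N) u.
  apply: aeS d0 => x H xab; have /eqP := H xab; rewrite mulN1r subr_eq0 => /eqP ->.
  by [].
have vv : aeeq a b v' v by apply: aeS zu => x H xab; rewrite /v' (H xab); ring.
exact: (LK_is_operator K).2.1 Kz Lu Lv zu vv.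
Qed.

Lemma Lmin_sub_LK K : op_extends (Lmin m a b Q) (LK m a b Q K).
Proof.
move=> u v [z [f [D H]]]; have [sz zu Lu] := Lmax_dataP D; apply/LKP; exists z; split => //.
by have [-> ->] := pq0 H; rewrite mulmx0.
Qed.

(** Some [y] has boundary pair (p, K1 p) for any given p; it lies in the domain of the first
    operator, and membership in the second says K2 p = K1 p. *)
Lemma LK_injective (K1 K2 : 'M[R[i]]_m) : same_op (LK m a b Q K1) (LK m a b Q K2) -> K1 = K2.
Proof.
move=> H; have E (p : 'cV_m) : K1 *m p = K2 *m p.
  have [z [v [sz <- hq]]] := boundary_surjective ab m3 iQ p (K1 *m p).
  have Lz := sol_L2 ab m3 sz.
  have : LK m a b Q K1 (z 0%N) v.
    by apply/LKP; exists z; split => //; exact: aeeq_refl.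
  move=> /H /LKP[w [sw wz _ Kpq]].
  have [h _] := sol_unique sw sz wz; have [h1 h2] := pq_ext h.
  by move: Kpq; rewrite h1 h2 => ->; rewrite hq.
apply/matrixP => i j; have := congr1 (fun A : 'cV_m => A i 0) (E (delta_mx j 0)).
by rewrite -!colE !mxE.
Qed.

(** For [w] in the domain of L_min the number (Lw, w) is real, so Im (G (u + la w), u + la w) is
    affine in la over the reals. Being nonnegative, it is constant, and this says (v, w) = (u,
    Lw). *)
Lemma dissipative_sub_max (G : op R) : is_operator a b G -> dissipative a b G ->
  op_extends (Lmin m a b Q) G -> forall u v, G u v ->
  exists2 z, sol z v & aeeq a b (z 0%N) u.
Proof.
move=> [oL [_ [_ [oD [oZ _]]]]] [_ dG] sub u v Guv; have [Lu Lv] := oL _ _ Guv.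
apply: (adjoint_of_min ab m3 iQ) => // w g sw wz.
have Lw := sol_L2 ab m3 sw; have Lg := sw.2.
have Gw : G (w 0%N) g.
  apply: sub; exists w, (fun x => ci ^- m * g x); split => //.
  by apply: sol_Lmax_data => //; exact: aeeq_refl.
have e0 : Im (ip a b g (w 0%N)) = 0.
  have := energy ab m3 sw; have [-> ->] := pq0 wz; lra.
set X := ip a b v (w 0%N); set Y := ip a b u g.
set A := Im (ip a b v u).
have H (la : R[i]) : 0 <= A + Im (la * (Y - X)^*).
  have Gl := oD _ _ _ _ Guv (oZ la _ _ Gw); have [L1 L2'] := oL _ _ Gl.
  have := dG _ _ Gl => /(dissipative_ipE L1 L2').
  have Llw := L2Z _ _ la _ Lw; have Llg := L2Z _ _ la _ Lg.
  rewrite ipDl// !ipDr// !ipZl// !ipZr// -/X.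
  rewrite (ipC _ _ _ _ Lu Lg) -/Y; move: e0; set W := ip a b g (w 0%N).
  rewrite /A; set V := ip a b v u; move: V W X Y => V W X Y hW.
  rewrite !cplxE hW; congr (0 <= _); ring.
suff : cnorm2 (Y - X) = 0 by move=> /cnorm2_eq0/eqP; rewrite subr_eq0 => /eqP.
set Z := Y - X in H *; have c0 := cnorm2_ge0 Z.
have Ht (t : R) : t * cnorm2 Z <= A.
  (* The multiplier -i t Z makes the linear term equal to -t |Z|^2. *)
  have := H ((- t)%:C%C * 'i%C * Z); move: (Z) => z; rewrite /cnorm2 !cplxE /=.
  nra.
apply/eqP; apply: contraT => n0; have p0 : 0 < cnorm2 Z by rewrite lt_neqAle eq_sym n0.
(* This value of t would give A + 1 <= A. *)
have := Ht ((A + 1) / cnorm2 Z); rewrite divfK//; lra.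
Qed.

Lemma maximal_dissipative_LK (G : op R) : op_extends (Lmin m a b Q) G ->
  maximal_dissipative a b G ->
  exists2 K : 'M[R[i]]_m, mx_contraction m K & same_op G (LK m a b Q K).
Proof.
move=> sub [oG [dG maxG]]; have := oG => -[oL [_ [G00 [oD [oZ _]]]]].
have Gmax := dissipative_sub_max oG dG sub.
pose S p q := exists u v z, [/\ G u v, sol z v, aeeq a b (z 0%N) u & pv a b m z = p /\ qv a b m z = q].
have [||||K cK HK] := @contraction_extension R m S.
- exists (fun=> 0), (fun=> 0), (fun _ _ => 0); split => //; [exact: sol0|exact: aeeq_refl|].
  exact: pq0.
- move=> p q p' q' [u [v [z [Guv sz zu [<- <-]]]]] [u' [v' [z' [Guv' sz' zu' [<- <-]]]]].
  exists (fun x => u x + u' x), (fun x => v x + v' x), (zadd z z'); split.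
  + exact: oD.
  + exact: solD.
  + by apply: aeS2 zu zu' => x h1 h2 xab; rewrite /zadd (h1 xab) (h2 xab).
  + by rewrite pvD qvD.
- move=> c p q [u [v [z [Guv sz zu [<- <-]]]]].
  exists (fun x => c * u x), (fun x => c * v x), (zscale c z); split.
  + exact: oZ.
  + exact: solZ.
  + by apply: aeS zu => x h1 xab; rewrite /zscale (h1 xab).
  + by rewrite pvZ qvZ.
(* Through [energy], dissipativity of [G] is the inequality |q| <= |p| on its boundary pairs. *)
- move=> p q [u [v [z [Guv sz zu [<- <-]]]]]; have [Lu Lv] := oL _ _ Guv.
  have Lz := sol_L2 ab m3 sz.
  have := dG.2 _ _ Guv => /(dissipative_ipE Lu Lv); rewrite -(ip_aer Lz Lu Lv zu).
  by have := energy ab m3 sz; lra.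
exists K => //.
have GK : op_extends G (LK m a b Q K).
  move=> u v Guv; have [z sz zu] := Gmax _ _ Guv; apply/LKP; exists z; split => //.
    exact: (oL _ _ Guv).1.
  by apply: HK; exists u, v, z.
have KG := maxG _ (LK_is_operator K) (LK_dissipative cK) GK.
by move=> u v; split; [exact: GK|exact: KG].
Qed.
End MaximalDissipative.

Theorem theorem5 (R : realType) (a b : R) (m : nat) (Q : R -> R) :
  a < b -> (3 <= m)%N ->
  (@lebesgue_measure R).-integrable `[a, b] (EFin \o Q) ->
  (forall K : 'M[R[i]]_m, mx_contraction m K ->
     op_extends (Lmin m a b Q) (LK m a b Q K) /\
     maximal_dissipative a b (LK m a b Q K)) /\
  (forall G : op R, op_extends (Lmin m a b Q) G -> maximal_dissipative a b G ->
     exists2 K : 'M[R[i]]_m, mx_contraction m K & same_op G (LK m a b Q K)) /\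
  (forall K1 K2 : 'M[R[i]]_m, mx_contraction m K1 -> mx_contraction m K2 ->
     same_op (LK m a b Q K1) (LK m a b Q K2) -> K1 = K2).
Proof.
move=> ab m3 iQ; split; [|split].
- by move=> K cK; split; [exact: Lmin_sub_LK|exact: LK_maximal].
- by move=> G; exact: maximal_dissipative_LK.
- by move=> K1 K2 _ _; exact: LK_injective.
Qed.
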